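(* Let $D=\{D_j\}_{j=1}^n$ be a partition of $\{1,\dots,d\}$, $d_j:=|D_j|$, $\Gamma=\prod_{j=1}^n\Gamma^{(j)}$ with $\Gamma^{(j)}\subset\mathbb{R}^{d_j}$, let $\pi=\prod_{j=1}^n\pi^{(j)}$ be a product probability distribution on $\Gamma$, and let $\boldsymbol\beta\in\mathbb{R}^n$ with $\beta_j>d_j/2$. Let $q\in H^{\boldsymbol\beta}_D(\Gamma)$ and let $q_N\in H^{\boldsymbol\beta}_D(\Gamma)$, $N\in\{1,2,\dots\}$, satisfy, for some $\kappa>0$, $$\|q-q_N\|_{H^{\boldsymbol\beta}_D(\Gamma)}\lesssim_N N^{-\kappa}.$$ For $j\in\{1,\dots,n\}$ let $\mathcal{I}^{(j)}_N\colon H^{\beta_j}(\Gamma^{(j)})\to\mathbb{R}$ be quadrature rules using $N$ point evaluations such that $$\Big\|\int_{\Gamma^{(j)}}\cdot\;d\pi^{(j)}-\mathcal{I}^{(j)}_N\Big\|_{H^{\beta_j}(\Gamma^{(j)})\to\mathbb{R}}\lesssim_N N^{-\beta_j/d_j}.$$ Assume that obtaining a sample $q_N(y)$, $y\in\Gamma$ (one call of the PDE solver), requires computational work $\tau\lesssim_N N^\gamma$ with $\gamma>0$. Let $E[q]=\int_\Gamma q\,d\pi$ and let $\mathcal{S}_L=\mathcal{S}_L(E[q])$ be Smolyak's algorithm with work parameters $(1,\dots,1,\gamma)$ and convergence parameters $(\beta_1/d_1,\dots,\beta_n/d_n,\kappa)$ (see context). Then for all sufficiently small $\epsilon>0$ one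 can choose $L$ such that $$|E[q]-\mathcal{S}_L|\le\epsilon$$ with computational work bounded by $$\mathrm{Work}(\mathcal{S}_L)\lesssim_\epsilon\epsilon^{-\rho}|\log\epsilon|^{(1+\rho)(n_0-1)},$$ where $\rho:=\max\{d_1/\beta_1,\dots,d_n/\beta_n,\gamma/\kappa\}$ and $n_0$ is the number of the $n+1$ entries $d_1/\beta_1,\dots,d_n/\beta_n,\gamma/\kappa$ that attain this maximum.
   Context: $A\lesssim_x B$ means $A\le cB$ with $c$ independent of $x$. $\|A\|_{H\to G}$ denotes the operator norm. Sobolev spaces: for a partition $D=\{D_j\}_{j=1}^n$ of $\{1,\dots,d\}$ and $\boldsymbol\beta\in[0,\infty)^n$, $H^{\boldsymbol\beta}_D(\mathbb{R}^d)$ is the Hilbert space of $f\in L^2(\mathbb{R}^d)$ with $\|f\|_{H^{\boldsymbol\beta}_D(\mathbb{R}^d)}:=\|\prod_{j=1}^n(1+|\omega_{D_j}|_2^2)^{\beta_j/2}\hat f\|_{L^2(\mathbb{R}^d)}<\infty$, where $\omega_{D_j}$ collects the components of $\omega$ with indices in $D_j$. For $\Gamma\subset\mathbb{R}^d$, $H^{\boldsymbol\beta}_D(\Gamma)$ is the space of restrictions to $\Gamma$ with norm $\inf_{g|_\Gamma=f}\|g\|_{H^{\boldsymbol\beta}_D(\mathbb{R}^d)}$. $H^\beta$ is the isotropic case $n=1$, $D_1=\{1,\dots,d\}$. In $\Gamma=\prod_j\Gamma^{(j)}$ the coordinates with indices in $D_j$ range over $\Gamma^{(j)}$. For $\beta_j>d_j/2$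 one has $H^{\boldsymbol\beta}_D(\Gamma)=\bigotimes_{j}H^{\beta_j}(\Gamma^{(j)})$ (Hilbert tensor product), so bounded functionals on the factors have a tensor product that is a bounded functional on $H^{\boldsymbol\beta}_D(\Gamma)$. Origin of $q$: for parameters $y\in\Gamma$ consider a partial differential equation $P_y(u_y)=f_y$ with unique solution $u_y$, and a real-valued quantity of interest $Q$; then $q(y)=Q(u_y)$, and $q_N(y)=Q(u_{y,N})$ for the output $u_{y,N}$ of a numerical solver with $N$ mesh points. Smolyak's algorithm for $E[q]=\mathcal{M}(\int_{\Gamma^{(1)}}d\pi^{(1)},\dots,\int_{\Gamma^{(n)}}d\pi^{(n)},q)$, where $\mathcal{M}(\lambda^{(1)},\dots,\lambda^{(n)},h):=(\bigotimes_{j=1}^n\lambda^{(j)})h$: for $l\ge1$ let $N^{(j)}_l:=\lceil\exp(l/(1+\beta_j/d_j))\rceil$ ($1\le j\le n$) and $N^{(n+1)}_l:=\lceil\exp(l/(\gamma+\kappa))\rceil$; let $\Delta^{(j)}_l:=\mathcal{I}^{(j)}_{N^{(j)}_l}-\mathcal{I}^{(j)}_{N^{(j)}_{l-1}}$ ($1\le j\le n$) and $\Delta^{(n+1)}_l:=q_{N^{(n+1)}_l}-q_{N^{(n+1)}_{l-1}}$, with the terms for level $l-1=0$ set to $0$; and $$\mathcal{S}_L:=\sum_{\boldsymbol l\in\{1,2,\dots\}^{n+1},\ l_1+\dots+l_{n+1}\le L}\mathcal{M}(\Delta^{(1)}_{l_1},\dots,\Delta^{(n)}_{l_n},\Delta^{(n+1)}_{l_{n+1}}).$$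 Work: quadrature points and weights are assumed precomputed. Evaluating $\mathcal{M}(\mathcal{I}^{(1)}_{N^{(1)}},\dots,\mathcal{I}^{(n)}_{N^{(n)}},q_{N^{(n+1)}})$ is assigned the work $(\prod_{j=1}^nN^{(j)})(N^{(n+1)})^\gamma$, i.e. (up to a constant) the work of $\prod_{j=1}^nN^{(j)}$ calls of the PDE solver with $N^{(n+1)}$ mesh points; $\mathrm{Work}(\mathcal{S}_L)$ is the sum of the works of all such terms obtained by expanding the differences in $\mathcal{S}_L$. *)

(* Defs.v *)
From HB Require Import structures.
From mathcomp Require Import all_boot all_order all_algebra.
From mathcomp Require Import complex.
From mathcomp Require Import all_classical all_reals all_analysis.

Set Implicit Arguments.
Unset Strict Implicit.
Unset Printing Implicit Defensive.

Import Order.TTheory GRing.Theory Num.Theory numFieldNormedType.Exports.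

Local Open Scope classical_set_scope.
Local Open Scope ring_scope.
Local Open Scope complex_scope.

(* R^d is the type d.-tuple R, with the Borel sigma-algebra generated by the
   coordinates; indices run over 'I_d = {0, ..., d-1}. *)

Section lebesgue_tuple.
Variable R : realType.

Section step.
Variables (leb : {sigma_finite_measure set (measurableTypeR R) -> \bar R}).
Variables (d : nat) (mu : {sigma_finite_measure set (d.-tuple R) -> \bar R}).

Definition cons_pair (p : measurableTypeR R * d.-tuple R) : d.+1.-tuple R :=
  [tuple of (p.1 : R) :: p.2].

Definition uncons_pair (t : d.+1.-tuple R) : measurableTypeR R * d.-tuple R :=
  (tnth t ord0, [tuple of behead t]).

Lemma cons_pairK : cancel cons_pair uncons_pair.
Proof. by case=> a t; congr pair => //; apply: val_inj. Qed.

Lemma measurable_cons_pair : measurable_fun [set: measurableTypeR R * d.-tuple R] cons_pair.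
Proof. exact: (measurable_cons measurable_fst measurable_snd). Qed.

Lemma measurable_uncons_pair : measurable_fun [set: d.+1.-tuple R] uncons_pair.
Proof.
apply: measurable_fun_pair; first exact: measurable_tnth.
exact: measurable_behead.
Qed.

Definition lebesgue_cons : set (d.+1.-tuple R) -> \bar R :=
  pushforward (leb \x mu)%E cons_pair.

Let lebesgue_cons_isMeasure : isMeasure _ _ R lebesgue_cons.
Proof.
split.
- by rewrite /lebesgue_cons /pushforward preimage_set0 measure0.
- by move=> A; rewrite /lebesgue_cons /pushforward measure_ge0.
- move=> F mF tF mUF; rewrite /lebesgue_cons /pushforward preimage_bigcup.
  have mpre A : measurable A -> measurable (cons_pair @^-1` A).
    by move=> mA; rewrite -[X in measurable X]setTI; exact: measurable_cons_pair.
  apply: measure_semi_sigma_additive => [k||]; [exact: mpre| |].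
    apply/trivIsetP => i j _ _ ij; rewrite -preimage_setI.
    by move/trivIsetP : tF => /(_ _ _ _ _ ij) ->//; rewrite preimage_set0.
  by rewrite -preimage_bigcup; exact: mpre.
Qed.

HB.instance Definition _ := lebesgue_cons_isMeasure.


Let lebesgue_cons_sigma_finite : sigma_finite setT lebesgue_cons.
Proof.
have /sigma_finiteP[F [TF ndF Foo]] := sigma_finiteT leb.
have /sigma_finiteP[G [TG ndG Goo]] := sigma_finiteT mu.
exists (fun k => uncons_pair @^-1` (F k `*` G k)).
  apply/esym; rewrite -subTset => t _.
  have [i _ Fi] : (\bigcup_i F i) (uncons_pair t).1 by rewrite -TF.
  have [j _ Gj] : (\bigcup_j G j) (uncons_pair t).2 by rewrite -TG.
  exists (maxn i j) => //; split.
    by move: Fi; exact/subsetPset/ndF/leq_maxl.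
  by move: Gj; exact/subsetPset/ndG/leq_maxr.
move=> k; have [mFk Fk] := Foo k; have [mGk Gk] := Goo k; split.
  rewrite -[X in measurable X]setTI; apply: measurable_uncons_pair => //.
  exact: measurableX.
rewrite /lebesgue_cons /pushforward -comp_preimage.
rewrite (_ : uncons_pair \o cons_pair = id); last first.
  by apply/funext => p /=; rewrite cons_pairK.
by rewrite preimage_id product_measure1E// lte_mul_pinfty// ge0_fin_numE.
Qed.

HB.instance Definition _ := Measure_isSigmaFinite.Build _ _ _ lebesgue_cons
  lebesgue_cons_sigma_finite.

End step.

Fixpoint lebesgue_tuple (d : nat) :
    {sigma_finite_measure set (d.-tuple R) -> \bar R} :=
  match d with
  | 0 => \d_([tuple] : 0.-tuple R)
  | d'.+1 => lebesgue_cons (@lebesgue_measure R) (lebesgue_tuple d')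
  end.

End lebesgue_tuple.

Section sobolev.
Variable R : realType.

Definition Rd_continuous d (g : d.-tuple R -> R) : Prop :=
  continuous (fun v : 'rV[R]_d => g [tuple v ord0 i | i < d]).

Section fourier.
Variable d : nat.
Local Notation leb := (lebesgue_tuple R d).

Definition L2norm (f : d.-tuple R -> R) : \bar R := 'N[leb]_2%:E[EFin \o f]%E.

Definition dotp (x y : d.-tuple R) : R := \sum_(i < d) tnth x i * tnth y i.

(* Unitary normalisation, angular frequency:
   (2 pi)^(-d/2) \int u(x) exp(- i omega . x) dx. *)
Definition fourier (u : d.-tuple R -> R) (omega : d.-tuple R) : R[i] :=
  let c := (2 * pi) `^ (- (d%:R / 2)) in
  (c * \int[leb]_x (u x * cos (dotp omega x))) +i*
  (- (c * \int[leb]_x (u x * sin (dotp omega x)))).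

(* The functions F representing the Fourier transform of f in L^2, which is the
   extension by continuity of [fourier] from L^1 `&` L^2. They agree almost
   everywhere; there are none when f is not in L^2. *)
Definition fourierL2 (f : d.-tuple R -> R) : set (d.-tuple R -> R[i]) :=
  [set F : d.-tuple R -> R[i] | [/\ f \in Lfun leb 2%:E,
     measurable_fun setT (fun omega => complex.Re (F omega)),
     measurable_fun setT (fun omega => complex.Im (F omega)) &
     exists u : nat -> d.-tuple R -> R,
     [/\ (forall k, u k \in Lfun leb 1%:E /\ u k \in Lfun leb 2%:E),
         L2norm (fun x => u k x - f x) @[k --> \oo] --> 0%E &
         L2norm (fun omega => Normc.normc (fourier (u k) omega - F omega))
           @[k --> \oo] --> 0%E]]].

End fourier.

Section anisotropic.
Variables (d n : nat) (D : 'I_n -> {set 'I_d}) (beta : 'I_n -> R).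

Definition sobolev_weight (omega : d.-tuple R) : R :=
  \prod_(j < n) (1 + \sum_(i in D j) tnth omega i ^+ 2) `^ (beta j / 2).

(* The infimum is over the almost everywhere equal versions of the Fourier
   transform of f; it is +oo when f is not in L^2. *)
Definition sobolev_norm (f : d.-tuple R -> R) : \bar R :=
  ereal_inf [set L2norm (fun omega =>
    sobolev_weight omega * Normc.normc (F omega)) | F in fourierL2 f].

(* Norm of the restriction space on Gamma; only the values of f on Gamma
   matter, and the norm is +oo when f is not such a restriction. Elements of
   the space on R^d are restricted to Gamma, which may be a null set, through
   their continuous representatives: these exist when beta_j > |D_j| / 2, the
   only case in which this norm is to be used. Extensions g are real-valued;
   complex ones would give the same infimum, as the weight is even. *)
Definition sobolev_norm_on (Gamma : set (d.-tuple R)) (f : d.-tuple R -> R) :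
    \bar R :=
  ereal_inf [set sobolev_norm g | g in
    [set g | Rd_continuous g /\ {in Gamma, g =1 f}]].

Definition sobolev_on (Gamma : set (d.-tuple R)) : set (d.-tuple R -> R) :=
  [set f | (sobolev_norm_on Gamma f < +oo)%E].

End anisotropic.

Definition iso_norm_on d (beta : R) : set (d.-tuple R) -> (d.-tuple R -> R) ->
    \bar R :=
  sobolev_norm_on (fun _ : 'I_1 => [set: 'I_d]%SET) (fun=> beta).

Definition opnorm (X : Type) (norm : (X -> R) -> \bar R)
    (lambda : (X -> R) -> R) : \bar R :=
  ereal_sup [set `|lambda f|%:E | f in [set f | (norm f <= 1)%E]].

End sobolev.

Section blocks.
Variables (R : realType) (d n : nat) (D : 'I_n -> {set 'I_d}).

Definition block_partition : Prop :=
  injective D /\ finset.partition [set D j | j : 'I_n]%SET [set: 'I_d]%SET.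

(* Coordinates of y with indices in B, in increasing order. *)
Definition get_block (B : {set 'I_d}) (y : d.-tuple R) : #|B|.-tuple R :=
  [tuple tnth y (enum_val k) | k < #|B|].

(* y with its coordinates with indices in B replaced by those of z. *)
Definition set_block (B : {set 'I_d}) (y : d.-tuple R) (z : #|B|.-tuple R) :
    d.-tuple R :=
  [tuple if i \in B then nth 0 z (index i (enum B)) else tnth y i | i < d].

Definition prod_domain (Gamma : forall j, set (#|D j|.-tuple R)) :
    set (d.-tuple R) :=
  [set y | forall j, Gamma j (get_block (D j) y)].

Definition is_product_measure (P_ : forall j, probability (#|D j|.-tuple R) R)
    (P : probability (d.-tuple R) R) : Prop :=
  forall A : forall j, set (#|D j|.-tuple R), (forall j, measurable (A j)) ->
  P (prod_domain A) = (\prod_(j < n) P_ j (A j))%E.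

(* Tensor product of functionals: each lambda_j is applied to the j-th block of
   variables, the others being fixed. All blocks get replaced, so the starting
   point 0 is irrelevant. *)
Definition tensor (lambda : forall j, (#|D j|.-tuple R -> R) -> R)
    (h : d.-tuple R -> R) : R :=
  foldr (fun j g y => lambda j (fun z => g (set_block y z)))
    h (enum 'I_n) [tuple 0 | i < d].

Lemma get_set_block (B : {set 'I_d}) y (z : #|B|.-tuple R) :
  get_block B (set_block y z) = z.
Proof.
apply: eq_from_tnth => k; rewrite !tnth_mktuple enum_valP.
rewrite (tnth_nth 0) {1}(enum_val_nth (enum_val k)) index_uniq ?enum_uniq //.
by rewrite -cardE.
Qed.

Lemma get_set_block_disjoint (B C : {set 'I_d}) y (z : #|B|.-tuple R) :
  [disjoint C & B]%B -> get_block C (set_block y z) = get_block C y.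
Proof.
move=> CB; apply: eq_from_tnth => k; rewrite !tnth_mktuple.
by rewrite (disjointFr CB) // enum_valP.
Qed.

Lemma block_partition_disjoint : block_partition ->
  forall j k, j != k -> [disjoint D j & D k]%B.
Proof.
move=> [Dinj /and3P[_ /finset.trivIsetP Dtriv _]] j k jk.
apply: Dtriv; [exact: imset_f|exact: imset_f|].
by apply: contra_neq jk => /Dinj.
Qed.

(* [tensor] has the defining property of a tensor product of functionals. *)
Lemma tensor_prod (lambda : forall j, (#|D j|.-tuple R -> R) -> R)
    (f : forall j, #|D j|.-tuple R -> R) :
  block_partition ->
  (forall j a g, lambda j (fun z => a * g z) = a * lambda j g) ->
  tensor lambda (fun y => \prod_(j < n) f j (get_block (D j) y)) =
  \prod_(j < n) lambda j (f j).
Proof.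
move=> /block_partition_disjoint Ddisj lambdaZ; rewrite /tensor.
set y0 := [tuple 0 | _ < d].
have prodE (s : seq 'I_n) y : uniq s ->
    foldr (fun j g y => lambda j (fun z => g (set_block y z)))
      (fun y => \prod_(j < n) f j (get_block (D j) y)) s y =
    \prod_(j < n) if j \in s then lambda j (f j) else f j (get_block (D j) y).
  elim: s y => [|j s IHs] y /=; first by [].
  move=> /andP[js us].
  rewrite (_ : (fun z => _) = fun z =>
      (\prod_(k < n | k != j) if k \in s then lambda k (f k)
                              else f k (get_block (D k) y)) * f j z).
    rewrite lambdaZ [RHS](bigD1 j) //= mem_head mulrC; congr (_ * _).
    by apply: eq_bigr => k kj; rewrite inE (negPf kj).
  apply/funext => z; rewrite IHs // (bigD1 j) //= (negPf js) get_set_block mulrC.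
  congr (_ * _); apply: eq_bigr => k kj.
  by rewrite get_set_block_disjoint ?Ddisj.
rewrite prodE ?enum_uniq //; apply: eq_bigr => j _.
by rewrite mem_enum.
Qed.

End blocks.

Definition is_quadrature (R : realType) m (Gamma : set (m.-tuple R)) (N : nat)
    (Q : (m.-tuple R -> R) -> R) : Prop :=
  exists (x : 'I_N -> m.-tuple R) (w : 'I_N -> R),
    (forall k, Gamma (x k)) /\ forall f, Q f = \sum_(k < N) w k * f (x k).

Section smolyak.
Variables (R : realType) (d n : nat) (D : 'I_n -> {set 'I_d}).
Variables (beta : 'I_n -> R) (kappa gamma : R).

(* The ceiling is positive, so the absolute value only casts it to nat. *)
Definition level (r : R) (l : nat) : nat := `|Num.ceil (expR (l%:R / r))|%N.

Definition quad_level (j : 'I_n) : nat -> nat :=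
  level (1 + beta j / #|D j|%:R).

Definition sample_level : nat -> nat := level (gamma + kappa).

(* a_(N_l) - a_(N_(l-1)) for l >= 1, the term of level 0 being 0. *)
Definition level_diff (V : zmodType) (a : nat -> V) (N : nat -> nat) (l : nat) :
    V :=
  a (N l) - (if (1 < l)%N then a (N l.-1) else 0).

Definition admissible L (l : {ffun 'I_n -> 'I_L.+1} * 'I_L.+1) : bool :=
  [&& [forall j, (0 < l.1 j)%N], (0 < l.2)%N & (\sum_j l.1 j + l.2 <= L)%N].

Definition smolyak (Q : forall j, nat -> (#|D j|.-tuple R -> R) -> R)
    (qN : nat -> d.-tuple R -> R) (L : nat) : R :=
  \sum_(l : {ffun 'I_n -> 'I_L.+1} * 'I_L.+1 | admissible l)
    tensor (fun j => level_diff (Q j) (quad_level j) (l.1 j))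
           (level_diff qN sample_level l.2).

(* [cost N] is the work of one call of the solver with N mesh points. In each
   term of the Smolyak sum the differences are expanded: e tells which factors
   are taken at the lower level, where terms of level 0 do not occur. *)
Definition smolyak_work (cost : nat -> R) (L : nat) : R :=
  \sum_(l : {ffun 'I_n -> 'I_L.+1} * 'I_L.+1 | admissible l)
    \sum_(e : {ffun 'I_n -> bool} * bool |
          [forall j, (e.1 j < l.1 j)%N] && (e.2 < l.2)%N)
      (\prod_(j < n) (quad_level j (l.1 j - e.1 j))%:R) *
      cost (sample_level (l.2 - e.2)).

Definition work_rates : seq R :=
  gamma / kappa :: [seq #|D j|%:R / beta j | j <- enum 'I_n].

Definition smolyak_rho : R := \big[Num.max/0]_(r <- work_rates) r.

Definition smolyak_n0 : nat := count_mem smolyak_rho work_rates.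

End smolyak.

(* Main.v *)
Require Import Defs.

From mathcomp Require Import all_boot all_order all_algebra.
From mathcomp Require Import complex ring lra.
From mathcomp Require Import all_classical all_reals all_analysis measurable_realfun.

Set Implicit Arguments.
Unset Strict Implicit.
Unset Printing Implicit Defensive.

Import Order.TTheory GRing.Theory Num.Theory numFieldNormedType.Exports.

Local Open Scope classical_set_scope.
Local Open Scope ring_scope.

(** The error of the Smolyak sum is read off on the frequency side.

    A function [h] of the restricted Sobolev space has an extension [g] that is
    continuous, and Fourier inversion writes the values of [h] on the domain
    as an absolutely convergent superposition of plane waves:
      h(y) = int Re (Z(w) e^(i w.y)) dw,  with W Z square integrable,
    where [W] is the Sobolev weight ([fourier_inversion], [frep_of_norm]).
    A tensor product of functionals acts on a plane wave by the product of the
    symbols L_j(w_j) = lambda_j (e^(i w_j.z)), so that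
      tensor lambda h = int Re (Z(w) prod_j L_j(w_j)) dw  ([tensor_fourier]).
    Since W factorises over the blocks, Cauchy-Schwarz bounds this integral by
    the weighted norm of [Z] times the product of the numbers
      (int (1 + |w|^2)^(-beta_j) |L_j(w)|^2 dw)^(1/2)  ([tensor_bound]).
    Up to the Fourier constant, these numbers are the operator norms of the
    [lambda_j]: testing [lambda_j] on its own Riesz representer shows that they
    are controlled by the operator norm ([dualsq_opnorm]).  This requires the
    Fourier transform, as defined by L^2 approximation, of the representer; it
    is computed by damping the representer with exp (- e |x|_1)
    ([synth_fourierL2]).  The expectation is itself the tensor product of the
    integrals over the blocks, because replacing a block of a random point by
    an independent copy preserves a product distribution
    ([expectation_fourier]).

    For the Smolyak sum, every approximation sequence is completed by a last
    level L+1 at which it is exact.  Increments between consecutive levels then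
    telescope, the expectation is the sum of the terms over all multi-indices
    with entries at most L+1, and E - S_L is exactly the part of this sum with
    |l| > L ([smolyak_remainder]).  The term of multi-index l is at most a
    constant times prod_i exp (- r_i l_i), where r_i = 1 / (1 + rho_i) and the
    rho_i are the rates d_j / beta_j and gamma / kappa; the work of the term is
    at most a constant times prod_i exp ((1 - r_i) l_i).

    Both sums are governed by the directions with the largest rate rho.  Put
    r = 1 / (1 + rho), and write exp (- r_i l_i) = exp (- r l_i) y_i^l_i with
    y_i <= 1 and y_i = 1 exactly in the n_0 extremal directions.  Summing over
    multi-indices of fixed sum and then over the sum costs a factor L for every
    extremal direction but one, which gives an error exp (- r L) L^(n_0 - 1)
    and a work exp (rho r L) L^(n_0 - 1) ([smolyak_tail], [smolyak_head]).  The
    least L for which the error bound is at most epsilon has the stated cost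
    ([choose_level]). *)

(** * Real-valued integrals *)

Section real_integrals.
Context dd (T : measurableType dd) (R : realType).
Variable mu : {measure set T -> \bar R}.
Implicit Types f g h : T -> R.

Definition intgr f := mu.-integrable setT (EFin \o f).

Lemma intgr_meas f : intgr f -> measurable_fun setT f.
Proof. by move=> /measurable_int /measurable_EFinP. Qed.

Lemma intgr_dom g f : intgr g -> measurable_fun setT f ->
  (forall x, `|f x| <= g x) -> intgr f.
Proof.
move=> ig mf fg; apply: le_integrable ig => //; first exact/measurable_EFinP.
by move=> x _ /=; rewrite lee_fin (le_trans (fg x))// ler_norm.
Qed.

Lemma intgrD f g : intgr f -> intgr g -> intgr (fun x => f x + g x).
Proof.
move=> fi gi; have := integrableD measurableT fi gi.
by apply: eq_integrable => // x _ /=; rewrite EFinD.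
Qed.

Lemma intgrB f g : intgr f -> intgr g -> intgr (fun x => f x - g x).
Proof.
move=> fi gi; have := integrableB measurableT fi gi.
by apply: eq_integrable => // x _ /=; rewrite EFinD.
Qed.

Lemma intgrZ k f : intgr f -> intgr (fun x => k * f x).
Proof.
move=> fi; have := integrableZl measurableT k fi.
by apply: eq_integrable => // x _ /=; rewrite EFinM.
Qed.

Lemma intgrN f : intgr f -> intgr (fun x => - f x).
Proof.
move=> fi; have := intgrZ (-1) fi; apply: eq_integrable => // x _ /=.
by rewrite mulN1r.
Qed.

Lemma intgr0 : intgr (fun=> 0).
Proof. exact: integrable0. Qed.

Lemma intgr_norm f : intgr f -> intgr (fun x => `|f x|).
Proof. by move=> fi; exact: integrable_norm. Qed.

Lemma intgrM M f g : intgr f -> measurable_fun setT g ->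
  (forall x, `|g x| <= M) -> intgr (fun x => f x * g x).
Proof.
move=> fi mg gM; apply: (@intgr_dom (fun x => M * `|f x|)).
- exact/intgrZ/intgr_norm.
- by apply: measurable_funM => //; exact: intgr_meas.
- by move=> x; rewrite normrM mulrC ler_wpM2r.
Qed.

Lemma intgr_sum (I : eqType) (s : seq I) (P : pred I) (F : I -> T -> R) :
  (forall i, i \in s -> P i -> intgr (F i)) ->
  intgr (fun x => \sum_(i <- s | P i) F i x).
Proof.
elim: s => [|i s IHs] Fi.
  have -> : (fun x => \sum_(i <- [::] | P i) F i x) = (fun=> 0).
    by apply/funext => x; rewrite big_nil.
  exact: intgr0.
have IH : intgr (fun x => \sum_(i <- s | P i) F i x).
  by apply: IHs => j js; apply: Fi; rewrite inE js orbT.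
have [Pi|Pi] := boolP (P i); last first.
  suff -> : (fun x => \sum_(i <- (i :: s) | P i) F i x) = (fun x => \sum_(i <- s | P i) F i x) by [].
  by apply/funext => x; rewrite big_cons (negPf Pi).
suff -> : (fun x => \sum_(i <- (i :: s) | P i) F i x) = (fun x => F i x + \sum_(i <- s | P i) F i x).
  by apply: intgrD => //; apply: Fi => //; rewrite mem_head.
by apply/funext => x; rewrite big_cons Pi.
Qed.

Lemma Rint_sum (I : eqType) (s : seq I) (P : pred I) (F : I -> T -> R) :
  (forall i, i \in s -> P i -> intgr (F i)) ->
  \int[mu]_x (\sum_(i <- s | P i) F i x) = \sum_(i <- s | P i) \int[mu]_x F i x.
Proof.
elim: s => [|i s IHs] Fi.
  rewrite big_nil.
  under eq_Rintegral do rewrite big_nil.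
  by rewrite Rintegral_cst// mul0r.
have Fs j : j \in s -> P j -> intgr (F j).
  by move=> js; apply: Fi; rewrite inE js orbT.
rewrite big_cons -IHs//.
have [Pi|Pi] := boolP (P i); last first.
  by under eq_Rintegral do rewrite big_cons (negPf Pi).
under eq_Rintegral do rewrite big_cons Pi.
by rewrite RintegralD//; [apply: Fi => //; rewrite mem_head|exact: intgr_sum].
Qed.

Lemma Rint_EFin f : intgr f -> (\int[mu]_x f x)%:E = (\int[mu]_x (f x)%:E)%E.
Proof. by move=> fi; rewrite /Rintegral fineK//; exact: integrable_fin_num. Qed.

Lemma intgr_le f g : intgr f -> intgr g -> (forall x, f x <= g x) ->
  \int[mu]_x f x <= \int[mu]_x g x.
Proof. by move=> fi gi fg; apply: le_Rintegral. Qed.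

Lemma le_norm_Rint f g : intgr g -> measurable_fun setT f ->
  (forall x, `|f x| <= g x) -> `|\int[mu]_x f x| <= \int[mu]_x g x.
Proof.
move=> gi mf fg; have fi : intgr f by exact: intgr_dom fg.
rewrite (le_trans (le_normr_Rintegral _ _))//.
by apply: le_Rintegral => //; exact: intgr_norm.
Qed.

Lemma ge0_intgr f (c : \bar R) : measurable_fun setT f -> (forall x, 0 <= f x) ->
  (\int[mu]_x (f x)%:E <= c)%E -> (c < +oo)%E -> intgr f.
Proof.
move=> mf f0 fc coo; apply/integrableP; split; first exact/measurable_EFinP.
rewrite (le_lt_trans _ coo)// (le_trans _ fc)//.
rewrite le_eqVlt; apply/orP; left; apply/eqP.
by apply: eq_integral => x _ /=; rewrite ger0_norm.
Qed.

Lemma Rdominated (f_ : nat -> T -> R) f g :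
  (forall n, measurable_fun setT (f_ n)) ->
  (forall x, f_ n x @[n --> \oo] --> f x) -> intgr g ->
  (forall n x, `|f_ n x| <= g x) ->
  intgr f /\ \int[mu]_x f_ n x @[n --> \oo] --> \int[mu]_x f x.
Proof.
move=> mf_ f_f gi fg.
have mf : measurable_fun setT f.
  by apply: (measurable_fun_cvg mf_) => x _; exact: f_f.
have [|||||fi _ cv] := @dominated_convergence _ _ _ mu setT measurableT
  (fun n => EFin \o f_ n) (EFin \o f) (EFin \o g).
- by move=> n; exact/measurable_EFinP.
- exact/measurable_EFinP.
- by apply/nearW => x _; apply: cvg_EFin; [exact: nearW|exact: f_f].
- exact: gi.
- by apply/nearW => x n _ /=; rewrite lee_fin.
split=> //; rewrite /Rintegral; apply: fine_cvg.
by rewrite fineK//; exact: integrable_fin_num.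
Qed.

Lemma intgrM2 f g : measurable_fun setT f -> measurable_fun setT g ->
  intgr (fun x => f x ^+ 2) -> intgr (fun x => g x ^+ 2) ->
  intgr (fun x => f x * g x).
Proof.
move=> mf mg fi gi; apply: (intgr_dom (intgrD fi gi)).
  exact: measurable_funM.
move=> x; rewrite normrM -(real_normK (num_real (f x))) -(real_normK (num_real (g x))).
set a := `|f x|; set b := `|g x|.
have a0 : 0 <= a by exact: normr_ge0.
have b0 : 0 <= b by exact: normr_ge0.
nra.
Qed.

Lemma Rint_CauchySchwarz f g : measurable_fun setT f -> measurable_fun setT g ->
  intgr (fun x => f x ^+ 2) -> intgr (fun x => g x ^+ 2) ->
  (\int[mu]_x (f x * g x)) ^+ 2 <=
  (\int[mu]_x (f x ^+ 2)) * (\int[mu]_x (g x ^+ 2)).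
Proof.
move=> mf mg fi gi; have fgi := intgrM2 mf mg fi gi.
set A := \int[mu]_x (f x ^+ 2); set B := \int[mu]_x (g x ^+ 2).
set C := \int[mu]_x (f x * g x).
have A0 : 0 <= A by apply: Rintegral_ge0 => x _; exact: sqr_ge0.
have B0 : 0 <= B by apply: Rintegral_ge0 => x _; exact: sqr_ge0.
have key s t : 0 <= s ^+ 2 * A + 2 * s * t * C + t ^+ 2 * B.
  have <- : \int[mu]_x ((s * f x + t * g x) ^+ 2) = s ^+ 2 * A + 2 * s * t * C + t ^+ 2 * B.
    rewrite /A /B /C -!RintegralZl//.
    rewrite -RintegralD//; [|exact: intgrZ..].
    rewrite -RintegralD//; [|by apply: intgrD; exact: intgrZ|exact: intgrZ].
    by apply: eq_Rintegral => x _; ring.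
  by apply: Rintegral_ge0 => x _; exact: sqr_ge0.
have k1 := key (- C) A.
(* The quadratic form [key] at (- C, A) gives the claim when A > 0; when A = 0
   it is affine in s and hence can only be nonnegative if C = 0. *)
have [A1|A1] := ltrP 0 A.
  have : 0 <= A * (A * B - C ^+ 2) by move: k1; nra.
  by rewrite pmulr_rge0// subr_ge0.
have {}A1 : A = 0 by apply/eqP; rewrite eq_le A1 A0.
rewrite A1 mul0r.
have [->|C0] := eqVneq C 0; first by rewrite expr0n.
have := key (- (B + 1) / (2 * C)) 1; rewrite A1 mulr0 add0r.
have -> : 2 * (- (B + 1) / (2 * C)) * 1 * C = - (B + 1) by field.
lra.
Qed.

End real_integrals.

(** * Fubini's theorem for real-valued functions *)

Section fubini_real.
Context d1 d2 (T1 : measurableType d1) (T2 : measurableType d2) (R : realType).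
Variable m1 : {sigma_finite_measure set T1 -> \bar R}.
Variable m2 : {sigma_finite_measure set T2 -> \bar R}.
Implicit Types f : T1 -> T2 -> R.

Definition pmeas f := measurable_fun [set: T1 * T2] (fun z => f z.1 z.2).

Definition pintgr f := intgr (m1 \x m2)%E (fun z => f z.1 z.2).

Lemma pmeas1 f x : pmeas f -> measurable_fun setT (f x).
Proof.
move=> mf.
by apply: (measurableT_comp mf (g := fun y => (x, y))); exact: measurable_pair1.
Qed.

(** Tonelli's criterion: integrability on the product follows from a bound of
    the inner integrals by an integrable function of the other variable. *)
Lemma pintgr_bound2 f (b : T2 -> R) : pmeas f ->
  (forall y, intgr m1 (f ^~ y)) -> intgr m2 b ->
  (forall y, \int[m1]_x `|f x y| <= b y) -> pintgr f.
Proof.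
move=> mf fi bi fb; apply/integrable21ltyP; first exact/measurable_EFinP.
rewrite (le_lt_trans _ (integrable_lty measurableT bi))//.
apply: ge0_le_integral => //.
- by move=> y _; exact: integral_ge0.
- apply: (measurable_fun_fubini_tonelli_G (fun z => `|(f z.1 z.2)%:E|%E)) => //=.
  by apply/measurable_EFinP; apply: measurableT_comp.
- by apply/measurable_EFinP; exact: intgr_meas bi.
move=> y _ /=; rewrite -Rint_EFin ?lee_fin//; exact: (intgr_norm (fi y)).
Qed.

Lemma pintgr_bound1 f (b : T1 -> R) : pmeas f ->
  (forall x, intgr m2 (f x)) -> intgr m1 b ->
  (forall x, \int[m2]_y `|f x y| <= b x) -> pintgr f.
Proof.
move=> mf fi bi fb; apply/integrable12ltyP; first exact/measurable_EFinP.
rewrite (le_lt_trans _ (integrable_lty measurableT bi))//.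
apply: ge0_le_integral => //.
- by move=> y _; exact: integral_ge0.
- apply: (measurable_fun_fubini_tonelli_F (fun z => `|(f z.1 z.2)%:E|%E)) => //=.
  by apply/measurable_EFinP; apply: measurableT_comp.
- by apply/measurable_EFinP; exact: intgr_meas bi.
move=> y _ /=; rewrite -Rint_EFin ?lee_fin//; exact: (intgr_norm (fi y)).
Qed.

Lemma pintgr_prod f (a : T1 -> R) (b : T2 -> R) : pmeas f ->
  intgr m1 a -> intgr m2 b -> (forall x y, `|f x y| <= a x * b y) -> pintgr f.
Proof.
move=> mf ai bi fab.
have fi x : intgr m2 (f x).
  by apply: (intgr_dom (intgrZ (a x) bi)) => //; exact: pmeas1.
apply: (@pintgr_bound1 _ (fun x => a x * \int[m2]_y b y)) => //.
  rewrite /intgr (_ : _ \o _ = EFin \o (fun x => (\int[m2]_y b y) * a x)); last first.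
    by apply/funext => x /=; rewrite mulrC.
  exact: intgrZ.
move=> x; rewrite -RintegralZl//; apply: intgr_le => //; first exact: intgr_norm.
exact: intgrZ.
Qed.

(** Inner integrals are extended real numbers, finite only almost everywhere;
    taking finite parts changes neither integrability nor the integral. *)
Lemma integrable_fine (dd : measure_display) (T : measurableType dd) (mu : {measure set T -> \bar R})
   (g : T -> \bar R) : mu.-integrable setT g ->
  intgr mu (fine \o g) /\ \int[mu]_x (fine (g x)) = fine (\int[mu]_x g x)%E.
Proof.
move=> gi; have mg : measurable_fun setT g by exact: measurable_int gi.
have mfg : measurable_fun setT (fine \o g) by exact: measurableT_comp.
have ae : ae_eq mu setT g (EFin \o (fine \o g)).
  have := integrable_ae measurableT gi; apply: filterS => x fx _ /=.
  by rewrite fineK//; exact: fx.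
split.
  apply: (le_integrable _ _ _ gi) => //; first exact/measurable_EFinP.
  by move=> x _ /=; case: (g x) => [r| |] //=; rewrite ?leey.
rewrite /Rintegral; congr fine; apply/esym/ae_eq_integral => //.
exact/measurable_EFinP.
Qed.

Lemma integrable_fubini_right (F : T1 * T2 -> \bar R) :
  (m1 \x m2)%E.-integrable setT F -> m2.-integrable setT (fubini_G m1 F).
Proof.
move=> Fi; have mF : measurable_fun setT F by exact: measurable_int Fi.
apply/integrableP; split; first exact: (measurable_fubini_G Fi).
have h : (\int[m2]_y \int[m1]_x `|F (x, y)| < +oo)%E by apply/(integrable21ltyP _ _ mF).
apply: le_lt_trans h.
apply: ge0_le_integral => //.
- by apply: measurableT_comp => //; exact: (measurable_fubini_G Fi).
- apply: (measurable_fun_fubini_tonelli_G (abse \o F)) => //=.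
  exact: measurableT_comp.
move=> y _; apply: le_abse_integral => //.
by apply: (measurableT_comp mF (g := fun x => (x, y))); exact: measurable_pair2.
Qed.

Lemma Rfubini f : pintgr f ->
  \int[m1]_x \int[m2]_y f x y = \int[m2]_y \int[m1]_x f x y.
Proof.
move=> fi.
have [_ E1] := integrable_fine (integrable_fubini_F fi).
have [_ E2] := integrable_fine (integrable_fubini_right fi).
rewrite /fubini_F /fubini_G in E1 E2.
rewrite /Rintegral in E1 E2 *; rewrite E1 E2; congr fine.
exact: (@Fubini _ _ _ _ _ m1 m2 (EFin \o (fun z => f z.1 z.2))).
Qed.

Lemma intgr_fubini_F f : pintgr f -> intgr m1 (fun x => \int[m2]_y f x y).
Proof. by move=> fi; have [] := integrable_fine (integrable_fubini_F fi). Qed.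

Lemma intgr_fubini_G f : pintgr f -> intgr m2 (fun y => \int[m1]_x f x y).
Proof. by move=> fi; have [] := integrable_fine (integrable_fubini_right fi). Qed.

Lemma Rfubini_prod f : pintgr f ->
  \int[m1]_x \int[m2]_y f x y = \int[(m1 \x m2)%E]_z f z.1 z.2.
Proof.
move=> fi.
have [_ E1] := integrable_fine (integrable_fubini_F fi).
rewrite /fubini_F /Rintegral in E1 *; rewrite E1; congr fine.
exact: (@integral12_prod_meas1 _ _ _ _ _ m1 m2 (EFin \o (fun z => f z.1 z.2))).
Qed.

(** Tonelli gives measurability for nonnegative integrands only; writing
    f = (|f| + f) - |f| keeps both terms nonnegative. *)
Lemma measurable_Rint f : pmeas f -> (forall x, intgr m2 (f x)) ->
  measurable_fun setT (fun x => \int[m2]_y f x y).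
Proof.
move=> mf fi.
have pos (h : T1 -> T2 -> R) : pmeas h -> (forall x y, 0 <= h x y) ->
    measurable_fun setT (fun x => \int[m2]_y h x y).
  move=> mh h0; apply: (measurableT_comp (fine_measurable measurableT)).
  apply: (measurable_fun_fubini_tonelli_F (fun z => (h z.1 z.2)%:E)) => //=.
    exact/measurable_EFinP.
  by move=> z; rewrite lee_fin.
have -> : (fun x => \int[m2]_y f x y) =
    (fun x => \int[m2]_y (`|f x y| + f x y) - \int[m2]_y `|f x y|).
  apply/funext => x; rewrite RintegralD; [|by []|exact: intgr_norm|exact: fi].
  by rewrite addrAC subrr add0r.
have mnf : pmeas (fun x y => `|f x y|).
  exact: (measurableT_comp (@normr_measurable R setT) mf).
apply: measurable_funB; apply: pos => //.
- exact: measurable_funD.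
- by move=> x y; rewrite -lerBlDr sub0r -normrN ler_norm.
Qed.

End fubini_real.

(** * Lebesgue measure on tuples as an iterated integral *)

Section coordinates.
Variable R : realType.

Lemma measurable_tuple dd (T : measurableType dd) n (f : T -> n.-tuple R) :
  (forall i, measurable_fun setT (fun x => tnth (f x) i)) -> measurable_fun setT f.
Proof. by move=> mf; apply/measurable_fun_tnthP => i; exact: mf. Qed.

(** [upd], [Icoord] and [Iseq] integrate one coordinate after the other.
    Unlike the recursive definition of [lebesgue_tuple], which fixes the order
    of the coordinates, this form can be reordered along an arbitrary
    partition into blocks. *)
Definition upd d (i : 'I_d) (x : d.-tuple R) (t : R) : d.-tuple R :=
  [tuple if k == i then t else tnth x k | k < d].

Lemma updC d (i j : 'I_d) x s t : i != j ->
  upd i (upd j x s) t = upd j (upd i x t) s.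
Proof.
move=> ij; apply: eq_from_tnth => k; rewrite !tnth_mktuple.
by case: (eqVneq k i) => [->|//]; rewrite (negPf ij).
Qed.

Lemma measurable_upd d (i : 'I_d) :
  measurable_fun [set: d.-tuple R * measurableTypeR R] (fun z => upd i z.1 z.2).
Proof.
apply: measurable_tuple => k; have [->|ki] := eqVneq k i.
  rewrite (_ : (fun x => _) = (fun z => z.2)); first exact: measurable_snd.
  by apply/funext => z; rewrite tnth_mktuple eqxx.
rewrite (_ : (fun x => _) = (fun z => tnth z.1 k)); last first.
  by apply/funext => z; rewrite tnth_mktuple (negPf ki).
by apply: (measurableT_comp (measurable_tnth k)).
Qed.

Local Notation leb1 := (@lebesgue_measure R).

Local Open Scope ereal_scope.

Definition Icoord d (i : 'I_d) (h : d.-tuple R -> \bar R) (x : d.-tuple R) :=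
  \int[leb1]_t h (upd i x t).

Definition Iseq d (s : seq 'I_d) (h : d.-tuple R -> \bar R) :=
  foldr (@Icoord d) h s.

Definition nnmeas d (h : d.-tuple R -> \bar R) :=
  measurable_fun setT h /\ (forall x, 0 <= h x).

Lemma nnmeas_upd d (i : 'I_d) h : nnmeas h ->
  measurable_fun setT (fun z : d.-tuple R * measurableTypeR R => h (upd i z.1 z.2)).
Proof. by move=> [mh _]; apply: (measurableT_comp mh); exact: measurable_upd. Qed.

Lemma nnmeas_upd1 d (i : 'I_d) h x : nnmeas h ->
  measurable_fun setT (fun t : measurableTypeR R => h (upd i x t)).
Proof.
move=> mh; apply: (measurableT_comp (nnmeas_upd i mh) (g := fun t => (x, t))).
exact: measurable_pair1.
Qed.

Lemma nnmeas_Icoord d (i : 'I_d) h : nnmeas h -> nnmeas (Icoord i h).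
Proof.
move=> mh; split; last by move=> x; apply: integral_ge0 => t _; exact: mh.2.
apply: (measurable_fun_fubini_tonelli_F (fun z : d.-tuple R * measurableTypeR R => h (upd i z.1 z.2))).
  exact: nnmeas_upd.
by move=> z; exact: mh.2.
Qed.

Lemma nnmeas_Iseq d (s : seq 'I_d) h : nnmeas h -> nnmeas (Iseq s h).
Proof. by move=> mh; elim: s => //= i s IHs; exact: nnmeas_Icoord. Qed.

Lemma IcoordC d (i j : 'I_d) h : nnmeas h ->
  Icoord i (Icoord j h) = Icoord j (Icoord i h).
Proof.
move=> mh; have [->//|ij] := eqVneq i j; apply/funext => x; rewrite /Icoord.
under [RHS]eq_integral do under eq_integral do rewrite updC//.
apply: (fubini_tonelli (fun z : measurableTypeR R * measurableTypeR R => h (upd j (upd i x z.1) z.2))).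
  apply: (measurableT_comp (nnmeas_upd j mh)
    (g := fun z : measurableTypeR R * measurableTypeR R => (upd i x z.1, z.2))).
  apply: measurable_fun_pair => //.
  apply: (measurableT_comp (measurable_upd i) (g := fun z : measurableTypeR R * measurableTypeR R => (x, z.1))).
  by apply: measurable_fun_pair.
by move=> z; exact: mh.2.
Qed.

Lemma Iseq_cat d (s1 s2 : seq 'I_d) h : Iseq (s1 ++ s2) h = Iseq s1 (Iseq s2 h).
Proof. by rewrite /Iseq foldr_cat. Qed.

Lemma Iseq_Icoord d (s : seq 'I_d) i h : nnmeas h ->
  Iseq s (Icoord i h) = Icoord i (Iseq s h).
Proof.
move=> mh; elim: s => //= j s ->; rewrite IcoordC//; exact: nnmeas_Iseq.
Qed.

Lemma perm_Iseq d (s1 s2 : seq 'I_d) h : nnmeas h -> perm_eq s1 s2 ->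
  Iseq s1 h = Iseq s2 h.
Proof.
move=> mh; elim: s1 s2 => [|i s1 IHs] s2; first by rewrite perm_sym => /perm_nilP ->.
move=> is12; have iin : i \in s2 by rewrite -(perm_mem is12) mem_head.
have /permPr e := perm_to_rem iin; move: is12; rewrite e perm_cons => /IHs /= ->.
rewrite -[RHS]/(Iseq s2 h).
have {2}-> : s2 = take (index i s2) s2 ++ i :: drop (index i s2).+1 s2.
  by rewrite -{2}(nth_index i iin) -drop_nth ?index_mem// cat_take_drop.
rewrite remE Iseq_cat Iseq_cat /= Iseq_Icoord//; exact: nnmeas_Iseq.
Qed.

Lemma Iseq_indep d (s : seq 'I_d) (c : d.-tuple R -> R) h : nnmeas h ->
  (forall x, 0 <= c x)%R -> (forall i x t, i \in s -> c (upd i x t) = c x) ->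
  Iseq s (fun x => (c x)%:E * h x) = (fun x => (c x)%:E * Iseq s h x).
Proof.
move=> mh c0; elim: s => //= i s IHs cs; rewrite IHs; last first.
  by move=> j x t js; apply: cs; rewrite inE js orbT.
apply/funext => x; rewrite /Icoord.
under eq_integral do rewrite cs ?mem_head//.
rewrite ge0_integralZl//; last by rewrite lee_fin.
  by apply: nnmeas_upd1; exact: nnmeas_Iseq.
by move=> t _; exact: (nnmeas_Iseq s mh).2.
Qed.

Lemma Iseq_cst d (s : seq 'I_d) (h : d.-tuple R -> \bar R) (k : \bar R) : nnmeas h -> 0 <= k ->
  Iseq s (fun x => h x * k) = (fun x => Iseq s h x * k).
Proof.
move=> mh k0; elim: s => //= i s ->.
apply/funext => x; rewrite /Icoord; under eq_integral do rewrite muleC.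
rewrite ge0_integralZl//; first by rewrite muleC.
  by apply: nnmeas_upd1; exact: nnmeas_Iseq.
by move=> t _; exact: (nnmeas_Iseq s mh).2.
Qed.

(** Integrating over the coordinates of a block is integrating over the
    tuple extracted from that block. *)
Lemma Iseq_map d m (e : 'I_m -> 'I_d) (p : d.-tuple R -> m.-tuple R) (s : seq 'I_m)
    (h : m.-tuple R -> \bar R) :
  (forall k x t, p (upd (e k) x t) = upd k (p x) t) ->
  forall x, Iseq (map e s) (h \o p) x = Iseq s h (p x).
Proof.
move=> pe; elim: s => //= i s IHs x; rewrite /Icoord.
by apply: eq_integral => t _; rewrite IHs pe.
Qed.

Lemma lebesgue_tuple_S d (h : d.+1.-tuple R -> \bar R) : nnmeas h ->
  \int[lebesgue_tuple R d.+1]_x h x =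
  \int[leb1]_t \int[lebesgue_tuple R d]_x h [tuple of t :: x].
Proof.
move=> [mh h0] /=.
transitivity (\int[pushforward (leb1 \x lebesgue_tuple R d) (@cons_pair R d)]_x h x).
  by [].
rewrite ge0_integral_pushforward//; last exact: measurable_cons_pair.
rewrite preimage_setT fubini_tonelli1//.
  by apply: measurableT_comp => //; exact: measurable_cons_pair.
by move=> z; exact: h0.
Qed.

Lemma lebesgue_tuple_0 (h : 0.-tuple R -> \bar R) : nnmeas h ->
  \int[lebesgue_tuple R 0]_x h x = h [tuple].
Proof. by move=> [mh h0]; rewrite integral_dirac// diracT mul1e. Qed.

(** Recursion on the dimension: prepending a coordinate shifts the indices of
    the others by [lift ord0]. *)
Lemma lebesgue_tuple_Iseq d (h : d.-tuple R -> \bar R) x : nnmeas h ->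
  \int[lebesgue_tuple R d]_x h x = Iseq (enum 'I_d) h x.
Proof.
elim: d => [|d IHd] in h x *.
  move=> mh; rewrite lebesgue_tuple_0//.
  have -> : enum 'I_0 = [::] by apply: size0nil; rewrite size_enum_ord.
  by rewrite /= (tuple0 x).
move=> mh; rewrite lebesgue_tuple_S// enum_ordSl /= /Icoord.
apply: eq_integral => t _.
have mht : nnmeas (fun y : d.-tuple R => h [tuple of t :: y]).
  split; last by move=> y; exact: mh.2.
  by apply: (measurableT_comp mh.1); apply: measurable_cons.
rewrite (IHd _ [tuple of behead x]) //.
have {1}-> : (fun y : d.-tuple R => h [tuple of t :: y]) = (fun y => h (cons_pair (t, y))).
  by apply/funext => y; congr h; apply: val_inj.
have E (s : seq 'I_d) y :
    Iseq s (fun y => h (cons_pair (t, y))) y = Iseq (map (lift ord0) s) h (cons_pair (t, y)).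
  elim: s y => //= i s IHs y; rewrite /Icoord.
  apply: eq_integral => u _; rewrite IHs; congr Iseq.
  apply: eq_from_tnth => k; rewrite !tnth_mktuple.
  have [->|k0] := eqVneq k ord0; first by [].
  case: (unliftP ord0 k) k0 => [j -> _|-> //].
  by rewrite !tnthS tnth_mktuple (inj_eq lift_inj).
rewrite E; congr (Iseq _ _ _); apply: eq_from_tnth => k.
rewrite !tnth_mktuple; have [->//|k0] := eqVneq k ord0.
case: (unliftP ord0 k) k0 => [j -> _|-> //].
rewrite !tnthS /= /tnth /=; rewrite nth_behead.
by apply: set_nth_default; rewrite size_tuple ltnS.
Qed.

Lemma get_block_upd_in d (B : {set 'I_d}) (k : 'I_#|B|) (x : d.-tuple R) t :
  get_block B (upd (enum_val k) x t) = upd k (get_block B x) t.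
Proof.
apply: eq_from_tnth => l; rewrite !tnth_mktuple.
by rewrite (inj_eq enum_val_inj).
Qed.

Lemma get_block_upd_notin d (B : {set 'I_d}) (i : 'I_d) (x : d.-tuple R) t :
  i \notin B -> get_block B (upd i x t) = get_block B x.
Proof.
move=> iB; apply: eq_from_tnth => l; rewrite !tnth_mktuple.
by case: eqP => // e; move: iB; rewrite -e enum_valP.
Qed.

Lemma map_enum_val_enum d (B : {set 'I_d}) :
  [seq enum_val k | k <- enum 'I_#|B|] = enum B.
Proof.
have sz : size [seq enum_val k | k : 'I_#|B|] = size (enum B).
  by rewrite size_map size_enum_ord -cardE.
case: (posnP #|B|) => [B0|Bp].
  by rewrite [RHS](size0nil _) -?cardE//; apply: size0nil; rewrite sz -cardE.
apply: (@eq_from_nth _ (enum_val (Ordinal Bp))) => // i.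
rewrite size_map size_enum_ord => ik.
rewrite (nth_map (Ordinal Bp)) ?size_enum_ord// (enum_val_nth (enum_val (Ordinal Bp))).
by rewrite nth_enum_ord.
Qed.

Lemma measurable_get_block d (B : {set 'I_d}) :
  measurable_fun [set: d.-tuple R] (get_block B).
Proof.
apply: measurable_tuple => i.
rewrite (_ : (fun x => _) = (fun x => tnth x (enum_val i))); first exact: measurable_tnth.
by apply/funext => x; rewrite tnth_mktuple.
Qed.

(** Lebesgue measure is the product of the Lebesgue measures of the blocks.
    The coordinates are integrated block by block: the factors of the other
    blocks do not depend on the coordinates being integrated, hence come out
    as constants. *)
Lemma block_integral d n (D : 'I_n -> {set 'I_d}) (phi : forall j, #|D j|.-tuple R -> R) :
  block_partition D ->
  (forall j, measurable_fun setT (phi j)) -> (forall j x, 0 <= phi j x)%R ->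
  \int[lebesgue_tuple R d]_x (\prod_(j < n) phi j (get_block (D j) x))%:E =
  \prod_(j < n) \int[lebesgue_tuple R #|D j|]_z (phi j z)%:E.
Proof.
move=> Dpart mphi phi0; have Ddisj := block_partition_disjoint Dpart.
pose h (js : seq 'I_n) (x : d.-tuple R) := (\prod_(j <- js) phi j (get_block (D j) x))%R.
have h0 js x : (0 <= h js x)%R by apply: prodr_ge0 => j _; exact: phi0.
have mphij j : measurable_fun setT (fun x : d.-tuple R => phi j (get_block (D j) x)).
  by apply: (measurableT_comp (mphi j)); exact: measurable_get_block.
have mh js : nnmeas (fun x => (h js x)%:E).
  split; last by move=> x; rewrite lee_fin.
  by apply/measurable_EFinP; rewrite /h; exact: measurable_prod.
have notinD j js k : j \notin js -> k \in flatten [seq enum (D i) | i <- js] -> k \notin D j.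
  move=> jjs /flattenP[_ /mapP[i ijs ->]]; rewrite mem_enum => kDi.
  apply/negP => kDj; have ij : i != j by apply: contraNneq jjs => <-.
  by move: (disjointFr (Ddisj _ _ ij) kDi); rewrite kDj.
have key js x : uniq js ->
    Iseq (flatten [seq enum (D j) | j <- js]) (fun x => (h js x)%:E) x =
    \prod_(j <- js) \int[lebesgue_tuple R #|D j|]_z (phi j z)%:E.
  elim: js x => [|j js IHs] x /=; first by rewrite /h !big_nil.
  move=> /andP[jjs ujs].
  rewrite Iseq_cat.
  rewrite (_ : (fun x => (h (j :: js) x)%:E) =
    (fun x => (phi j (get_block (D j) x))%:E * (h js x)%:E)); last first.
    by apply/funext => y; rewrite /h big_cons EFinM.
  rewrite Iseq_indep//; last first.
    move=> i y t /(notinD _ _ _ jjs) iD; by rewrite get_block_upd_notin.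
  rewrite (_ : (fun x => _) = (fun x => (phi j (get_block (D j) x))%:E *
      \prod_(j <- js) \int[lebesgue_tuple R #|D j|]_z (phi j z)%:E)); last first.
    by apply/funext => y; rewrite IHs.
  rewrite Iseq_cst; last 2 first.
  - by split; [exact/measurable_EFinP|move=> y; rewrite lee_fin].
  - apply: prode_ge0 => i _; apply: integral_ge0 => z _; by rewrite lee_fin.
  rewrite big_cons; congr (_ * _).
  rewrite -map_enum_val_enum.
  rewrite (@Iseq_map _ _ enum_val (get_block (D j)) _ (fun z => (phi j z)%:E)); last first.
    exact: get_block_upd_in.
  rewrite -lebesgue_tuple_Iseq//; split; last by move=> y; rewrite lee_fin.
  by apply/measurable_EFinP; exact (mphi j).
have uflat js : uniq js -> uniq (flatten [seq enum (D i) | i <- js]).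
  elim: js => //= j js IH /andP[jjs ujs].
  rewrite cat_uniq enum_uniq IH// andbT /=.
  apply/hasPn => k kf; rewrite mem_enum; exact: notinD kf.
pose x0 : d.-tuple R := [tuple 0%R | _ < d].
rewrite (@lebesgue_tuple_Iseq _ _ x0); last first.
  have := mh (enum 'I_n).
  rewrite /h; under [X in nnmeas X -> _]eq_fun do rewrite big_enum.
  by [].
rewrite (_ : \prod_(j < n) _ = \prod_(j <- enum 'I_n) \int[lebesgue_tuple R #|D j|]_z (phi j z)%:E); last first.
  by rewrite big_enum.
rewrite -(key _ x0) ?enum_uniq//.
rewrite (_ : (fun x => (\prod_(j < n) phi j (get_block (D j) x))%:E) = (fun x => (h (enum 'I_n) x)%:E)); last first.
  by apply/funext => x; rewrite /h big_enum.
rewrite (perm_Iseq (mh _) (s2 := flatten [seq enum (D j) | j <- enum 'I_n]))//.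
apply: uniq_perm; rewrite ?enum_uniq ?uflat ?enum_uniq// => k.
rewrite mem_enum inE; apply/esym/flattenP.
have [_ /and3P[/eqP cov _ _]] := Dpart.
have : k \in [set: 'I_d]%SET by rewrite finset.in_setT.
rewrite -cov => /finset.bigcupP[B /imsetP[j _ ->] kB].
exists (enum (D j)); last by rewrite mem_enum.
by apply: map_f; rewrite mem_enum.
Qed.

Local Close Scope ereal_scope.

Lemma intgr_tupleS d (h : d.+1.-tuple R -> R) :
  measurable_fun setT h ->
  pintgr (@lebesgue_measure R) (lebesgue_tuple R d) (fun t x => h (cons_pair (t, x))) ->
  intgr (lebesgue_tuple R d.+1) h /\
  \int[lebesgue_tuple R d.+1]_x h x = \int[leb1]_t \int[lebesgue_tuple R d]_x h (cons_pair (t, x)).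
Proof.
move=> mh hi.
have hi' : (leb1 \x lebesgue_tuple R d)%E.-integrable setT ((EFin \o h) \o @cons_pair R d).
  move: hi; rewrite /pintgr /intgr; apply: eq_integrable => //.
have meh : measurable_fun setT (EFin \o h) by exact/measurable_EFinP.
split.
  have := @integrable_pushforward _ _ _ _ _ _ (measurable_cons_pair (R:=R) (d:=d)) _ _ _ meh hi' measurableT.
  by [].
rewrite Rfubini_prod//.
rewrite /Rintegral; congr fine.
have := @integral_pushforward _ _ _ _ _ _ (measurable_cons_pair (R:=R) (d:=d)) _ _ _ meh hi' measurableT.
rewrite preimage_setT => e.
transitivity (\int[pushforward (leb1 \x lebesgue_tuple R d)%E (@cons_pair R d)]_x (h x)%:E)%E; first by [].
rewrite [LHS]e; by apply: eq_integral => -[t x] _.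
Qed.

End coordinates.

(** * Laplace, Cauchy and Bessel integrals on the line *)

Section one_dimensional.
Variable R : realType.
Local Notation leb1 := (@lebesgue_measure R).
Implicit Types (f F : R -> R) (e x y t : R).

Lemma ge0_continuous_intgr f (c : R) : continuous f -> (forall t, 0 <= f t) ->
  (\int[leb1]_t (f t)%:E = c%:E)%E -> intgr leb1 f /\ \int[leb1]_t f t = c.
Proof.
move=> cf f0 fc; split; last by rewrite /Rintegral fc.
apply: (@ge0_intgr _ _ _ _ _ c%:E); rewrite ?fc ?ltry//.
exact: continuous_measurable_fun.
Qed.

Lemma is_deriveP F t (v : R) : is_derive t 1 F v -> derivable F t 1 /\ derive1 F t = v.
Proof. by move=> dF; rewrite derive1E; case: dF. Qed.

Lemma halfline_FTC f F (a l : R) : continuous f -> (forall t, 0 <= f t) ->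
  F x @[x --> +oo] --> l -> continuous F ->
  (forall t, a < t -> derivable F t 1 /\ derive1 F t = f t) ->
  (\int[leb1]_(t in `[a, +oo[) (f t)%:E = (l - F a)%:E)%E.
Proof.
move=> cf f0 Fl cF dF; rewrite (@ge0_continuous_FTC2y _ f F a l)//.
- exact: continuous_subspaceT.
- by move=> t at_; have [] := dF _ at_.
- by apply: cvg_at_right_filter; exact: cF.
- move=> t; rewrite in_itv/= andbT => at_; by have [] := dF _ at_.
Qed.

(** [F] need only be a primitive for positive arguments, which allows
    integrands built from |t|. *)
Lemma even_FTC f F l : continuous f -> (forall t, 0 <= f t) ->
  (forall t, f (- t) = f t) ->
  F x @[x --> +oo] --> l -> continuous F ->
  (forall t, 0 < t -> derivable F t 1 /\ derive1 F t = f t) ->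
  intgr leb1 f /\ \int[leb1]_t f t = 2 * (l - F 0).
Proof.
move=> cf f0 fN Fl cF dF; apply: ge0_continuous_intgr => //.
rewrite ge0_symfun_integralT//; last by move=> t /=; rewrite fN.
rewrite -set_itvcy (halfline_FTC cf f0 Fl cF dF); first by rewrite EFinM.
Qed.

Lemma integral_halves f : continuous f -> (forall t, 0 <= f t) ->
  (\int[leb1]_t (f t)%:E =
   \int[leb1]_(t in `[0%R, +oo[) (f t)%:E + \int[leb1]_(t in `[0%R, +oo[) (f (- t))%:E)%E.
Proof.
move=> cf f0; have mf : measurable_fun setT f by exact: continuous_measurable_fun.
rewrite -(setUv `[0%R, +oo[%classic) ge0_integral_setU//=; last 4 first.
- exact: measurableC.
- by apply/measurable_EFinP; rewrite setUv.
- by move=> t _; rewrite lee_fin.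
- exact/disj_setPCl.
congr (_ + _)%E.
rewrite setCitvr integral_itv_bndo_bndc; last exact/measurable_EFinP/measurable_funTS.
by rewrite -{1}oppr0 ge0_integration_by_substitutionNy//; exact: continuous_subspaceT.
Qed.

Lemma ge0_integral_opp f : continuous f -> (forall t, 0 <= f t) ->
  (\int[leb1]_t (f (- t))%:E = \int[leb1]_t (f t)%:E)%E.
Proof.
move=> cf f0; rewrite (integral_halves cf)// (@integral_halves (fun t => f (- t)))//.
  by under [X in (_ + X)%E = _]eq_integral do rewrite opprK; rewrite addeC.
by move=> t; apply: (@continuous_comp _ _ _ -%R f); [exact: oppr_continuous|exact: cf].
Qed.

Lemma cvgy_atan : atan x @[x --> +oo] --> (pi / 2 : R).
Proof.
apply/cvgrPdist_le => /= e e0.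
pose e' := Num.min e (pi / 2).
have e'0 : 0 < e' by rewrite lt_min e0 divr_gt0// pi_gt0.
near=> x.
rewrite ger0_norm; last by rewrite subr_ge0 ltW// atan_ltpi2.
rewrite lerBlDr -lerBlDl.
apply: (@le_trans _ _ (pi / 2 - e')); first by rewrite lerB// ge_min lexx.
have p0 := @pi_gt0 R.
rewrite -[leLHS]tanK; last first.
  rewrite in_itv/=; apply/andP; split; last by rewrite ltrBlDr ltrDl.
  rewrite ltrBrDr (le_lt_trans (y := 0))// ?divr_gt0//.
  by rewrite addrC subr_le0 ge_min lexx orbT.
apply: le_atan; near: x; apply: nbhs_pinfty_ge; exact: num_real.
Unshelve. all: by end_near. Qed.

Lemma cauchy_continuous e y : 0 < e -> continuous (fun t => e / (e ^+ 2 + (t - y) ^+ 2)).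
Proof.
move=> e0 t; apply: cvgM; first exact: cvg_cst.
apply: cvgV; first by rewrite gt_eqF// ltr_wpDr ?sqr_ge0// exprn_gt0.
apply: cvgD; first exact: cvg_cst.
by apply: (@continuous_comp _ _ _ (fun t => t - y) (fun u => u ^+ 2)); [|exact: exprn_continuous]; apply: cvgB; [exact: cvg_id|exact: cvg_cst].
Qed.

(** A primitive is atan ((t - y) / e). *)
Lemma cauchy_half e y : 0 < e ->
  (\int[leb1]_(t in `[0%R, +oo[) (e / (e ^+ 2 + (t - y) ^+ 2))%:E = (pi / 2 - atan (- y / e))%:E)%E.
Proof.
move=> e0; rewrite (@halfline_FTC _ (fun t => atan ((t - y) / e)) 0 (pi / 2)).
- by rewrite sub0r.
- exact: cauchy_continuous.
- by move=> t; rewrite divr_ge0 ?(ltW e0)// addr_ge0// sqr_ge0.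
- apply: (cvg_comp _ atan _ cvgy_atan).
  apply/cvgryPge => A; near=> x.
  rewrite ler_pdivlMr// lerBrDr; near: x; apply: nbhs_pinfty_ge; exact: num_real.
- move=> t; apply: continuous_comp; last exact: continuous_atan.
  by apply: cvgM; [apply: cvgB; [exact: cvg_id|exact: cvg_cst]|exact: cvg_cst].
- move=> t _; apply: is_deriveP.
  have -> : e / (e ^+ 2 + (t - y) ^+ 2) = (1 + ((t - y) / e) ^+ 2)^-1 * e^-1.
    have h : e ^+ 2 + (t - y) ^+ 2 != 0.
      by rewrite gt_eqF// ltr_wpDr ?sqr_ge0// exprn_gt0.
    by field; rewrite gt_eqF//= h.
  apply: is_derive_eq.
  by rewrite /GRing.scale/= ; ring.
Unshelve. all: by end_near. Qed.

Lemma cauchy_mass e y : 0 < e ->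
  intgr leb1 (fun t => e / (e ^+ 2 + (t - y) ^+ 2)) /\
  \int[leb1]_t (e / (e ^+ 2 + (t - y) ^+ 2)) = pi.
Proof.
move=> e0; apply: ge0_continuous_intgr.
- exact: cauchy_continuous.
- by move=> t; rewrite divr_ge0 ?(ltW e0)// addr_ge0// sqr_ge0.
rewrite integral_halves.
- rewrite (cauchy_half _ e0).
  rewrite (_ : (\int[leb1]_(t in `[0%R, +oo[) _)%E =
      (\int[leb1]_(t in `[0%R, +oo[) (e / (e ^+ 2 + (t - - y) ^+ 2))%:E)%E).
    rewrite (cauchy_half _ e0) -EFinD; congr (_%:E).
    by rewrite mulNr opprK atanN opprK; field.
  by apply: eq_integral => t _; congr (_%:E); congr (_ / (_ + _)); ring.
- exact: cauchy_continuous.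
- by move=> t; rewrite divr_ge0 ?(ltW e0)// addr_ge0// sqr_ge0.
Qed.

Lemma expR_continuous_comp (f : R -> R) : continuous f -> continuous (fun t => expR (f t)).
Proof. by move=> cf t; apply: continuous_comp; [exact: cf|exact: continuous_expR]. Qed.

Lemma laplace_continuous e : continuous (fun t : R => expR (- (e * `|t|))).
Proof.
apply: expR_continuous_comp => t; apply: cvgN; apply: cvgM; first exact: cvg_cst.
exact: norm_continuous.
Qed.

Lemma cvgy_expRN e : 0 < e -> expR (- (e * x)) @[x --> +oo] --> (0 : R).
Proof.
move=> e0; apply: (cvg_comp (fun x => e * x) (fun y => expR (- y)) _ (@cvgr_expR R)).
apply/cvgryPge => A; near=> x.
rewrite -ler_pdivrMl//; near: x; apply: nbhs_pinfty_ge; exact: num_real.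
Unshelve. all: by end_near. Qed.

Lemma laplace_mass e : 0 < e ->
  intgr leb1 (fun t => expR (- (e * `|t|))) /\ \int[leb1]_t (expR (- (e * `|t|))) = 2 / e.
Proof.
move=> e0.
have [||||||ig ->] := @even_FTC (fun t => expR (- (e * `|t|))) (fun t => - (expR (- (e * t)) / e)) 0.
- exact: laplace_continuous.
- by move=> t; exact: expR_ge0.
- by move=> t; rewrite normrN.
- rewrite -oppr0; apply: cvgN; rewrite -(mul0r e^-1).
  by apply: cvgM; [exact: cvgy_expRN|exact: cvg_cst].
- move=> t; apply: cvgN; apply: cvgM; last exact: cvg_cst.
  by apply: (@expR_continuous_comp (fun u => - (e * u))) => u; apply: cvgN; apply: cvgM; [exact: cvg_cst|exact: cvg_id].
- move=> t t0; rewrite (gtr0_norm t0); apply: is_deriveP.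
  apply: is_derive_eq.
  by rewrite /GRing.scale/=; field; rewrite gt_eqF.
split=> //; rewrite mulr0 oppr0 expR0 sub0r opprK; by field; rewrite gt_eqF.
Qed.

(** The summand 1 makes the integrand nonnegative, so that integrability and
    the value of the integral both follow from the limit of a primitive; it is
    removed in [laplace_cos]. *)
Lemma laplace_cos1 e x : 0 < e ->
  intgr leb1 (fun t => expR (- (e * `|t|)) * (1 + cos (t * x))) /\ \int[leb1]_t (expR (- (e * `|t|)) * (1 + cos (t * x))) = 2 / e + 2 * e / (e ^+ 2 + x ^+ 2).
Proof.
move=> e0.
pose F t := - (expR (- (e * t)) / e) + expR (- (e * t)) * ((x * sin (t * x) - e * cos (t * x)) / (e ^+ 2 + x ^+ 2)).
have h : e ^+ 2 + x ^+ 2 != 0 by rewrite gt_eqF// ltr_wpDr ?sqr_ge0// exprn_gt0.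
have dF t : is_derive t 1 F (expR (- (e * t)) * (1 + cos (t * x))).
  rewrite /F; apply: is_derive_eq.
  by rewrite /GRing.scale/=; field; rewrite h gt_eqF.
have [||||||ig E] := @even_FTC (fun t => expR (- (e * `|t|)) * (1 + cos (t * x))) F 0.
- move=> t; apply: cvgM; first exact: laplace_continuous.
  apply: cvgD; first exact: cvg_cst.
  apply: continuous_comp; last exact: continuous_cos.
  by apply: cvgM; [exact: cvg_id|exact: cvg_cst].
- by move=> t; rewrite mulr_ge0 ?expR_ge0//; have := cos_geN1 (t * x); rewrite -subr_ge0 opprK addrC.
- by move=> t; rewrite normrN mulNr cosN.
- rewrite -[X in _ --> X](addr0 0); apply: cvgD.
    rewrite -oppr0; apply: cvgN; rewrite -(mul0r e^-1).
    by apply: cvgM; [exact: cvgy_expRN|exact: cvg_cst].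
  apply: (@squeeze_cvgr _ _ _ _ (fun t => - (expR (- (e * t)) * ((`|x| + e) / (e ^+ 2 + x ^+ 2))))
     (fun t => expR (- (e * t)) * ((`|x| + e) / (e ^+ 2 + x ^+ 2)))).
  - apply: nearW => t; rewrite -ler_norml normrM ger0_norm ?expR_ge0// ler_wpM2l ?expR_ge0//.
    rewrite normrM ler_pM//; last by rewrite ger0_norm// invr_ge0 addr_ge0// sqr_ge0.
    rewrite (le_trans (ler_normB _ _))// lerD// normrM.
      by rewrite ler_piMr// sin_max.
    by rewrite (gtr0_norm e0) ler_piMr ?cos_max// ltW.
  - rewrite -oppr0 -(mul0r ((`|x| + e) / (e ^+ 2 + x ^+ 2))); apply: cvgN.
    by apply: cvgM; [exact: cvgy_expRN|exact: cvg_cst].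
  - rewrite -[X in _ --> X](mul0r ((`|x| + e) / (e ^+ 2 + x ^+ 2))).
    by apply: cvgM; [exact: cvgy_expRN|exact: cvg_cst].
- move=> t; apply: differentiable_continuous; apply/derivable1_diffP.
  by have [] := dF t.
- by move=> t t0; rewrite gtr0_norm//; exact: is_deriveP.
split=> //; rewrite [LHS]E /F mulr0 oppr0 expR0 mul0r sin0 cos0.
by field; rewrite h gt_eqF.
Qed.

Lemma laplace_cos e x : 0 < e ->
  \int[leb1]_t (expR (- (e * `|t|)) * cos (t * x)) = 2 * e / (e ^+ 2 + x ^+ 2).
Proof.
move=> e0; have [i1 E1] := laplace_cos1 x e0; have [i0 E0] := laplace_mass e0.
transitivity (\int[leb1]_t (expR (- (e * `|t|)) * (1 + cos (t * x)) - expR (- (e * `|t|)))).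
  by apply: eq_Rintegral => t _; rewrite mulrDr mulr1 addrC addKr.
by rewrite RintegralB// E1 E0 addrC addKr.
Qed.

(** Oddness: the nonnegative functions exp (- e |t|) (1 + s sin (t x)), for
    s = 1 and s = -1, are exchanged by t |-> - t. *)
Lemma laplace_sin e x : 0 < e ->
  \int[leb1]_t (expR (- (e * `|t|)) * sin (t * x)) = 0.
Proof.
move=> e0; have [i0 E0] := laplace_mass e0.
pose f s t : R := expR (- (e * `|t|)) * (1 + s * sin (t * x)).
have csin : continuous (fun t : R => sin (t * x)).
  move=> t; apply: continuous_comp; last exact: continuous_sin.
  by apply: cvgM; [exact: cvg_id|exact: cvg_cst].
have isin : intgr leb1 (fun t => expR (- (e * `|t|)) * sin (t * x)).
  apply: (intgrM i0); first exact: continuous_measurable_fun.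
  by move=> t; exact: sin_max.
have fi s : intgr leb1 (f s).
  have := intgrD i0 (intgrZ s isin); rewrite /intgr; apply: eq_integrable => // t _.
  by rewrite /f /=; congr (_%:E); ring.
have fE s : \int[leb1]_t f s t = 2 / e + s * \int[leb1]_t (expR (- (e * `|t|)) * sin (t * x)).
  rewrite -E0 -RintegralZl// -RintegralD//; last exact: intgrZ.
  by apply: eq_Rintegral => t _; rewrite /f; ring.
have : \int[leb1]_t f (-1) t = \int[leb1]_t f 1 t.
  rewrite /Rintegral -(@ge0_integral_opp (f 1)).
  - by congr fine; apply: eq_integral => t _; rewrite /f normrN (mulNr t) sinN mul1r mulN1r.
  - move=> t; apply: cvgM; first exact: laplace_continuous.
    apply: cvgD; first exact: cvg_cst.
    by apply: cvgM; [exact: cvg_cst|exact: csin].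
  - by move=> t; rewrite mulr_ge0 ?expR_ge0// mul1r; have := sin_geN1 (t * x); rewrite -subr_ge0 opprK addrC.
rewrite !fE; lra.
Qed.

(** Comparison with (1 + |t|)^(- 2 s), whose primitive is elementary:
    (1 + |t|)^2 <= 2 (1 + t^2). *)
Lemma bessel_intgr s : 2^-1 < s -> intgr leb1 (fun t : R => (1 + t ^+ 2) `^ (- s)).
Proof.
move=> s2.
have s0 : 0 < s by rewrite (lt_trans _ s2)// invr_gt0.
have p1 t : 0 < 1 + `|t| :> R by rewrite ltr_wpDr.
pose F t : R := expR ((1 - 2 * s) * ln (1 + t)) / (1 - 2 * s).
have c0 : 1 - 2 * s < 0 by lra.
have [||||||ig _] := @even_FTC (fun t => expR (- (2 * s) * ln (1 + `|t|))) (fun t => F `|t|) 0.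
- apply: expR_continuous_comp => t; apply: cvgM; first exact: cvg_cst.
  apply: continuous_comp; last exact: continuous_ln.
  by apply: cvgD; [exact: cvg_cst|exact: norm_continuous].
- by move=> t; exact: expR_ge0.
- by move=> t; rewrite normrN.
- rewrite -(mul0r (1 - 2 * s)^-1); apply: cvgM; last exact: cvg_cst.
  have -> : (fun t : R => expR ((1 - 2 * s) * ln (1 + `|t|))) =
     (fun t => expR (- ((2 * s - 1) * ln (1 + `|t|)))).
    by apply/funext => t; congr expR; ring.
  apply: (cvg_comp (fun t : R => ln (1 + `|t|)) (fun u => expR (- ((2 * s - 1) * u)))); last first.
    by apply: cvgy_expRN; lra.
  apply/cvgryPge => A; near=> t.
  rewrite -[leLHS]expRK ler_ln ?posrE ?expR_gt0//.
  suff At : expR A <= t by rewrite (le_trans At)// (le_trans (ler_norm _))// lerDr.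
  near: t; apply: nbhs_pinfty_ge; exact: num_real.
- move=> t; apply: cvgM; last exact: cvg_cst.
  apply: (@expR_continuous_comp (fun u => (1 - 2 * s) * ln (1 + `|u|))) => u; apply: cvgM; first exact: cvg_cst.
  apply: continuous_comp; last exact: continuous_ln.
  by apply: cvgD; [exact: cvg_cst|exact: norm_continuous].
- move=> t t0; rewrite (gtr0_norm t0); apply: is_deriveP.
  have dF : is_derive t 1 F (expR (- (2 * s) * ln (1 + t))).
    have t1 : 0 < 1 + t by rewrite addr_gt0.
    have dln := is_derive1_ln t1.
    rewrite /F; apply: is_derive_eq.
    rewrite /GRing.scale/=.
    have -> : (1 - 2 * s) * ln (1 + t) = - (2 * s) * ln (1 + t) + ln (1 + t) by ring.
    rewrite expRD lnK ?posrE//; field.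
    by apply/andP; split; [rewrite gt_eqF|rewrite lt_eqF].
  apply: near_eq_is_derive dF => //.
  near=> u; rewrite ger0_norm//.
  apply: ltW; near: u; exact: lt_nbhsr.
apply: (intgr_dom (intgrZ (2 `^ s) ig)).
  apply: (measurableT_comp (measurable_powR _)).
  apply: continuous_measurable_fun => t; apply: cvgD; first exact: cvg_cst.
  exact: exprn_continuous.
move=> t; rewrite ger0_norm ?powR_ge0//.
have -> : expR (- (2 * s) * ln (1 + `|t|)) = (1 + `|t|) `^ (- (2 * s)).
  by rewrite /powR gt_eqF.
have q1 : 0 < 1 + t ^+ 2 by rewrite ltr_wpDr ?sqr_ge0.
rewrite !powRN ler_pdivlMr ?powR_gt0// mulrC ler_pdivrMr ?powR_gt0//.
rewrite powRrM -powRM//; last exact: ltW.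
apply: ge0_ler_powR.
- exact: ltW.
- by rewrite nnegrE powR_ge0.
- by rewrite nnegrE mulr_ge0// ltW.
rewrite (@powR_mulrn _ _ 2) ?(ltW (p1 _))// -(real_normK (num_real t)).
set a := `|t|; have : 0 <= (1 - a) ^+ 2 by exact: sqr_ge0.
lra.
Unshelve. all: by end_near. Qed.

End one_dimensional.

(** * Laplace and Cauchy kernels in several variables *)

Section euclidean.
Variable R : realType.
Local Notation leb1 := (@lebesgue_measure R).
Local Notation leb := (lebesgue_tuple R).

Lemma tnth_cons0 d (t : R) (x : d.-tuple R) : tnth (cons_pair (t, x)) ord0 = t.
Proof. by []. Qed.

Lemma tnth_consS d (t : R) (x : d.-tuple R) i :
  tnth (cons_pair (t, x)) (lift ord0 i) = tnth x i.
Proof. by rewrite /cons_pair tnthS. Qed.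

Lemma const_tuple0 (h : 0.-tuple R -> R) : h = fun=> h [tuple].
Proof. by apply/funext => x; rewrite (tuple0 x). Qed.

Lemma intgr_tuple0 (h : 0.-tuple R -> R) :
  intgr (leb 0) h /\ \int[leb 0]_x h x = h [tuple].
Proof.
have mh : measurable_fun setT (EFin \o h).
  by rewrite (const_tuple0 h); apply/measurable_EFinP; exact: measurable_cst.
split; last by rewrite /Rintegral integral_dirac ?diracT ?mul1e.
apply/integrableP; split=> //; rewrite integral_dirac ?diracT ?mul1e ?ltry//.
exact: measurableT_comp.
Qed.

Lemma prod_tuple_integral d (f : 'I_d -> R -> R) : (forall i, intgr leb1 (f i)) ->
  intgr (leb d) (fun x => \prod_i f i (tnth x i)) /\
  \int[leb d]_x (\prod_i f i (tnth x i)) = \prod_i \int[leb1]_t f i t.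
Proof.
elim: d => [|d IHd] in f *.
  move=> _; have [i E] := intgr_tuple0 (fun x => \prod_(i < 0) f i (tnth x i)).
  by split=> //; rewrite E !big_ord0.
move=> fi; have [IHi IHE] := IHd (fun i => f (lift ord0 i)) (fun i => fi (lift ord0 i)).
have mprod : measurable_fun setT (fun x : d.+1.-tuple R => \prod_i f i (tnth x i)).
  apply: measurable_prod => i _.
  exact: (measurableT_comp (intgr_meas (fi i)) (measurable_tnth i)).
have E t x : \prod_i f i (tnth (cons_pair (t, x)) i) = f ord0 t * \prod_(i < d) f (lift ord0 i) (tnth x i).
  by rewrite big_ord_recl tnth_cons0; congr (_ * _); apply: eq_bigr => i _; rewrite tnth_consS.
have [|i ->] := @intgr_tupleS _ d (fun x => \prod_i f i (tnth x i)) mprod.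
  apply: (@pintgr_prod _ _ _ _ R leb1 (leb d) _ (fun t => `|f ord0 t|) (fun x => `|\prod_(i < d) f (lift ord0 i) (tnth x i)|)).
  - apply: (measurableT_comp mprod (g := @cons_pair R d)); exact: measurable_cons_pair.
  - by apply: intgr_norm.
  - exact: intgr_norm.
  - by move=> t x; rewrite E normrM.
split => //; rewrite big_ord_recl -IHE.
under eq_Rintegral do under eq_Rintegral do rewrite E.
under eq_Rintegral do rewrite RintegralZl//.
by rewrite RintegralZr//; exact: (fi ord0).
Qed.

Lemma dotpC d (x y : d.-tuple R) : dotp x y = dotp y x.
Proof. by apply: eq_bigr => i _; rewrite mulrC. Qed.

Lemma dotp_cons d (t u : R) (x y : d.-tuple R) :
  dotp (cons_pair (t, x)) (cons_pair (u, y)) = t * u + dotp x y.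
Proof.
rewrite /dotp big_ord_recl !tnth_cons0; congr (_ + _).
by apply: eq_bigr => i _; rewrite !tnth_consS.
Qed.

Lemma cons_pair_surj d (y : d.+1.-tuple R) : exists t x, y = cons_pair (t, x).
Proof.
exists (tnth y ord0), [tuple of behead y]; rewrite /cons_pair /=.
by rewrite [LHS](tuple_eta y).
Qed.

Lemma measurable_dotp2 d dd (T : measurableType dd) (f g : T -> d.-tuple R) :
  measurable_fun setT f -> measurable_fun setT g ->
  measurable_fun setT (fun x => dotp (f x) (g x)).
Proof.
move=> mf mg; apply: measurable_sum => i; apply: measurable_funM.
  exact: (measurableT_comp (measurable_tnth i) mf).
exact: (measurableT_comp (measurable_tnth i) mg).
Qed.

Lemma measurable_dotp d (x : d.-tuple R) : measurable_fun setT (fun y => dotp y x).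
Proof. by apply: measurable_dotp2. Qed.

(** The Laplace kernel exp (- e |w|_1) is used for damping instead of a
    Gaussian: its Fourier transform is elementary, and it factorises over the
    coordinates just as well. *)
Definition lap d (e : R) (w : d.-tuple R) : R := \prod_i expR (- (e * `|tnth w i|)).

Lemma lap_ge0 d e (w : d.-tuple R) : 0 <= lap e w.
Proof. by apply: prodr_ge0 => i _; exact: expR_ge0. Qed.

Lemma lap_le1 d e (w : d.-tuple R) : 0 <= e -> lap e w <= 1.
Proof.
move=> e0; suff /andP[] : 0 <= lap e w <= 1 by [].
rewrite /lap; apply: (big_ind (fun x => 0 <= x <= 1)) => [|x y|i _].
- by rewrite ler01 lexx.
- by move=> /andP[x0 x1] /andP[y0 y1]; rewrite mulr_ge0// mulr_ile1.
- by rewrite expR_ge0/= -expR0 ler_expR oppr_le0 mulr_ge0.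
Qed.

Lemma lap_intgr d e : 0 < e -> intgr (leb d) (lap e).
Proof.
move=> e0.
by have [] := @prod_tuple_integral d (fun _ t => expR (- (e * `|t|))) (fun i => (laplace_mass e0).1).
Qed.

Lemma lap_cons d e t (w : d.-tuple R) :
  lap e (cons_pair (t, w)) = expR (- (e * `|t|)) * lap e w.
Proof.
rewrite /lap big_ord_recl tnth_cons0; congr (_ * _).
by apply: eq_bigr => i _; rewrite tnth_consS.
Qed.

(** Induction on the dimension, through the addition formulas; cosine and
    sine have to be treated together, the sine part vanishing by oddness. *)
Lemma lap_fourier d e (x : d.-tuple R) : 0 < e ->
  \int[leb d]_w (lap e w * cos (dotp w x)) = \prod_i (2 * e / (e ^+ 2 + tnth x i ^+ 2)) /\
  \int[leb d]_w (lap e w * sin (dotp w x)) = 0.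
Proof.
move=> e0; elim: d => [|d IHd] in x *.
  rewrite (intgr_tuple0 _).2 (intgr_tuple0 _).2 /dotp !big_ord0 cos0 sin0 mulr0.
  by rewrite /lap big_ord0 mulr1.
have [u [y ->]] := cons_pair_surj x; have [IC IS] := IHd y.
have [L1 _] := laplace_mass e0.
have Ld := lap_intgr d e0.
have mlap : measurable_fun setT (@lap d.+1 e) by exact: intgr_meas (lap_intgr _ e0).
have c1 (tr : R -> R) : measurable_fun setT tr -> (forall t, `|tr t| <= 1) ->
    \int[leb d.+1]_w (lap e w * tr (dotp w (cons_pair (u, y)))) =
    \int[leb1]_t (expR (- (e * `|t|)) * \int[leb d]_w (lap e w * tr (t * u + dotp w y))).
  move=> mtr tr1.
  have mh : measurable_fun setT (fun w : d.+1.-tuple R => lap e w * tr (dotp w (cons_pair (u, y)))).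
    by apply: measurable_funM => //; apply: (measurableT_comp mtr); exact: measurable_dotp.
  have [|_ ->] := intgr_tupleS mh.
    apply: (@pintgr_prod _ _ _ _ R leb1 (leb d) _ (fun t => expR (- (e * `|t|))) (fun x => lap e x)) => //.
      apply: (measurableT_comp mh (g := @cons_pair R d)); exact: measurable_cons_pair.
    move=> t w; rewrite normrM lap_cons (ger0_norm (mulr_ge0 (expR_ge0 _) (lap_ge0 _ _))).
    by apply: ler_piMr; rewrite ?mulr_ge0 ?expR_ge0 ?lap_ge0 ?tr1.
  apply: eq_Rintegral => t _; rewrite -RintegralZl//; last first.
    apply: (intgrM Ld _ (fun w => tr1 _)).
    by apply: (measurableT_comp mtr); apply: measurable_funD => //; exact: measurable_dotp.
  by apply: eq_Rintegral => w _; rewrite lap_cons dotp_cons mulrA.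
have mcos : measurable_fun setT (@cos R) by apply: continuous_measurable_fun; exact: continuous_cos.
have msin : measurable_fun setT (@sin R) by apply: continuous_measurable_fun; exact: continuous_sin.
have icos : intgr (leb d) (fun w => lap e w * cos (dotp w y)).
  by apply: (intgrM Ld _ (fun w => cos_max _)); apply: (measurableT_comp mcos); exact: measurable_dotp.
have isin : intgr (leb d) (fun w => lap e w * sin (dotp w y)).
  by apply: (intgrM Ld _ (fun w => sin_max _)); apply: (measurableT_comp msin); exact: measurable_dotp.
have m1 : measurable_fun setT (fun t : R => t * u) by apply: measurable_funM.
have jcos : intgr leb1 (fun t => expR (- (e * `|t|)) * cos (t * u)).
  by apply: (intgrM L1 _ (fun w => cos_max _)); apply: (measurableT_comp mcos).
have jsin : intgr leb1 (fun t => expR (- (e * `|t|)) * sin (t * u)).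
  by apply: (intgrM L1 _ (fun w => sin_max _)); apply: (measurableT_comp msin).
split.
  rewrite c1//; last exact: cos_max.
  transitivity (\int[leb1]_t (expR (- (e * `|t|)) * cos (t * u) * \prod_i (2 * e / (e ^+ 2 + tnth y i ^+ 2)))).
    apply: eq_Rintegral => t _; rewrite -mulrA; congr (_ * _).
    transitivity (\int[leb d]_w (cos (t * u) * (lap e w * cos (dotp w y)) - sin (t * u) * (lap e w * sin (dotp w y)))).
      by apply: eq_Rintegral => w _; rewrite cosD; ring.
    by rewrite RintegralB ?RintegralZl ?IC ?IS ?mulr0 ?subr0//; exact: intgrZ.
  rewrite RintegralZr// laplace_cos// big_ord_recl tnth_cons0; congr (_ * _).
  by apply: eq_bigr => i _; rewrite tnth_consS.
rewrite c1//; last exact: sin_max.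
transitivity (\int[leb1]_t (expR (- (e * `|t|)) * sin (t * u) * \prod_i (2 * e / (e ^+ 2 + tnth y i ^+ 2)))).
  apply: eq_Rintegral => t _; rewrite -mulrA; congr (_ * _).
  transitivity (\int[leb d]_w (sin (t * u) * (lap e w * cos (dotp w y)) + cos (t * u) * (lap e w * sin (dotp w y)))).
    by apply: eq_Rintegral => w _; rewrite sinD; ring.
  by rewrite RintegralD ?RintegralZl ?IC ?IS ?mulr0 ?addr0//; exact: intgrZ.
by rewrite RintegralZr// laplace_sin// mul0r.
Qed.

(** [cau e] is the normalised Fourier transform of the Laplace kernel
    ([lap_cau]): a product of Cauchy densities of width e, which form an
    approximate identity as e tends to 0. *)
Definition cau1 (e t : R) : R := e / (e ^+ 2 + t ^+ 2) / pi.

Definition cau d (e : R) (x y : d.-tuple R) : R := \prod_i cau1 e (tnth y i - tnth x i).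

Lemma cau1_ge0 e t : 0 < e -> 0 <= cau1 e t.
Proof.
by move=> e0; rewrite !divr_ge0 ?pi_ge0 ?(ltW e0)// addr_ge0// sqr_ge0.
Qed.

Lemma cau_ge0 d e (x y : d.-tuple R) : 0 < e -> 0 <= cau e x y.
Proof. by move=> e0; apply: prodr_ge0 => i _; exact: cau1_ge0. Qed.

Lemma cauC d e (x y : d.-tuple R) : cau e x y = cau e y x.
Proof. by apply: eq_bigr => i _; rewrite /cau1; congr (_ / (_ + _) / _); ring. Qed.

Lemma cau1_mass e u : 0 < e ->
  intgr leb1 (fun t => cau1 e (t - u)) /\ \int[leb1]_t (cau1 e (t - u)) = 1.
Proof.
move=> e0; have [i E] := cauchy_mass u e0; split.
  by have := intgrZ pi^-1 i; rewrite /intgr; apply: eq_integrable => // t _; rewrite /= mulrC.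
by rewrite RintegralZr// E divff// gt_eqF// pi_gt0.
Qed.

Lemma cau_mass d e (x : d.-tuple R) : 0 < e ->
  intgr (leb d) (cau e x) /\ \int[leb d]_y cau e x y = 1.
Proof.
move=> e0; have [i E] := @prod_tuple_integral d (fun i t => cau1 e (t - tnth x i)) (fun i => (cau1_mass _ e0).1).
split; first exact: i.
rewrite /cau E big1// => k _; exact: (cau1_mass _ e0).2.
Qed.

Lemma lap_cau d e (x y : d.-tuple R) : 0 < e ->
  \int[leb d]_w (lap e w * cos (dotp w [tuple tnth y i - tnth x i | i < d])) =
  (2 * pi) ^+ d * cau e x y.
Proof.
move=> e0; rewrite (lap_fourier _ e0).1.
have -> : (2 * pi) ^+ d = \prod_(i < d) (2 * pi) :> R by rewrite prodr_const card_ord.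
rewrite -big_split/=; apply: eq_bigr => i _; rewrite tnth_mktuple /cau1.
have h : e ^+ 2 + (tnth y i - tnth x i) ^+ 2 != 0.
  by rewrite gt_eqF// ltr_wpDr ?sqr_ge0// exprn_gt0.
have p0 : @pi R != 0 by rewrite gt_eqF// pi_gt0.
move: (@pi R) p0 => p p0.
by field; apply/andP; split.
Qed.

Definition cont_at d (f : d.-tuple R -> R) (x : d.-tuple R) :=
  forall eta, 0 < eta -> exists2 del, 0 < del &
    forall y, (forall i, `|tnth y i - tnth x i| <= del) -> `|f y - f x| <= eta.

Lemma measurable_cau d e : 0 < e -> pmeas (@cau d e).
Proof.
move=> e0; apply: measurable_prod => i _.
have m1 : measurable_fun setT (cau1 e).
  have := (cau1_mass 0 e0).1 => /intgr_meas.
  by under eq_fun do rewrite subr0.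
apply: (measurableT_comp m1); apply: measurable_funB.
  exact: (measurableT_comp (measurable_tnth i) measurable_snd).
exact: (measurableT_comp (measurable_tnth i) measurable_fst).
Qed.

(** Away from 0, a narrow Cauchy density is small relative to the one of width
    1: for |t| > del one has e^2 + t^2 >= t^2 >= (1 + t^2) / (1 + del^-2). *)
Lemma cau1_tail e del t : 0 < e -> 0 < del -> del < `|t| ->
  cau1 e t <= e * (1 + del ^- 2) * cau1 1 t.
Proof.
move=> e0 del0 dt.
rewrite /cau1 !mulrA ler_wpM2r ?invr_ge0 ?pi_ge0// expr1n mulr1.
have t2 : del ^+ 2 <= t ^+ 2.
  by rewrite -(real_normK (num_real t)) ler_sqr ?nnegrE ?ltW// (lt_trans del0).
have d2 : 0 < del ^+ 2 by rewrite exprn_gt0.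
rewrite ler_pdivrMr; last by rewrite ltr_wpDr ?sqr_ge0// exprn_gt0.
rewrite -!mulrA ler_peMr ?(ltW e0)//.
rewrite mulrA mulrAC ler_pdivlMr ?ltr_wpDr ?sqr_ge0// mul1r.
apply: (@le_trans _ _ ((1 + del ^- 2) * t ^+ 2)); last first.
  rewrite ler_wpM2l ?addr_ge0 ?invr_ge0 ?sqr_ge0// lerDr sqr_ge0//.
rewrite mulrDl mul1r addrC lerD2l mulrC ler_pdivlMr// mul1r//.
Qed.

(** Near [x] the integrand varies by at most eta / 2.  Far from [x], some
    coordinate [i] differs by more than [del], and by [cau1_tail] the kernel is
    at most e times a fixed constant times a product of densities in which the
    i-th one has width 1; the sum over [i] has integral O(e). *)
Lemma cau_cvg d (f : d.-tuple R -> R) (M : R) (x : d.-tuple R) :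
  measurable_fun setT f -> (forall y, `|f y| <= M) -> cont_at f x ->
  \int[leb d]_y (f y * cau (k.+1%:R^-1) x y) @[k --> \oo] --> f x.
Proof.
move=> mf fM fx; apply/cvgrPdist_le => /= eta eta0.
have M0 : 0 <= M by rewrite (le_trans _ (fM x)).
have [del del0 fdel] := fx _ (divr_gt0 eta0 (ltr0n R 2)).
pose K := 2 * M * (1 + del ^- 2) * d%:R.
near=> k.
have eK : k.+1%:R^-1 * K <= eta / 2.
  near: k; exists (Num.truncn (K * 2 / eta)).+1 => // k /= kK.
  rewrite mulrC ler_pdivrMr ?ltr0n// -ler_pdivrMl ?divr_gt0// invf_div mulrC mulrA.
  apply: ltW; apply: (lt_le_trans (truncnS_gt _)); rewrite ler_nat (leq_trans kK)//.
set e := k.+1%:R^-1 in eK *.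
have e0 : 0 < e by rewrite invr_gt0 ltr0n.
have [ci cE] := cau_mass x e0.
have c0 : 0 <= e * (1 + del ^- 2).
  by apply: mulr_ge0; [exact: ltW|apply: addr_ge0 => //; rewrite invr_ge0 exprn_ge0// ltW].
pose g i k t := if k == i then e * (1 + del ^- 2) * cau1 1 (t - tnth x k) else cau1 e (t - tnth x k).
have gi i m : intgr leb1 (g i m).
  by rewrite /g; case: eqP => _; [apply: intgrZ; exact: (cau1_mass _ ltr01).1|exact: (cau1_mass _ e0).1].
have gE i m : \int[leb1]_t g i m t = if m == i then e * (1 + del ^- 2) else 1.
  rewrite /g; case: eqP => _; last exact: (cau1_mass _ e0).2.
  by rewrite RintegralZl// ?(cau1_mass _ ltr01).2 ?mulr1//; exact: (cau1_mass _ ltr01).1.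
have g0 i m t : 0 <= g i m t.
  rewrite /g; case: eqP => _; last exact: cau1_ge0.
  by apply: mulr_ge0 => //; exact: cau1_ge0.
have Gi i := (prod_tuple_integral (gi i)).1.
have GE i : \int[leb d]_y (\prod_k g i k (tnth y k)) = e * (1 + del ^- 2).
  rewrite (prod_tuple_integral (gi i)).2 (bigD1 i)//= gE eqxx big1 ?mulr1// => k' k'i.
  by rewrite gE (negPf k'i).
have fc : intgr (leb d) (fun y => f y * cau e x y).
  have := intgrM ci mf fM; rewrite /intgr; apply: eq_integrable => // y _.
  by rewrite /= mulrC.
have -> : f x - \int[leb d]_y (f y * cau e x y) = \int[leb d]_y ((f x - f y) * cau e x y).
  under [RHS]eq_Rintegral do rewrite mulrBl.
  by rewrite RintegralB ?RintegralZl ?cE ?mulr1//; exact: intgrZ.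
have sumi : intgr (leb d) (fun y => \sum_i \prod_k g i k (tnth y k)).
  exact: intgr_sum.
apply: (@le_trans _ _ (\int[leb d]_y (eta / 2 * cau e x y + 2 * M * \sum_i \prod_k g i k (tnth y k)))).
  apply: le_norm_Rint.
  - by apply: intgrD; exact: intgrZ.
  - by apply: measurable_funM; [exact: measurable_funB|exact: intgr_meas ci].
  move=> y; rewrite normrM (ger0_norm (cau_ge0 _ _ e0)).
  have S0 : 0 <= \sum_i \prod_k g i k (tnth y k).
    by apply: sumr_ge0 => i _; apply: prodr_ge0 => k' _; exact: g0.
  have [/forallP yx|] := boolP [forall i, `|tnth y i - tnth x i| <= del].
    rewrite -[leLHS]addr0 lerD//; last by rewrite !mulr_ge0.
    by rewrite ler_wpM2r ?cau_ge0// distrC fdel.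
  move=> h; have [ i ] := forallPn h; rewrite -ltNge => yi.
  rewrite -[leLHS]add0r lerD ?mulr_ge0 ?cau_ge0 ?divr_ge0 ?(ltW eta0)//.
  rewrite ler_pM ?cau_ge0//.
    by rewrite (le_trans (ler_normB _ _))// mulr_natl mulr2n lerD.
  rewrite (bigD1 i)//= -[leLHS]addr0 lerD//; last first.
    by apply: sumr_ge0 => j _; apply: prodr_ge0 => k' _; exact: g0.
  apply: ler_prod => k' _; rewrite cau1_ge0//= /g; case: eqP => // ->.
  exact: cau1_tail.
rewrite RintegralD; [|by []|exact: intgrZ|exact: intgrZ].
rewrite !RintegralZl// cE mulr1 Rint_sum//.
under eq_bigr do rewrite GE.
rewrite sumr_const card_ord -(mulr_natr _ d).
suff : 2 * M * (e * (1 + del ^- 2) * d%:R) <= eta / 2 by lra.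
move: eK; congr (_ <= _); rewrite /K; ring.
Unshelve. all: by end_near. Qed.

End euclidean.

(** * Averaging kernels and convergence in L2 *)

Section kernel_L2.
Context dd (T : measurableType dd) (R : realType).
Variable mu : {sigma_finite_measure set T -> \bar R}.

Definition smooth (k : T -> T -> R) (f : T -> R) (x : T) := \int[mu]_y (f y * k x y).

(** Both marginals have mass at most 1, so that [smooth k] is a contraction of
    L^2 by Schur's test ([smooth_L2]). *)
Definition contr_kernel (k : T -> T -> R) :=
  [/\ pmeas k, (forall x, intgr mu (k x) /\ \int[mu]_y `|k x y| <= 1) &
      (forall y, intgr mu (k ^~ y) /\ \int[mu]_x `|k x y| <= 1)].

Section one_kernel.
Variables (k : T -> T -> R) (f : T -> R) (M : R).
Hypothesis kc : contr_kernel k.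
Hypotheses (fi : intgr mu f) (fM : forall x, `|f x| <= M).

Let mf : measurable_fun setT f. Proof. exact: intgr_meas fi. Qed.
Let M0 (x : T) : 0 <= M. Proof. by rewrite (le_trans _ (fM x)). Qed.

Lemma kf_pintgr : pintgr mu mu (fun x y => f y * k x y).
Proof.
have [mk k1 k2] := kc.
apply: (pintgr_bound2 (b := fun y => `|f y|)).
- apply: measurable_funM => //; exact: (measurableT_comp mf).
- by move=> y; apply: intgrZ; have [] := k2 y.
- exact: intgr_norm.
- move=> y; under eq_Rintegral do rewrite normrM.
  rewrite RintegralZl//; last by apply: intgr_norm; have [] := k2 y.
  by rewrite ler_piMr//; have [] := k2 y.
Qed.

Lemma smooth_intgr : intgr mu (smooth k f).
Proof. exact: (intgr_fubini_F kf_pintgr). Qed.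

Lemma kf_intgr x : intgr mu (fun y => f y * k x y).
Proof.
have [mk k1 k2] := kc.
have := @intgrM _ _ _ mu M (k x) f (k1 x).1 mf fM.
by rewrite /intgr; apply: eq_integrable => // y _; rewrite /= mulrC.
Qed.

Lemma smooth_le x : `|smooth k f x| <= M.
Proof.
have [mk k1 k2] := kc; rewrite /smooth.
apply: (@le_trans _ _ (\int[mu]_y (M * `|k x y|))).
  apply: le_norm_Rint; first by apply/intgrZ/intgr_norm; have [] := k1 x.
    exact: intgr_meas (kf_intgr x).
  by move=> y; rewrite normrM ler_wpM2r.
rewrite RintegralZl//; last by apply: intgr_norm; have [] := k1 x.
by rewrite ler_piMr ?(M0 x)//; have [] := k1 x.
Qed.

Lemma sqr_intgr (g : T -> R) : intgr mu g -> (forall x, `|g x| <= M) -> intgr mu (fun x => g x ^+ 2).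
Proof. by move=> gi gM; apply: (intgrM gi) => //; exact: (intgr_meas gi). Qed.

(** Cauchy-Schwarz for the splitting f k = (f sqrt |k|) (sqrt |k|), then
    Fubini. *)
Lemma smooth_L2 : \int[mu]_x (smooth k f x ^+ 2) <= \int[mu]_x (f x ^+ 2).
Proof.
have [mk k1 k2] := kc.
have fi2 : intgr mu (fun x => f x ^+ 2) by exact: sqr_intgr.
have fkp : pintgr mu mu (fun x y => f y ^+ 2 * `|k x y|).
  apply: (pintgr_bound2 (b := fun y => f y ^+ 2)) => //.
  - apply: measurable_funM; last exact: measurableT_comp mk.
    by apply: measurable_funX; exact: (measurableT_comp mf).
  - by move=> y; apply/intgrZ/intgr_norm; have [] := k2 y.
  - move=> y; under eq_Rintegral do rewrite normrM normr_id.
    rewrite RintegralZl//; last by apply: intgr_norm; have [] := k2 y.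
    rewrite ger0_norm ?sqr_ge0//.
    by rewrite ler_piMr ?sqr_ge0//; have [] := k2 y.
have fki x : intgr mu (fun y => f y ^+ 2 * `|k x y|).
  have := @intgrM _ _ _ mu (M ^+ 2) (fun y => `|k x y|) (fun y => f y ^+ 2)
    (intgr_norm (k1 x).1) (measurable_funX 2 mf).
  rewrite /intgr => h.
  apply: eq_integrable (h _) => //; first by move=> y _; rewrite /= mulrC.
  move=> y; rewrite normrX ler_sqr ?nnegrE//; exact: M0.
apply: (@le_trans _ _ (\int[mu]_x \int[mu]_y (f y ^+ 2 * `|k x y|))).
  apply: intgr_le.
  - by apply: (intgrM smooth_intgr); [exact: intgr_meas smooth_intgr|exact: smooth_le].
  - exact: (intgr_fubini_F fkp).
  move=> x.
  pose a y := `|f y| * Num.sqrt `|k x y|; pose b y := Num.sqrt `|k x y|.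
  have mb : measurable_fun setT b.
    apply: (measurableT_comp (continuous_measurable_fun (@sqrt_continuous R))).
    by apply: measurableT_comp => //; exact: intgr_meas (k1 x).1.
  have ma : measurable_fun setT a by apply: measurable_funM => //; exact: measurableT_comp.
  have aE y : a y ^+ 2 = f y ^+ 2 * `|k x y|.
    by rewrite exprMn sqr_sqrtr// real_normK ?num_real.
  have bE y : b y ^+ 2 = `|k x y| by rewrite sqr_sqrtr.
  have ai : intgr mu (fun y => a y ^+ 2) by under eq_fun do rewrite aE; exact: fki.
  have bi : intgr mu (fun y => b y ^+ 2).
    by under eq_fun do rewrite bE; apply: intgr_norm; have [] := k1 x.
  apply: (@le_trans _ _ ((\int[mu]_y (a y * b y)) ^+ 2)).
    rewrite -(real_normK (num_real (smooth k f x))) ler_sqr ?nnegrE//; last first.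
      by apply: Rintegral_ge0 => y _; rewrite !mulr_ge0 ?sqrtr_ge0.
    apply: le_norm_Rint; [exact: intgrM2|exact: intgr_meas (kf_intgr x)|].
    by move=> y; rewrite normrM /a /b -mulrA -expr2 sqr_sqrtr.
  apply: (le_trans (Rint_CauchySchwarz ma mb ai bi)).
  under eq_Rintegral do rewrite aE; under [X in _ * X <= _]eq_Rintegral do rewrite bE.
  rewrite ler_piMr//; last by have [] := k1 x.
  by apply: Rintegral_ge0 => y _; rewrite mulr_ge0// sqr_ge0.
rewrite Rfubini//; apply: intgr_le => //; first exact: (intgr_fubini_G fkp).
move=> y; rewrite RintegralZl//; last by apply: intgr_norm; have [] := k2 y.
by rewrite ler_piMr ?sqr_ge0//; have [] := k2 y.
Qed.

End one_kernel.

(** Pointwise convergence suffices: by contractivity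
      ||S f - f||^2 <= 2 (||f||^2 - <f, S f>),
    and the scalar product converges by domination, S f being bounded. *)
Lemma smooth_cvg_L2 (k : nat -> T -> T -> R) (f : T -> R) (M : R) :
  (forall m, contr_kernel (k m)) -> intgr mu f -> (forall x, `|f x| <= M) ->
  (forall x, smooth (k m) f x @[m --> \oo] --> f x) ->
  (forall m, intgr mu (fun x => (smooth (k m) f x - f x) ^+ 2)) /\
  \int[mu]_x ((smooth (k m) f x - f x) ^+ 2) @[m --> \oo] --> (0 : R).
Proof.
move=> kc fi fM kf.
have mf := intgr_meas fi.
have si m := smooth_intgr (kc m) fi.
have sM m := smooth_le (kc m) fi fM.
have fi2 : intgr mu (fun x => f x ^+ 2) by exact: (sqr_intgr fi fM).
have si2 m : intgr mu (fun x => smooth (k m) f x ^+ 2) by exact: (sqr_intgr (si m) (sM m)).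
have fsi m : intgr mu (fun x => f x * smooth (k m) f x).
  by apply: (intgrM fi _ (sM m)); exact: intgr_meas.
have di m : intgr mu (fun x => (smooth (k m) f x - f x) ^+ 2).
  apply: (@sqr_intgr (M + M)); first exact: intgrB.
  by move=> x; rewrite (le_trans (ler_normB _ _))// lerD.
split => //.
have [_ fs] : intgr mu (fun x => f x * f x) /\
    \int[mu]_x (f x * smooth (k m) f x) @[m --> \oo] --> \int[mu]_x (f x * f x).
  apply: (Rdominated (g := fun x => M * `|f x|)).
  - by move=> m; exact: intgr_meas (fsi m).
  - by move=> x; apply: cvgM; [exact: cvg_cst|exact: kf].
  - exact/intgrZ/intgr_norm.
  - by move=> m x; rewrite normrM mulrC ler_wpM2r.
have E m : \int[mu]_x ((smooth (k m) f x - f x) ^+ 2) <=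
    2 * (\int[mu]_x (f x * f x) - \int[mu]_x (f x * smooth (k m) f x)).
  have -> : \int[mu]_x ((smooth (k m) f x - f x) ^+ 2) =
      \int[mu]_x (smooth (k m) f x ^+ 2) - 2 * \int[mu]_x (f x * smooth (k m) f x)
      + \int[mu]_x (f x ^+ 2).
    rewrite -RintegralZl; [|by []|exact: fsi].
    rewrite -RintegralB; [|by []|exact: si2|exact/intgrZ/fsi].
    rewrite -RintegralD; [|by []|by apply: intgrB; [exact: si2|exact/intgrZ/fsi]|exact: fi2].
    by apply: eq_Rintegral => x _; ring.
  have := smooth_L2 (kc m) fi fM.
  under [X in _ <= 2 * (X - _)]eq_Rintegral do rewrite -expr2.
  lra.
apply: (@squeeze_cvgr _ _ _ _ (fun=> 0) (fun m => 2 * (\int[mu]_x (f x * f x) - \int[mu]_x (f x * smooth (k m) f x)))).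
- by apply: nearW => m; rewrite E andbT; apply: Rintegral_ge0 => x _; exact: sqr_ge0.
- exact: cvg_cst.
- rewrite [X in _ --> X](_ : 0 = 2 * (\int[mu]_x (f x * f x) - \int[mu]_x (f x * f x))); last by rewrite subrr mulr0.
  by apply: cvgM; [exact: cvg_cst|apply: cvgB; [exact: cvg_cst|exact: fs]].
Qed.

End kernel_L2.

Section L2.
Context dd (T : measurableType dd) (R : realType).
Variable mu : {measure set T -> \bar R}.

Lemma Lnorm2_fin (h : T -> R) : intgr mu (fun x => h x ^+ 2) ->
  ('N[mu]_2%:E[EFin \o h] = (Num.sqrt (\int[mu]_x (h x ^+ 2)))%:E)%E.
Proof.
move=> hi; rewrite unlock.
have -> : (\int[mu]_x (`|(EFin \o h) x| `^ 2%R) = (\int[mu]_x (h x ^+ 2))%:E)%E.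
  rewrite Rint_EFin//; apply: eq_integral => x _ /=.
  by rewrite powR_mulrn// real_normK ?num_real.
by rewrite poweR_EFin powR12_sqrt// Rintegral_ge0// => x _; rewrite sqr_ge0.
Qed.

Lemma Lnorm2_lty (h : T -> R) : measurable_fun setT h ->
  ('N[mu]_2%:E[EFin \o h] < +oo)%E -> intgr mu (fun x => h x ^+ 2).
Proof.
move=> mh h2; apply: Lfun2_integrable_sqr.
by rewrite inE; apply/andP; split; rewrite inE.
Qed.

Lemma Lfun2P (h : T -> R) : h \in Lfun mu 2%:E <->
  measurable_fun setT h /\ intgr mu (fun x => h x ^+ 2).
Proof.
split=> [hL|[mh hi]].
  by split; [move: hL; rewrite inE => /andP[]; rewrite inE|exact: Lfun2_integrable_sqr].
rewrite inE; apply/andP; split; rewrite inE//=.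
by rewrite /finite_norm Lnorm2_fin// ltry.
Qed.

Lemma Lnorm2_cvg0 (h : nat -> T -> R) : (forall m, intgr mu (fun x => h m x ^+ 2)) ->
  \int[mu]_x (h m x ^+ 2) @[m --> \oo] --> (0 : R) ->
  ('N[mu]_2%:E[EFin \o h m] @[m --> \oo] --> 0)%E.
Proof.
move=> hi h0; under eq_cvg do rewrite Lnorm2_fin//.
apply: cvg_EFin; first exact: nearW.
rewrite -[X in _ --> X](@sqrtr0 R).
by apply: (@cvg_comp _ _ _ (fun m => \int[mu]_x (h m x ^+ 2)) Num.sqrt) h0 _; exact: sqrt_continuous.
Qed.

(** Only eventually: a sequence converging to 0 in norm may have finitely many
    terms of infinite norm. *)
Lemma Lnorm2_cvg0_inv (h : nat -> T -> R) : (forall m, measurable_fun setT (h m)) ->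
  ('N[mu]_2%:E[EFin \o h m] @[m --> \oo] --> 0)%E ->
  (\forall m \near \oo, intgr mu (fun x => h m x ^+ 2)) /\
  \int[mu]_x (h m x ^+ 2) @[m --> \oo] --> (0 : R).
Proof.
move=> mh /fine_cvgP[hfin h0].
have nh : \forall m \near \oo, intgr mu (fun x => h m x ^+ 2).
  apply: filterS hfin => m hm; apply: Lnorm2_lty => //.
  by rewrite ltey_eq hm.
split=> //.
have : Num.sqrt (\int[mu]_x (h m x ^+ 2)) @[m --> \oo] --> (0 : R).
  apply: cvg_trans h0; apply: near_eq_cvg.
  by apply: filterS nh => m hm /=; rewrite Lnorm2_fin.
move=> h1.
have : (Num.sqrt (\int[mu]_x (h m x ^+ 2))) ^+ 2 @[m --> \oo] --> (0 ^+ 2 : R).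
  exact: (@cvg_comp _ _ _ (fun m => Num.sqrt (\int[mu]_x (h m x ^+ 2))) (fun x : R => x ^+ 2)) h1 (@exprn_continuous _ _ _).
rewrite expr0n /=; apply: cvg_trans; apply: near_eq_cvg; apply: nearW => m.
by rewrite sqr_sqrtr// Rintegral_ge0// => x _; rewrite sqr_ge0.
Qed.

Lemma L2_pairing (h : nat -> T -> R) (p : T -> R) :
  (forall m, measurable_fun setT (h m)) -> measurable_fun setT p ->
  (\forall m \near \oo, intgr mu (fun x => h m x ^+ 2)) ->
  \int[mu]_x (h m x ^+ 2) @[m --> \oo] --> (0 : R) ->
  intgr mu (fun x => p x ^+ 2) ->
  \int[mu]_x (h m x * p x) @[m --> \oo] --> (0 : R).
Proof.
move=> mh mp hi h0 pi2.
have : (Num.sqrt (\int[mu]_x (h m x ^+ 2) * \int[mu]_x (p x ^+ 2))) @[m --> \oo] --> (0 : R).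
  rewrite -[X in _ --> X](@sqrtr0 R) -(mul0r (\int[mu]_x (p x ^+ 2))).
  apply: (@cvg_comp _ _ _ (fun m => \int[mu]_x (h m x ^+ 2) * \int[mu]_x (p x ^+ 2)) Num.sqrt); last exact: sqrt_continuous.
  by apply: cvgM => //; exact: cvg_cst.
move=> s0; apply/norm_cvg0P.
apply: (@squeeze_cvgr _ _ _ _ (fun=> 0) (fun m => Num.sqrt (\int[mu]_x (h m x ^+ 2) * \int[mu]_x (p x ^+ 2)))) => //; last exact: cvg_cst.
apply: filterS hi => m hm; rewrite normr_ge0/=.
rewrite -sqrtr_sqr ler_wsqrtr//; exact: Rint_CauchySchwarz.
Qed.

End L2.

(** * Sequential continuity *)

Section continuity.
Variables (R : realType) (d : nat).
Implicit Types (f g : d.-tuple R -> R) (x : d.-tuple R).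

Lemma Rd_continuous_at g x : Rd_continuous g -> cont_at g x.
Proof.
move=> cg eta eta0.
have E (y : d.-tuple R) : [tuple (\row_i tnth y i) ord0 i | i < d] = y.
  by apply: eq_from_tnth => i; rewrite tnth_mktuple mxE.
have /cvgrPdist_le/(_ eta eta0) := cg (\row_i tnth x i).
rewrite E => /nbhs_ballP[del /= del0 h].
exists (del / 2); first by rewrite divr_gt0.
move=> y yx; rewrite distrC -{1}(E y); apply: h; split=> // i j /=.
rewrite !mxE /ball/= distrC (le_lt_trans (yx _))// ltr_pdivrMr// ltr_pMr//.
by rewrite ltr1n.
Qed.

Lemma cont_at_Rd g : (forall x, cont_at g x) -> Rd_continuous g.
Proof.
move=> cg v; apply/(@cvgrPdist_le _ _ _ (nbhs v) (nbhs_filter v)) => /= eta eta0.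
have [del del0 h] := cg [tuple v ord0 i | i < d] eta eta0.
apply/nbhs_ballP; exists del => //= u vu.
rewrite distrC; apply: h => i; rewrite !tnth_mktuple.
by have := vu.2 ord0 i; rewrite /ball/= distrC => /ltW.
Qed.

(** Sequential continuity, for convergence of every coordinate: the form of
    continuity that dominated convergence yields for integrals depending on a
    parameter ([scont_int]). *)
Definition scont f x := forall y_ : nat -> d.-tuple R,
  (forall i, tnth (y_ k) i @[k --> \oo] --> tnth x i) ->
  f (y_ k) @[k --> \oo] --> f x.

Lemma scont_cont_at f x : scont f x -> cont_at f x.
Proof.
move=> sf; apply: contrapT => nf.
have [eta eta0 h] : exists2 eta, 0 < eta & forall del, 0 < del ->
    exists y, (forall i, `|tnth y i - tnth x i| <= del) /\ eta < `|f y - f x|.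
  apply: contrapT => h; apply: nf => eta eta0.
  apply: contrapT => h2; apply: h; exists eta => // del del0.
  apply: contrapT => h3; apply: h2; exists del => // y hy.
  rewrite leNgt; apply/negP => h4; apply: h3; by exists y.
have /choice[y_ hy] : forall k : nat, exists y : d.-tuple R,
    (forall i, `|tnth y i - tnth x i| <= k.+1%:R^-1) /\ eta < `|f y - f x|.
  by move=> k; apply: h; rewrite invr_gt0.
have /sf/cvgrPdist_lt/(_ eta eta0) : forall i, tnth (y_ k) i @[k --> \oo] --> tnth x i.
  move=> i; apply/subr_cvg0/norm_cvg0P.
  apply: (@squeeze_cvgr _ _ _ _ (fun=> 0) (fun k => k.+1%:R^-1)).
  - by apply: nearW => k; rewrite normr_ge0/=; exact: (hy k).1.
  - exact: cvg_cst.
  - exact: cvg_harmonic.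
move=> [N _ /(_ N (leqnn N))] /=.
by rewrite distrC => /lt_trans /(_ (hy N).2); rewrite ltxx.
Qed.

Lemma scont_cst c x : scont (fun=> c) x.
Proof. by move=> y_ _; exact: cvg_cst. Qed.

Lemma scont_tnth i x : scont (fun y => tnth y i) x.
Proof. by move=> y_ h; exact: h. Qed.

Lemma scontD f g x : scont f x -> scont g x -> scont (fun y => f y + g y) x.
Proof. by move=> sf sg y_ h; apply: cvgD; [exact: sf|exact: sg]. Qed.

Lemma scontN f x : scont f x -> scont (fun y => - f y) x.
Proof. by move=> sf y_ h; apply: cvgN; exact: sf. Qed.

Lemma scontM f g x : scont f x -> scont g x -> scont (fun y => f y * g y) x.
Proof. by move=> sf sg y_ h; apply: cvgM; [exact: sf|exact: sg]. Qed.

Lemma scont_comp (phi : R -> R) f x : {for f x, continuous phi} -> scont f x ->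
  scont (fun y => phi (f y)) x.
Proof. by move=> cp sf y_ h; apply: continuous_cvg => //; exact: sf. Qed.

Lemma scont_sum (I : Type) (s : seq I) (P : pred I) (F : I -> d.-tuple R -> R) x :
  (forall i, P i -> scont (F i) x) -> scont (fun y => \sum_(i <- s | P i) F i y) x.
Proof.
move=> sF; elim: s => [|i s IHs].
  by under eq_fun do rewrite big_nil; exact: scont_cst.
have [Pi|Pi] := boolP (P i); last by under eq_fun do rewrite big_cons (negPf Pi).
rewrite (_ : (fun y => _) = (fun y => F i y + \sum_(i <- s | P i) F i y)); last first.
  by apply/funext => y; rewrite big_cons Pi.
by apply: (@scontD (F i)) => //; exact: sF.
Qed.

Lemma scont_prod (I : Type) (s : seq I) (P : pred I) (F : I -> d.-tuple R -> R) x :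
  (forall i, P i -> scont (F i) x) -> scont (fun y => \prod_(i <- s | P i) F i y) x.
Proof.
move=> sF; elim: s => [|i s IHs].
  by under eq_fun do rewrite big_nil; exact: scont_cst.
have [Pi|Pi] := boolP (P i); last by under eq_fun do rewrite big_cons (negPf Pi).
rewrite (_ : (fun y => _) = (fun y => F i y * \prod_(i <- s | P i) F i y)); last first.
  by apply/funext => y; rewrite big_cons Pi.
by apply: (@scontM (F i)) => //; exact: sF.
Qed.

Lemma scont_cos f x : scont f x -> scont (fun y => cos (f y)) x.
Proof. by move=> sf; exact: (scont_comp (@continuous_cos R (f x)) sf). Qed.

Lemma scont_sin f x : scont f x -> scont (fun y => sin (f y)) x.
Proof. by move=> sf; exact: (scont_comp (@continuous_sin R (f x)) sf). Qed.

Lemma scont_dotp w x : scont (dotp w) x.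
Proof.
by apply: scont_sum => i _; apply: scontM; [exact: scont_cst|exact: scont_tnth].
Qed.

Lemma scont_int dd (T : measurableType dd) (mu : {measure set T -> \bar R})
    (h : T -> d.-tuple R -> R) (b : T -> R) x :
  (forall y, measurable_fun setT (h ^~ y)) -> intgr mu b ->
  (forall t y, `|h t y| <= b t) -> (forall t, scont (h t) x) ->
  scont (fun y => \int[mu]_t h t y) x.
Proof.
move=> mh bi hb hx y_ yx.
have [] // := @Rdominated _ _ _ mu (fun k t => h t (y_ k)) (fun t => h t x) b _ _ bi _.
by move=> t; exact: hx.
Qed.

End continuity.

(** * Damped Fourier inversion *)

Section fourier_inversion.
Variables (R : realType) (d : nat).
Local Notation leb1 := (@lebesgue_measure R).
Local Notation leb := (lebesgue_tuple R d).
Local Notation tup := (d.-tuple R).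

(** The constant of the unitary Fourier transform. *)
Definition cfour : R := (2 * pi) `^ (- (d%:R / 2)).

Lemma cfour_gt0 : 0 < cfour.
Proof. by rewrite powR_gt0// mulr_gt0// pi_gt0. Qed.

Lemma cfour_sqr : cfour * cfour * (2 * pi) ^+ d = 1.
Proof.
have p0 : 0 < 2 * @pi R by rewrite mulr_gt0// pi_gt0.
rewrite -(powR_mulrn _ (ltW p0)) -!powRD ?(gt_eqF p0) ?implybT//.
by rewrite -opprD -splitr addNr powRr0.
Qed.

Lemma normc_sqrE (a b : R) : (Normc.normc (Complex a b)) ^+ 2 = a ^+ 2 + b ^+ 2.
Proof. by rewrite /= sqr_sqrtr// addr_ge0// sqr_ge0. Qed.

Lemma pmeas_dotp : pmeas (@dotp R d).
Proof. exact: measurable_dotp2. Qed.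

Lemma intgr_trig (u : tup -> R) (tr : R -> R) (w : tup) : measurable_fun setT tr ->
  (forall t, `|tr t| <= 1) -> intgr leb u -> intgr leb (fun x => u x * tr (dotp w x)).
Proof.
move=> mtr tr1 ui; apply: (intgrM ui _ (fun x => tr1 _)).
by apply: (measurableT_comp mtr); exact: (pmeas1 w pmeas_dotp).
Qed.

Lemma measurable_cos : measurable_fun setT (@cos R).
Proof. by apply: continuous_measurable_fun; exact: continuous_cos. Qed.

Lemma measurable_sin : measurable_fun setT (@sin R).
Proof. by apply: continuous_measurable_fun; exact: continuous_sin. Qed.

Lemma measurable_trig_transform (u : tup -> R) (tr : R -> R) : measurable_fun setT tr ->
  (forall t, `|tr t| <= 1) -> intgr leb u ->
  measurable_fun setT (fun w => \int[leb]_x (u x * tr (dotp w x))).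
Proof.
move=> mtr tr1 ui.
apply: (@measurable_Rint _ _ _ _ R leb (fun w x => u x * tr (dotp w x))).
  apply: measurable_funM; first exact: (measurableT_comp (intgr_meas ui) measurable_snd).
  exact: (measurableT_comp mtr pmeas_dotp).
by move=> w; exact: intgr_trig.
Qed.

Lemma measurable_fourier (u : tup -> R) : intgr leb u ->
  measurable_fun setT (fun w => complex.Re (fourier u w)) /\
  measurable_fun setT (fun w => complex.Im (fourier u w)).
Proof.
move=> ui; split.
  apply: measurable_funM => //; apply: measurable_trig_transform => //.
    exact: measurable_cos.
  exact: cos_max.
apply: measurableT_comp => //.
apply: measurable_funM => //; apply: measurable_trig_transform => //.
  exact: measurable_sin.
exact: sin_max.
Qed.

(** The inverse Fourier transform at [y] of the function with real part [F1]
    and imaginary part [F2], multiplied by [damp]; only its real part, as the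
    functions under consideration are real. *)
Definition inverse_fourier (F1 F2 : tup -> R) (damp : tup -> R) (y : tup) : R :=
  cfour * \int[leb]_w ((F1 w * cos (dotp w y) - F2 w * sin (dotp w y)) * damp w).

Lemma lap_measurable (e : R) : 0 < e -> measurable_fun setT (@lap R d e).
Proof. by move=> e0; exact: intgr_meas (lap_intgr _ e0). Qed.

Lemma cau_le (e : R) (x y : tup) : 0 < e -> cau e y x <= (e^-1 / pi) ^+ d.
Proof.
move=> e0; rewrite -[X in (_ ^+ X)](card_ord d) -prodr_const; apply: ler_prod => i _.
rewrite cau1_ge0//= /cau1 ler_wpM2r ?invr_ge0 ?pi_ge0//.
rewrite ler_pdivrMr; last by rewrite ltr_wpDr ?sqr_ge0// exprn_gt0.
by rewrite mulrDr expr2 mulrA mulVf ?gt_eqF// mul1r lerDl mulr_ge0 ?sqr_ge0 ?invr_ge0 ?ltW.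
Qed.

(** By Fubini, damping in frequency is convolution with the transform of the
    damping factor. *)
Lemma fourier_damped (u : tup -> R) (e : R) (y : tup) : intgr leb u -> 0 < e ->
  inverse_fourier (fun w => complex.Re (fourier u w)) (fun w => complex.Im (fourier u w)) (lap e) y =
  \int[leb]_x (u x * cau e y x).
Proof.
move=> ui e0.
have mu := intgr_meas ui.
pose K (w x : tup) := u x * (lap e w * cos (dotp w [tuple tnth x i - tnth y i | i < d])).
have dotB w x : dotp w [tuple tnth x i - tnth y i | i < d] = dotp w x - dotp w y.
  by rewrite /dotp -sumrB; apply: eq_bigr => i _; rewrite tnth_mktuple mulrBr.
have Kp : pintgr leb leb K.
  apply: (@pintgr_prod _ _ _ _ R leb leb _ (fun w => lap e w) (fun x => `|u x|)).
  - apply: measurable_funM; first exact: (measurableT_comp mu measurable_snd).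
    apply: measurable_funM; first exact: (measurableT_comp (lap_measurable e0) measurable_fst).
    apply: (measurableT_comp measurable_cos).
    rewrite (_ : (fun x => _) = (fun z : tup * tup => dotp z.1 z.2 - dotp z.1 y)); last first.
      by apply/funext => z; rewrite dotB.
    apply: measurable_funB; first exact: pmeas_dotp.
    by apply: measurable_dotp2.
  - exact: lap_intgr.
  - exact: intgr_norm.
  - move=> w x; rewrite /K normrM mulrC ler_wpM2r// normrM ger0_norm ?lap_ge0//.
    by rewrite ler_piMr ?lap_ge0// cos_max.
have ic w := intgr_trig w measurable_cos (@cos_max R) ui.
have is_ w := intgr_trig w measurable_sin (@sin_max R) ui.
rewrite /inverse_fourier.
transitivity (cfour * \int[leb]_w \int[leb]_x (cfour * K w x)).
  congr (_ * _); apply: eq_Rintegral => w _; rewrite /fourier /= -/cfour.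
  transitivity (\int[leb]_x (cfour * lap e w * cos (dotp w y) * (u x * cos (dotp w x)) + cfour * lap e w * sin (dotp w y) * (u x * sin (dotp w x)))).
    rewrite RintegralD; [|by []|exact: intgrZ|exact: intgrZ].
    rewrite !RintegralZl; [|by []|exact: is_|by []|exact: ic].
    ring.
  by apply: eq_Rintegral => x _; rewrite /K dotB cosB; ring.
rewrite Rfubini; last first.
  exact: (@intgrZ _ _ _ _ cfour (fun z => K z.1 z.2)).
transitivity (cfour * \int[leb]_x (cfour * (2 * pi) ^+ d * (u x * cau e y x))).
  congr (_ * _); apply: eq_Rintegral => x _.
  have ci : intgr leb (fun w => lap e w * cos (dotp w [tuple tnth x i - tnth y i | i < d])).
    apply: (intgrM (lap_intgr _ e0) _ (fun w => @cos_max R _)).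
    by apply: (measurableT_comp measurable_cos); exact: measurable_dotp.
  rewrite RintegralZl; [|by []|exact: intgrZ].
  rewrite RintegralZl; [|by []|exact: ci].
  rewrite lap_cau//; ring.
have uci : intgr leb (fun x => u x * cau e y x).
  have [ci _] := cau_mass y e0.
  apply: (@intgrM _ _ _ _ ((e^-1 / pi) ^+ d)) => //; first exact: intgr_meas ci.
  by move=> x; rewrite ger0_norm ?cau_ge0// cau_le.
by rewrite RintegralZl// !mulrA cfour_sqr mul1r.
Qed.

Lemma cau_sqr_intgr (e : R) (y : tup) : 0 < e -> intgr leb (fun x => cau e y x ^+ 2).
Proof.
move=> e0; have [ci _] := cau_mass y e0; apply: (sqr_intgr ci) => x.
by rewrite ger0_norm ?cau_ge0//; exact: cau_le.
Qed.

Lemma pair_cvg (h : nat -> tup -> R) (f p : tup -> R) :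
  (forall m, measurable_fun setT (h m)) -> measurable_fun setT f -> measurable_fun setT p ->
  (forall m, intgr leb (fun x => h m x * p x)) -> intgr leb (fun x => f x * p x) ->
  (\forall m \near \oo, intgr leb (fun x => (h m x - f x) ^+ 2)) ->
  \int[leb]_x ((h m x - f x) ^+ 2) @[m --> \oo] --> (0 : R) ->
  intgr leb (fun x => p x ^+ 2) ->
  \int[leb]_x (h m x * p x) @[m --> \oo] --> \int[leb]_x (f x * p x).
Proof.
move=> mh mf mp hpi fpi di d0 pi2; apply/subr_cvg0.
have := L2_pairing (fun m => measurable_funB (mh m) mf) mp di d0 pi2.
apply: cvg_trans; apply: near_eq_cvg; apply: nearW => m /=.
rewrite -RintegralB; [|by []|exact: hpi|exact: fpi].
by apply: eq_Rintegral => x _; rewrite mulrBl.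
Qed.

(** Both sides of [fourier_damped] are continuous for the L^2 convergence of
    [u] and of its Fourier transform, because the Laplace and the Cauchy
    kernels are square integrable.  Hence the identity passes to the limit in
    the definition of [fourierL2]. *)
Lemma fourierL2_damped (g : tup -> R) (F : tup -> R[i]) (e : R) (y : tup) :
  fourierL2 g F -> 0 < e ->
  intgr leb (fun w => complex.Re (F w)) -> intgr leb (fun w => complex.Im (F w)) ->
  inverse_fourier (fun w => complex.Re (F w)) (fun w => complex.Im (F w)) (lap e) y =
  \int[leb]_x (g x * cau e y x).
Proof.
move=> [/Lfun2P[mg gi] mFr mFi [u [uL ug uF]]] e0 iFr iFi.
have u1 k : intgr leb (u k) by apply/Lfun1_integrable; exact: (uL k).1.
have mu_ k := intgr_meas (u1 k).
have [mc ci] : measurable_fun setT (@cau R d e y) /\ intgr leb (cau e y).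
  by have [ci _] := cau_mass y e0; split => //; exact: intgr_meas ci.
have [n1 c1] := Lnorm2_cvg0_inv (fun k => measurable_funB (mu_ k) mg) ug.
have gc : intgr leb (fun x => g x * cau e y x).
  by apply: intgrM2 => //; exact: cau_sqr_intgr.
have ucB x : `|cau e y x| <= (e^-1 / pi) ^+ d.
  by rewrite ger0_norm ?cau_ge0//; exact: cau_le.
have uc k : intgr leb (fun x => u k x * cau e y x) by exact: (intgrM (u1 k) mc ucB).
have L1 : \int[leb]_x (u k x * cau e y x) @[k --> \oo] --> \int[leb]_x (g x * cau e y x).
  apply: pair_cvg => //; exact: cau_sqr_intgr.
pose ur k w := complex.Re (fourier (u k) w); pose ui k w := complex.Im (fourier (u k) w).
have mur k : measurable_fun setT (ur k) by exact: (measurable_fourier (u1 k)).1.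
have mui k : measurable_fun setT (ui k) by exact: (measurable_fourier (u1 k)).2.
pose Fr w := complex.Re (F w); pose Fi w := complex.Im (F w).
have nE k w : Normc.normc (fourier (u k) w - F w) ^+ 2 = (ur k w - Fr w) ^+ 2 + (ui k w - Fi w) ^+ 2.
  by rewrite /ur /ui /Fr /Fi; case: (F w) => a b; rewrite normc_sqrE.
have mn k : measurable_fun setT (fun w => Normc.normc (fourier (u k) w - F w)).
  rewrite (_ : (fun w => _) = (fun w => Num.sqrt ((ur k w - Fr w) ^+ 2 + (ui k w - Fi w) ^+ 2))).
    apply: (measurableT_comp (continuous_measurable_fun (@sqrt_continuous R))).
    by apply: measurable_funD; apply: measurable_funX; exact: measurable_funB.
  by apply/funext => w; rewrite -nE sqrtr_sqr ger0_norm//; case: (_ - _) => a b /=; exact: sqrtr_ge0.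
have [n2 c2] := Lnorm2_cvg0_inv mn uF.
have part (h : nat -> tup -> R) (f : tup -> R) : (forall k, measurable_fun setT (h k)) -> measurable_fun setT f ->
   (forall k w, (h k w - f w) ^+ 2 <= Normc.normc (fourier (u k) w - F w) ^+ 2) ->
   (\forall m \near \oo, intgr leb (fun x => (h m x - f x) ^+ 2)) /\
    \int[leb]_x ((h m x - f x) ^+ 2) @[m --> \oo] --> (0 : R).
  move=> mh mf hf.
  have nh : \forall m \near \oo, intgr leb (fun x => (h m x - f x) ^+ 2).
    apply: filterS n2 => k ik; apply: (intgr_dom ik).
      by apply: measurable_funX; exact: measurable_funB.
    by move=> w; rewrite ger0_norm ?sqr_ge0.
  split=> //.
  apply: (@squeeze_cvgr _ _ _ _ (fun=> 0) (fun k => \int[leb]_w (Normc.normc (fourier (u k) w - F w) ^+ 2))) => //; last exact: cvg_cst.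
  near=> k; apply/andP; split; first by apply: Rintegral_ge0 => w _; exact: sqr_ge0.
  by apply: intgr_le; [near: k; exact: nh|near: k; exact: n2|exact: hf].
have lap2 : intgr leb (fun w => lap e w ^+ 2).
  apply: (sqr_intgr (lap_intgr _ e0) (M := 1)) => w.
  by rewrite ger0_norm ?lap_ge0// lap_le1// ltW.
have trig (tr : R -> R) (h : nat -> tup -> R) (f : tup -> R) : measurable_fun setT tr -> (forall t, `|tr t| <= 1) ->
    (forall k, measurable_fun setT (h k)) -> measurable_fun setT f ->
    (forall k, intgr leb (fun w => h k w * lap e w)) -> intgr leb f ->
   (forall k w, (h k w - f w) ^+ 2 <= Normc.normc (fourier (u k) w - F w) ^+ 2) ->
   [/\ (forall k, intgr leb (fun w => h k w * (tr (dotp w y) * lap e w))),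
     intgr leb (fun w => f w * (tr (dotp w y) * lap e w)) &
   \int[leb]_w (h k w * (tr (dotp w y) * lap e w)) @[k --> \oo] --> \int[leb]_w (f w * (tr (dotp w y) * lap e w))].
  move=> mtr tr1 mh mf hl fi hf.
  have mtd : measurable_fun setT (fun w : tup => tr (dotp w y)).
    by apply: (measurableT_comp mtr); exact: measurable_dotp.
  have ml := lap_measurable e0.
  have i1 k : intgr leb (fun w => h k w * (tr (dotp w y) * lap e w)).
    have := intgrM (hl k) mtd (fun w => tr1 _).
    by rewrite /intgr; apply: eq_integrable => // w _ /=; congr (_%:E); ring.
  have i2 : intgr leb (fun w => f w * (tr (dotp w y) * lap e w)).
    apply: (@intgrM _ _ _ _ 1) => //; first exact: measurable_funM.
    by move=> w; rewrite normrM mulr_ile1// ger0_norm ?lap_ge0// lap_le1// ltW.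
  split => //.
  have [ni ci0] := part h f mh mf hf.
  apply: pair_cvg => //; first exact: measurable_funM.
  apply: (intgr_dom lap2).
    by apply: measurable_funX; exact: measurable_funM.
  move=> w; rewrite ger0_norm ?sqr_ge0// exprMn ler_piMl ?sqr_ge0//.
  by rewrite -(real_normK (num_real _)) expr_le1.
have ubound k (tr : R -> R) : (forall t, `|tr t| <= 1) -> measurable_fun setT tr ->
    intgr leb (fun w => (cfour * \int[leb]_x (u k x * tr (dotp w x))) * lap e w).
  move=> tr1 mtr.
  have := @intgrM _ _ _ leb (cfour * \int[leb]_x `|u k x|) _ (fun w => cfour * \int[leb]_x (u k x * tr (dotp w x))) (lap_intgr d e0).
  have mm : measurable_fun setT (fun w : tup => cfour * \int[leb]_x (u k x * tr (dotp w x))).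
    by apply: measurable_funM => //; exact: measurable_trig_transform.
  move=> /(_ mm) hh.
  have := hh _; rewrite /intgr => hh'.
  apply: eq_integrable (hh' _) => //; first by move=> w _; rewrite /= mulrC.
  move=> w; rewrite normrM gtr0_norm ?cfour_gt0// ler_wpM2l ?(ltW cfour_gt0)//.
  apply: le_norm_Rint; first exact: intgr_norm.
    exact: intgr_meas (intgr_trig _ _ _ _).
  by move=> x; rewrite normrM ler_piMr.
have [|||i1 i1' c1'] := trig cos ur Fr measurable_cos (@cos_max R) mur mFr.
- by move=> k; exact: (ubound k cos (@cos_max R) measurable_cos).
- exact: iFr.
- by move=> k w; rewrite nE lerDl sqr_ge0.
have [|||i2 i2' c2'] := trig sin ui Fi measurable_sin (@sin_max R) mui mFi.
- move=> k; have := intgrN (ubound k sin (@sin_max R) measurable_sin).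
  by rewrite /intgr; apply: eq_integrable => // w _ /=; rewrite mulNr.
- exact: iFi.
- by move=> k w; rewrite nE lerDr sqr_ge0.
have split_int (a b : tup -> R) : intgr leb (fun w => a w * (cos (dotp w y) * lap e w)) ->
    intgr leb (fun w => b w * (sin (dotp w y) * lap e w)) ->
    inverse_fourier a b (lap e) y = cfour * (\int[leb]_w (a w * (cos (dotp w y) * lap e w)) -
      \int[leb]_w (b w * (sin (dotp w y) * lap e w))).
  move=> ia ib; rewrite /inverse_fourier; congr (_ * _); rewrite -RintegralB//.
  by apply: eq_Rintegral => w _; ring.
have L2 : inverse_fourier (ur k) (ui k) (lap e) y @[k --> \oo] --> inverse_fourier Fr Fi (lap e) y.
  rewrite split_int//; under eq_cvg do rewrite split_int//.
  by apply: cvgM; [exact: cvg_cst|exact: cvgB].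
have L1' : inverse_fourier (ur k) (ui k) (lap e) y @[k --> \oo] --> \int[leb]_x (g x * cau e y x).
  apply: cvg_trans L1; apply: near_eq_cvg; apply: nearW => k.
  by rewrite [RHS]fourier_damped.
by rewrite -[LHS](cvg_lim (@Rhausdorff R) L2) -[RHS](cvg_lim (@Rhausdorff R) L1').
Unshelve. all: by end_near. Qed.

End fourier_inversion.

(** * Fourier inversion for continuous functions *)

Section inversion.
Variables (R : realType) (d : nat).
Local Notation leb1 := (@lebesgue_measure R).
Local Notation leb := (lebesgue_tuple R d).
Local Notation tup := (d.-tuple R).

(** A continuous function supported in [- del, del]; products of such functions
    localise the comparison of the two sides of the inversion formula. *)
Definition bump1 (del t : R) : R := Num.max 0 (del - `|t|).

Lemma bump1_ge0 del t : 0 <= bump1 del t.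
Proof. by rewrite le_max lexx. Qed.

Lemma bump1_le del t : 0 <= del -> bump1 del t <= del.
Proof. by move=> d0; rewrite ge_max d0 lerBlDr lerDl /=. Qed.

Lemma bump1_out del t : del <= `|t| -> bump1 del t = 0.
Proof. by move=> dt; apply/max_idPl; rewrite subr_le0. Qed.

Lemma bump1_continuous del u : continuous (fun t => bump1 del (t - u)).
Proof.
move=> t; apply: (@continuous_max _ _ (fun=> 0) (fun t => del - `|t - u|)).
  exact: cvg_cst.
apply: cvgB; first exact: cvg_cst.
apply: (@continuous_comp _ _ _ (fun t => t - u) (fun t => `|t|)).
  by apply: cvgB; [exact: cvg_id|exact: cvg_cst].
exact: norm_continuous.
Qed.

Lemma indic_itv_int (a b : R) : a <= b ->
  intgr leb1 (\1_`[a, b] : R -> R) /\ \int[leb1]_t (\1_`[a, b] t) = b - a.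
Proof.
move=> ab; have mI : measurable (`[a, b]%classic : set R) by exact: measurable_itv.
have E : (\int[leb1]_t (\1_`[a, b] t : R)%:E = (b - a)%:E)%E.
  rewrite integral_indic// setIT /= lebesgue_measure_itv/= lte_fin.
  by move: ab; rewrite le_eqVlt => /predU1P[->|->]; rewrite ?ltxx ?subrr ?EFinB.
split; last by rewrite /Rintegral E.
apply: (@ge0_intgr _ _ _ _ _ (b - a)%:E); rewrite ?E ?ltry//.
Qed.

Lemma bump1_int del u : 0 < del ->
  intgr leb1 (fun t => bump1 del (t - u)) /\ 0 < \int[leb1]_t bump1 del (t - u).
Proof.
move=> del0.
have h x (e : R) : (x \in `[u - e, u + e]) = (`|x - u| <= e).
  by rewrite in_itv/= ler_norml; apply/andP/andP => -[h1 h2]; split; lra.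
have [i1 _] := @indic_itv_int (u - del) (u + del) (ltac:(lra)).
have i : intgr leb1 (fun t => bump1 del (t - u)).
  apply: (intgr_dom (intgrZ del i1)).
    by apply: continuous_measurable_fun; exact: bump1_continuous.
  move=> t; rewrite ger0_norm ?bump1_ge0// indicE mem_setE h.
  have [_|tu] := lerP `|t - u| del; first by rewrite mulr1 bump1_le// ltW.
  by rewrite mulr0 bump1_out// ltW.
split=> //.
have [i2 E2] := @indic_itv_int (u - del / 2) (u + del / 2) (ltac:(lra)).
apply: (@lt_le_trans _ _ (del / 2 * \int[leb1]_t (\1_`[u - del / 2, u + del / 2] t))).
  by rewrite E2 mulr_gt0//; lra.
rewrite -RintegralZl//; apply: intgr_le => //; first exact: intgrZ.
move=> t; rewrite indicE mem_setE h; have [tu|_] := lerP `|t - u| (del / 2).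
  by rewrite mulr1 le_max; apply/orP; right; lra.
by rewrite mulr0 bump1_ge0.
Qed.

Definition bump (del : R) (x0 y : tup) : R := \prod_i bump1 del (tnth y i - tnth x0 i).

Lemma bump_ge0 del x0 y : 0 <= bump del x0 y.
Proof. by apply: prodr_ge0 => i _; exact: bump1_ge0. Qed.

Lemma bump_le del x0 y : 0 <= del -> bump del x0 y <= del ^+ d.
Proof.
move=> del0; rewrite -[X in (_ ^+ X)](card_ord d) -prodr_const.
by apply: ler_prod => i _; rewrite bump1_ge0 bump1_le.
Qed.

Lemma bump_out del x0 y i : del <= `|tnth y i - tnth x0 i| -> bump del x0 y = 0.
Proof. by move=> h; rewrite /bump (bigD1 i)//= bump1_out// mul0r. Qed.

Lemma bump_int del x0 : 0 < del ->
  intgr leb (bump del x0) /\ 0 < \int[leb]_y bump del x0 y.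
Proof.
move=> del0; have [i E] := prod_tuple_integral (fun i => (bump1_int (tnth x0 i) del0).1).
split; first exact: i.
by rewrite /bump E; apply: prodr_gt0 => k _; exact: (bump1_int _ del0).2.
Qed.

Lemma bump_scont del x0 x : scont (bump del x0) x.
Proof.
apply: scont_prod => i _.
apply: (@scont_comp _ _ (fun t => bump1 del (t - tnth x0 i)) (fun y => tnth y i)).
  exact: bump1_continuous.
exact: scont_tnth.
Qed.

Lemma cau_contr (e : R) : 0 < e -> contr_kernel leb (@cau R d e).
Proof.
move=> e0; split; first exact: measurable_cau.
  move=> x; have [ci cE] := cau_mass x e0; split => //.
  rewrite -[leRHS]cE le_eqVlt; apply/orP; left; apply/eqP.
  by apply: eq_Rintegral => y _; rewrite ger0_norm// cau_ge0.
move=> y; have [ci cE] := cau_mass y e0.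
have -> : (cau e)^~ y = cau e y by apply/funext => x; rewrite cauC.
split => //; rewrite -[leRHS]cE le_eqVlt; apply/orP; left; apply/eqP.
by apply: eq_Rintegral => x _; rewrite cauC ger0_norm// cau_ge0.
Qed.

Lemma lapE (e : R) (w : tup) : lap e w = expR (- (e * \sum_i `|tnth w i|)).
Proof.
rewrite mulr_sumr -sumrN /lap; elim/big_ind2 : _ => //; first by rewrite expR0.
by move=> a b a' b' -> ->; rewrite expRD.
Qed.

Lemma lap_cvg1 (w : tup) : lap (k.+1%:R^-1) w @[k --> \oo] --> (1 : R).
Proof.
pose S := \sum_i `|tnth w i|.
have -> : (fun k => lap (k.+1%:R^-1) w) = (fun k => expR (- (k.+1%:R^-1 * S))).
  by apply/funext => k; rewrite lapE.
have h : - (k.+1%:R^-1 * S) @[k --> \oo] --> (- (0 * S) : R).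
  by apply: cvgN; apply: cvgM; [exact: cvg_harmonic|exact: cvg_cst].
have := cvg_comp _ _ h (@continuous_expR R _).
by rewrite mul0r oppr0 expR0.
Qed.

Section inverse_fourier_facts.
Variables (F1 F2 : tup -> R).
Hypotheses (F1i : intgr leb F1) (F2i : intgr leb F2).

Let bd w := `|F1 w| + `|F2 w|.
Let bdi : intgr leb bd. Proof. by apply: intgrD; exact: intgr_norm. Qed.

Let trig_bound w y : `|F1 w * cos (dotp w y) - F2 w * sin (dotp w y)| <= bd w.
Proof.
rewrite (le_trans (ler_normB _ _))// !normrM lerD//.
  by rewrite ler_piMr// cos_max.
by rewrite ler_piMr// sin_max.
Qed.

Let trig_meas y : measurable_fun setT (fun w => F1 w * cos (dotp w y) - F2 w * sin (dotp w y)).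
Proof.
apply: measurable_funB; apply: measurable_funM; try exact: (intgr_meas F1i); try exact: (intgr_meas F2i).
  by apply: (measurableT_comp (@measurable_cos R)); exact: measurable_dotp.
by apply: (measurableT_comp (@measurable_sin R)); exact: measurable_dotp.
Qed.

Lemma inverse_fourier_scont x : scont (inverse_fourier F1 F2 (fun=> 1)) x.
Proof.
apply: scontM; first exact: scont_cst.
apply: (@scont_int _ _ _ _ leb (fun w y => (F1 w * cos (dotp w y) - F2 w * sin (dotp w y)) * 1) bd) => //.
- by move=> y; apply: measurable_funM.
- by move=> w y; rewrite mulr1.
move=> w; apply: scontM; last exact: scont_cst.
apply: scontD; last apply: scontN; apply: scontM; try exact: scont_cst.
  by apply: scont_cos; exact: scont_dotp.
by apply: scont_sin; exact: scont_dotp.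
Qed.

Variable damp : tup -> R.
Hypotheses (mdamp : measurable_fun setT damp) (damp1 : forall w, `|damp w| <= 1).

Lemma inverse_fourier_bound y : `|inverse_fourier F1 F2 damp y| <= cfour R d * \int[leb]_w bd w.
Proof.
rewrite normrM gtr0_norm ?cfour_gt0// ler_wpM2l ?(ltW (cfour_gt0 _ _))//.
apply: le_norm_Rint => //; first exact: measurable_funM.
by move=> w; rewrite normrM (le_trans _ (trig_bound w y))// ler_piMr.
Qed.

Lemma inverse_fourier_meas : measurable_fun setT (inverse_fourier F1 F2 damp).
Proof.
apply: measurable_funM => //.
apply: (@measurable_Rint _ _ _ _ R leb (fun y w => (F1 w * cos (dotp w y) - F2 w * sin (dotp w y)) * damp w)).
  have ms (f : tup -> R) : measurable_fun setT f -> measurable_fun setT (fun z : tup * tup => f z.2).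
    by move=> mf; exact: (measurableT_comp mf measurable_snd).
  apply: measurable_funM; last exact: ms.
  apply: measurable_funB; apply: measurable_funM; try (by apply: ms; exact: (intgr_meas F1i)); try (by apply: ms; exact: (intgr_meas F2i)).
    by apply: (measurableT_comp (@measurable_cos R)); apply: measurable_dotp2.
  by apply: (measurableT_comp (@measurable_sin R)); apply: measurable_dotp2.
move=> y; apply: (intgr_dom bdi); first exact: measurable_funM.
by move=> w; rewrite normrM (le_trans _ (trig_bound w y))// ler_piMr.
Qed.

End inverse_fourier_facts.

Lemma inverse_fourier_cvg (F1 F2 : tup -> R) y : intgr leb F1 -> intgr leb F2 ->
  inverse_fourier F1 F2 (lap (k.+1%:R^-1)) y @[k --> \oo] --> inverse_fourier F1 F2 (fun=> 1) y.
Proof.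
move=> F1i F2i; apply: cvgM; first exact: cvg_cst.
have mt : measurable_fun setT (fun w => F1 w * cos (dotp w y) - F2 w * sin (dotp w y)).
  apply: measurable_funB; apply: measurable_funM; try exact: (intgr_meas F1i); try exact: (intgr_meas F2i).
    by apply: (measurableT_comp (@measurable_cos R)); exact: measurable_dotp.
  by apply: (measurableT_comp (@measurable_sin R)); exact: measurable_dotp.
have [] // := @Rdominated _ _ _ leb
  (fun k w => (F1 w * cos (dotp w y) - F2 w * sin (dotp w y)) * lap (k.+1%:R^-1) w)
  (fun w => (F1 w * cos (dotp w y) - F2 w * sin (dotp w y)) * 1)
  (fun w => `|F1 w| + `|F2 w|).
- by move=> k; apply: measurable_funM => //; exact: lap_measurable.
- by move=> w; apply: cvgM; [exact: cvg_cst|exact: lap_cvg1].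
- by apply: intgrD; exact: intgr_norm.
- move=> k w; rewrite normrM (ger0_norm (lap_ge0 _ _)).
  apply: (@le_trans _ _ `|F1 w * cos (dotp w y) - F2 w * sin (dotp w y)|).
    by rewrite ler_piMr// lap_le1.
  rewrite (le_trans (ler_normB _ _))// !normrM lerD// ler_piMr//.
    exact: cos_max.
  exact: sin_max.
Qed.

(** The L^2 transform determines [g] only almost everywhere, so that it is
    tested against the bump.  As the damping tends to 1, the left-hand side
    converges by domination; by [fourierL2_damped] and the symmetry of the
    Cauchy kernel, it is also the integral of [g] against the averaged bump,
    which converges to the bump in L^2. *)
Lemma bump_test (g : tup -> R) (F : tup -> R[i]) (x0 : tup) (del : R) : 0 < del ->
  fourierL2 g F ->
  intgr leb (fun w => complex.Re (F w)) -> intgr leb (fun w => complex.Im (F w)) ->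
  intgr leb (fun y => g y * bump del x0 y) /\
  \int[leb]_y (bump del x0 y * inverse_fourier (fun w => complex.Re (F w)) (fun w => complex.Im (F w)) (fun=> 1) y)
  = \int[leb]_y (g y * bump del x0 y).
Proof.
move=> del0 gF iFr iFi.
have /Lfun2P[mg gi] : g \in Lfun leb 2%:E by case: gF.
have [bi _] := bump_int x0 del0.
have mb := intgr_meas bi.
have bM y : `|bump del x0 y| <= del ^+ d.
  by rewrite ger0_norm ?bump_ge0// bump_le// ltW.
have b2 : intgr leb (fun y => bump del x0 y ^+ 2) by exact: (sqr_intgr bi bM).
have gb : intgr leb (fun y => g y * bump del x0 y) by exact: intgrM2.
split=> //.
set Fr := (fun w => complex.Re (F w)) in iFr *; set Fi := (fun w => complex.Im (F w)) in iFi *.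
pose e k : R := k.+1%:R^-1.
have e0 k : 0 < e k by rewrite invr_gt0.
have lm k := @lap_measurable R d _ (e0 k).
have l1 k (w : tup) : `|lap (e k) w| <= 1 by rewrite ger0_norm ?lap_ge0// lap_le1// ltW.
have LL : \int[leb]_y (bump del x0 y * inverse_fourier Fr Fi (lap (e k)) y) @[k --> \oo] -->
    \int[leb]_y (bump del x0 y * inverse_fourier Fr Fi (fun=> 1) y).
  have [] // := @Rdominated _ _ _ leb (fun k y => bump del x0 y * inverse_fourier Fr Fi (lap (e k)) y)
     (fun y => bump del x0 y * inverse_fourier Fr Fi (fun=> 1) y)
     (fun y => (cfour R d * \int[leb]_w (`|Fr w| + `|Fi w|)) * bump del x0 y).
  - by move=> k; apply: measurable_funM => //; exact: inverse_fourier_meas.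
  - by move=> y; apply: cvgM; [exact: cvg_cst|exact: inverse_fourier_cvg].
  - exact: intgrZ.
  - move=> k y; rewrite normrM mulrC (ger0_norm (bump_ge0 _ _ _)) ler_wpM2r ?bump_ge0//.
    exact: inverse_fourier_bound.
have sc k : contr_kernel leb (@cau R d (e k)) by exact: cau_contr.
have [di d0] := smooth_cvg_L2 sc bi bM (fun x => cau_cvg mb bM (scont_cont_at (@bump_scont del x0 x))).
have EE k : \int[leb]_y (bump del x0 y * inverse_fourier Fr Fi (lap (e k)) y) =
    \int[leb]_x (smooth leb (cau (e k)) (bump del x0) x * g x).
  transitivity (\int[leb]_y \int[leb]_x (bump del x0 y * (g x * cau (e k) y x))).
    apply: eq_Rintegral => y _; rewrite (fourierL2_damped y gF (e0 k) iFr iFi).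
    rewrite RintegralZl//; apply: intgrM2 => //; last exact: cau_sqr_intgr.
    exact: intgr_meas (cau_mass y (e0 k)).1.
  have mk := (@measurable_cau R d _ (e0 k)).
  have gci y : intgr leb (fun x => g x * cau (e k) y x).
    apply: intgrM2 => //; last exact: cau_sqr_intgr.
    exact: intgr_meas (cau_mass y (e0 k)).1.
  rewrite Rfubini; last first.
    apply: (@pintgr_bound1 _ _ _ _ R leb leb _ (fun y => (((e k)^-1 / pi) ^+ d * \int[leb]_x (g x ^+ 2) + 1) * bump del x0 y)).
    - apply: measurable_funM; first exact: (measurableT_comp mb measurable_fst).
      apply: measurable_funM => //; exact: (measurableT_comp mg measurable_snd).
    - by move=> y; apply: intgrZ.
    - exact: intgrZ.
    - move=> y; under eq_Rintegral do rewrite normrM (ger0_norm (bump_ge0 _ _ _)).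
      rewrite RintegralZl//; last exact: intgr_norm.
      rewrite mulrC ler_wpM2r ?bump_ge0//.
      have [ci cE] := cau_mass y (e0 k).
      rewrite -cE -RintegralZl// -RintegralD//; last exact: intgrZ.
      apply: intgr_le; [exact: intgr_norm|by apply: intgrD => //; exact: intgrZ|].
      move=> x; rewrite normrM (ger0_norm (cau_ge0 _ _ (e0 k))).
      have c1 := cau_le x y (e0 k); have c2 := cau_ge0 y x (e0 k).
      apply: (@le_trans _ _ ((g x ^+ 2 + 1) * cau (e k) y x)).
        rewrite ler_wpM2r// -(real_normK (num_real (g x))).
        have : 0 <= `|g x| by [].
        nra.
      by rewrite mulrDl mul1r lerD2r mulrC ler_wpM2r// sqr_ge0.
  apply: eq_Rintegral => x _; rewrite /smooth mulrC -RintegralZl//; last exact: kf_intgr.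
  by apply: eq_Rintegral => y _; rewrite [cau _ x y]cauC; ring.
have LR : \int[leb]_x (smooth leb (cau (e k)) (bump del x0) x * g x) @[k --> \oo] --> \int[leb]_x (bump del x0 x * g x).
  have ms k := intgr_meas (smooth_intgr (sc k) bi).
  apply: pair_cvg => //.
  - move=> k; apply: intgrM2 => //.
    exact: (sqr_intgr (smooth_intgr (sc k) bi) (smooth_le (sc k) bi bM)).
  - exact: intgrM2.
  - exact: nearW.
rewrite -[LHS](cvg_lim (@Rhausdorff R) LL); under eq_fun do rewrite EE.
by rewrite (cvg_lim (@Rhausdorff R) LR); apply: eq_Rintegral => y _; rewrite mulrC.
Qed.

(** Both sides are continuous.  If they differed at [x0], their difference
    would keep its sign on a neighbourhood, which contradicts [bump_test] for a
    bump supported there. *)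
Theorem fourier_inversion (g : tup -> R) (F : tup -> R[i]) : Rd_continuous g ->
  fourierL2 g F ->
  intgr leb (fun w => complex.Re (F w)) -> intgr leb (fun w => complex.Im (F w)) ->
  forall x, g x = inverse_fourier (fun w => complex.Re (F w)) (fun w => complex.Im (F w)) (fun=> 1) x.
Proof.
move=> cg gF iFr iFi x0; set H := inverse_fourier _ _ _.
apply/eqP; rewrite -subr_eq0; apply/negP => /negP r0.
pose r := `|g x0 - H x0|; have rp : 0 < r by rewrite normr_gt0.
have [del1 del10 h1] := Rd_continuous_at x0 cg (divr_gt0 rp (ltr0n _ 4)).
have [del2 del20 h2] := scont_cont_at (@inverse_fourier_scont _ _ iFr iFi x0) (divr_gt0 rp (ltr0n _ 4)).
pose del := Num.min del1 del2.
have del0 : 0 < del by rewrite lt_min del10.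
have [gb E] := bump_test x0 del0 gF iFr iFi.
have [bi b0] := bump_int x0 del0.
have Hi : intgr leb (fun y => bump del x0 y * H y).
  apply: (intgrM bi); first by apply: (inverse_fourier_meas iFr iFi) => // w; rewrite normr1.
  by move=> y; apply: (inverse_fourier_bound iFr iFi) => // w; rewrite normr1.
pose s : R := Num.sg (g x0 - H x0).
have sE : s * (g x0 - H x0) = r by rewrite /s /r normrEsg.
have s1 : `|s| <= 1 by rewrite normr_sg; case: (_ != 0).
have : r / 2 * \int[leb]_y bump del x0 y <= s * (\int[leb]_y (g y * bump del x0 y) - \int[leb]_y (bump del x0 y * H y)).
  rewrite -RintegralB// -!RintegralZl//; last exact: intgrB.
  apply: intgr_le; [exact: intgrZ|by apply: intgrZ; exact: intgrB|].
  move=> y; rewrite (mulrC (bump _ _ _)) -mulrBl mulrA.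
  have [/forallP yx|yx] := boolP [forall i, `|tnth y i - tnth x0 i| <= del].
    rewrite ler_wpM2r ?bump_ge0//.
    have g1 : `|g y - g x0| <= r / 4.
      by apply: h1 => i; rewrite (le_trans (yx i))// ge_min lexx.
    have g2 : `|H y - H x0| <= r / 4.
      by apply: h2 => i; rewrite (le_trans (yx i))// ge_min lexx orbT.
    have -> : s * (g y - H y) = r + (s * (g y - g x0) - s * (H y - H x0)) by rewrite -sE; ring.
    have : `|s * (g y - g x0) - s * (H y - H x0)| <= r / 4 + r / 4.
      rewrite (le_trans (ler_normB _ _))// !normrM lerD//.
        by rewrite (le_trans _ g1)// ler_piMl.
      by rewrite (le_trans _ g2)// ler_piMl.
    rewrite ler_norml => /andP[+ _]; lra.
  have [ i ] := forallPn yx; rewrite -ltNge => yi.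
  by rewrite (bump_out (ltW yi)) !mulr0.
rewrite -E subrr mulr0 leNgt => /negP; apply.
by rewrite mulr_gt0// divr_gt0.
Qed.

End inversion.

(** * Functions with prescribed Fourier transform *)

Section synthesis.
Variables (R : realType) (d : nat).
Local Notation leb := (lebesgue_tuple R d).
Local Notation tup := (d.-tuple R).
Local Notation c := (cfour R d).

Definition negt (w : tup) : tup := [tuple - tnth w i | i < d].

Lemma dotp_negt w x : dotp (negt w) x = - dotp w x.
Proof. by rewrite /dotp -sumrN; apply: eq_bigr => i _; rewrite tnth_mktuple mulNr. Qed.

Lemma cau_negt e w y : cau e (negt w) y = cau e (negt y) w :> R.
Proof.
apply: eq_bigr => i _; rewrite !tnth_mktuple /cau1; congr (_ / (_ + _) / _); ring.
Qed.

(** The kernel [cau] symmetrised (s = 1) or antisymmetrised (s = -1) under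
    w |-> - w: up to the factor (2 pi)^d, the damped products of two cosines,
    or of two sines, integrate to it. *)
Definition ksym (s e : R) (w y : tup) : R := 2^-1 * (cau e w y + s * cau e (negt w) y).

Lemma measurable_negt : measurable_fun setT negt.
Proof.
apply: measurable_tuple => i.
rewrite (_ : (fun x => _) = (fun x => - tnth x i)); last first.
  by apply/funext => x; rewrite tnth_mktuple.
apply: measurableT_comp => //; exact: measurable_tnth.
Qed.

Lemma ksym_contr s e : `|s| <= 1 -> 0 < e -> contr_kernel leb (ksym s e).
Proof.
move=> s1 e0.
have mk : pmeas (@cau R d e) by exact: measurable_cau.
have bnd (a b : tup -> R) : (forall y, 0 <= a y) -> (forall y, 0 <= b y) ->
    intgr leb a -> intgr leb b -> \int[leb]_y a y = 1 -> \int[leb]_y b y = 1 ->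
    intgr leb (fun y => 2^-1 * (a y + s * b y)) /\
    \int[leb]_y `|2^-1 * (a y + s * b y)| <= 1.
  move=> a0 b0 ai bi aE bE.
  have i : intgr leb (fun y => 2^-1 * (a y + s * b y)).
    by apply: intgrZ; apply: intgrD => //; exact: intgrZ.
  split => //.
  have E : \int[leb]_y (2^-1 * (a y + b y)) = 1.
    rewrite RintegralZl//; last exact: intgrD.
    by rewrite RintegralD// aE bE; field.
  rewrite -[leRHS]E.
  apply: intgr_le; [exact: (intgr_norm i)|by apply: intgrZ; exact: intgrD|].
  move=> y; rewrite normrM ger0_norm// ler_wpM2l//.
  rewrite (le_trans (ler_normD _ _))// (ger0_norm (a0 y)) lerD2l.
  by rewrite normrM (ger0_norm (b0 y)) ler_piMl.
split.
- apply: measurable_funM => //; apply: measurable_funD; first exact: mk.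
  apply: measurable_funM => //.
  apply: (measurableT_comp mk (g := fun z : tup * tup => (negt z.1, z.2))).
  apply: measurable_fun_pair => //.
  exact: (measurableT_comp measurable_negt measurable_fst).
- move=> w; have [i1 E1] := cau_mass w e0; have [i2 E2] := cau_mass (negt w) e0.
  by apply: (bnd (cau e w) (cau e (negt w))) => // y; exact: cau_ge0.
- move=> y; have [i1 E1] := cau_mass y e0; have [i2 E2] := cau_mass (negt y) e0.
  have kE w : ksym s e w y = 2^-1 * (cau e y w + s * cau e (negt y) w).
    by rewrite /ksym cauC cau_negt.
  under [X in _ /\ X <= _]eq_Rintegral do rewrite kE.
  have -> : (ksym s e)^~ y = (fun w => 2^-1 * (cau e y w + s * cau e (negt y) w)).
    by apply/funext => w; rewrite kE.
  by apply: (bnd (cau e y) (cau e (negt y))) => // w; exact: cau_ge0.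
Qed.

Lemma ksym_cvg (s M : R) (p : tup -> R) : `|s| <= 1 -> intgr leb p ->
  (forall w, `|p w| <= M) -> (forall w, scont p w) -> (forall w, p (negt w) = s * p w) -> s * s = 1 ->
  forall w, smooth leb (ksym s (k.+1%:R^-1)) p w @[k --> \oo] --> p w.
Proof.
move=> s1 pi pM ps pn ss w; have mp := intgr_meas pi.
have h1 := cau_cvg mp pM (scont_cont_at (ps w)).
have h2 := cau_cvg mp pM (scont_cont_at (ps (negt w))).
have e0 k : 0 < k.+1%:R^-1 :> R by rewrite invr_gt0.
have i1 k x : intgr leb (fun y => p y * cau (k.+1%:R^-1) x y).
  exact: (kf_intgr (cau_contr d (e0 k)) pi pM).
have -> : (fun k => smooth leb (ksym s (k.+1%:R^-1)) p w) =
    (fun k => 2^-1 * (\int[leb]_y (p y * cau (k.+1%:R^-1) w y) +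
       s * \int[leb]_y (p y * cau (k.+1%:R^-1) (negt w) y))).
  apply/funext => k; rewrite -RintegralZl; [|by []|exact: i1].
  rewrite -RintegralD; [|by []|exact: i1|exact/intgrZ/i1].
  rewrite -RintegralZl; [|by []|by apply: intgrD; [exact: i1|exact/intgrZ/i1]].
  by apply: eq_Rintegral => y _; rewrite /ksym; ring.
have -> : p w = 2^-1 * (p w + s * p (negt w)) by rewrite pn mulrA ss; field.
apply: cvgM; first exact: cvg_cst.
by apply: cvgD => //; apply: cvgM => //; exact: cvg_cst.
Qed.

Section synth.
Variables (p r : tup -> R) (M : R).
Hypotheses (pint : intgr leb p) (rint : intgr leb r).
Hypotheses (pM : forall w, `|p w| <= M) (rM : forall w, `|r w| <= M).
Hypotheses (psc : forall w, scont p w) (rsc : forall w, scont r w).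
Hypotheses (peven : forall w, p (negt w) = p w) (rodd : forall w, r (negt w) = - r w).

(** The function with transform (p - i r) / c; it is real-valued because [p] is
    even and [r] is odd. *)
Definition synth (x : tup) : R := \int[leb]_w (p w * cos (dotp w x) + r w * sin (dotp w x)).

Let e k : R := k.+1%:R^-1.
Let e0 k : 0 < e k. Proof. by rewrite invr_gt0. Qed.

Let B := \int[leb]_w (`|p w| + `|r w|).

Let bdi : intgr leb (fun w => `|p w| + `|r w|).
Proof. by apply: intgrD; exact: intgr_norm. Qed.

Let mp := intgr_meas pint.
Let mr := intgr_meas rint.

Let trig_bound w x : `|p w * cos (dotp w x) + r w * sin (dotp w x)| <= `|p w| + `|r w|.
Proof.
rewrite (le_trans (ler_normD _ _))// !normrM lerD//.
  by rewrite ler_piMr// cos_max.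
by rewrite ler_piMr// sin_max.
Qed.

Let mtrig : pmeas (fun x w => p w * cos (dotp w x) + r w * sin (dotp w x)).
Proof.
apply: measurable_funD; apply: measurable_funM.
- exact: (measurableT_comp mp measurable_snd).
- by apply: (measurableT_comp (@measurable_cos R)); apply: measurable_dotp2.
- exact: (measurableT_comp mr measurable_snd).
- by apply: (measurableT_comp (@measurable_sin R)); apply: measurable_dotp2.
Qed.

Let trigi x : intgr leb (fun w => p w * cos (dotp w x) + r w * sin (dotp w x)).
Proof. by apply: (intgr_dom bdi) => //; exact: (pmeas1 x mtrig). Qed.

Lemma synth_bound x : `|synth x| <= B.
Proof. by apply: le_norm_Rint => //; exact: (pmeas1 x mtrig). Qed.

Lemma synth_meas : measurable_fun setT synth.
Proof. exact: (@measurable_Rint _ _ _ _ R leb _ mtrig trigi). Qed.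

Lemma synth_continuous : Rd_continuous synth.
Proof.
apply: cont_at_Rd => x; apply: scont_cont_at.
apply: (@scont_int _ _ _ _ leb (fun w y => p w * cos (dotp w y) + r w * sin (dotp w y)) (fun w => `|p w| + `|r w|)) => //.
  by move=> y; exact: (pmeas1 y mtrig).
move=> w; apply: scontD; apply: scontM; try exact: scont_cst.
  by apply: scont_cos; exact: scont_dotp.
by apply: scont_sin; exact: scont_dotp.
Qed.

Let u k (x : tup) := synth x * lap (e k) x.

Let mlap k := @lap_measurable R d _ (e0 k).

Let ui k : intgr leb (u k).
Proof.
have := intgrM (lap_intgr d (e0 k)) synth_meas synth_bound.
by rewrite /intgr; apply: eq_integrable => // x _; rewrite /= mulrC.
Qed.

(** Product-to-sum formulas reduce these integrals to the Fourier transform of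
    the Laplace kernel at the difference and at the sum of the frequencies. *)
Let waves k (w v : tup) :
  [/\ \int[leb]_x (lap (e k) x * (cos (dotp w x) * cos (dotp v x))) = (2 * pi) ^+ d * ksym 1 (e k) v w,
      \int[leb]_x (lap (e k) x * (sin (dotp w x) * cos (dotp v x))) = 0,
      \int[leb]_x (lap (e k) x * (cos (dotp w x) * sin (dotp v x))) = 0 &
      \int[leb]_x (lap (e k) x * (sin (dotp w x) * sin (dotp v x))) = (2 * pi) ^+ d * ksym (-1) (e k) v w].
Proof.
pose dm : tup := [tuple tnth w i - tnth v i | i < d].
pose dp : tup := [tuple tnth w i - tnth (negt v) i | i < d].
have dmE x : dotp x dm = dotp w x - dotp v x.
  by rewrite /dotp -sumrB; apply: eq_bigr => i _; rewrite tnth_mktuple; ring.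
have dpE x : dotp x dp = dotp w x + dotp v x.
  by rewrite /dotp -big_split/=; apply: eq_bigr => i _; rewrite !tnth_mktuple; ring.
have C1 := lap_cau v w (e0 k); have C2 := lap_cau (negt v) w (e0 k).
have S1 := (lap_fourier dm (e0 k)).2; have S2 := (lap_fourier dp (e0 k)).2.
rewrite -/dm in C1; rewrite -/dp in C2.
have ic y : intgr leb (fun x => lap (e k) x * cos (dotp x y)).
  apply: (intgrM (lap_intgr _ (e0 k)) _ (fun w => @cos_max R _)).
  by apply: (measurableT_comp (@measurable_cos R)); exact: measurable_dotp.
have is_ y : intgr leb (fun x => lap (e k) x * sin (dotp x y)).
  apply: (intgrM (lap_intgr _ (e0 k)) _ (fun w => @sin_max R _)).
  by apply: (measurableT_comp (@measurable_sin R)); exact: measurable_dotp.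
have comb (a b : tup -> R) s : intgr leb a -> intgr leb b ->
    \int[leb]_x (2^-1 * (a x + s * b x)) = 2^-1 * (\int[leb]_x a x + s * \int[leb]_x b x).
  move=> ai bi; rewrite RintegralZl//; last by apply: intgrD => //; exact: intgrZ.
  by rewrite RintegralD ?RintegralZl//; exact: intgrZ.
split.
- transitivity (\int[leb]_x (2^-1 * (lap (e k) x * cos (dotp x dm) + 1 * (lap (e k) x * cos (dotp x dp))))).
    by apply: eq_Rintegral => x _; rewrite dmE dpE cosB cosD; field.
  by rewrite comb// C1 C2 /ksym; ring.
- transitivity (\int[leb]_x (2^-1 * (lap (e k) x * sin (dotp x dm) + 1 * (lap (e k) x * sin (dotp x dp))))).
    by apply: eq_Rintegral => x _; rewrite dmE dpE sinB sinD; field.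
  by rewrite comb// S1 S2 mulr0 addr0 mulr0.
- transitivity (\int[leb]_x (2^-1 * (lap (e k) x * sin (dotp x dp) + (-1) * (lap (e k) x * sin (dotp x dm))))).
    by apply: eq_Rintegral => x _; rewrite dmE dpE sinB sinD; field.
  by rewrite comb// S1 S2 mulr0 addr0 mulr0.
- transitivity (\int[leb]_x (2^-1 * (lap (e k) x * cos (dotp x dm) + (-1) * (lap (e k) x * cos (dotp x dp))))).
    by apply: eq_Rintegral => x _; rewrite dmE dpE cosB cosD; field.
  by rewrite comb// C1 C2 /ksym; ring.
Qed.

Let Kc k := ksym_contr (s := 1) (ltac:(by rewrite normr1)) (e0 k).
Let Ks k := ksym_contr (s := -1) (ltac:(by rewrite normrN1)) (e0 k).

Let transform k (tr : R -> R) (v : tup) : measurable_fun setT tr -> (forall t, `|tr t| <= 1) ->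
  \int[leb]_x (u k x * tr (dotp v x)) =
  \int[leb]_w (p w * \int[leb]_x (lap (e k) x * (cos (dotp w x) * tr (dotp v x))) +
               r w * \int[leb]_x (lap (e k) x * (sin (dotp w x) * tr (dotp v x)))).
Proof.
move=> mtr tr1.
have mtv : measurable_fun setT (fun x : tup => tr (dotp v x)).
  by apply: (measurableT_comp mtr); apply: measurable_dotp2.
transitivity (\int[leb]_x \int[leb]_w ((lap (e k) x * tr (dotp v x)) * (p w * cos (dotp w x) + r w * sin (dotp w x)))).
  by apply: eq_Rintegral => x _; rewrite RintegralZl; [rewrite -/(synth x) /u; ring|by []|exact: trigi].
rewrite Rfubini; last first.
  apply: (@pintgr_prod _ _ _ _ R leb leb _ (fun x => lap (e k) x) (fun w => `|p w| + `|r w|)) => //.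
  - apply: measurable_funM => //.
    apply: measurable_funM; first exact: (measurableT_comp (mlap k) measurable_fst).
    exact: (measurableT_comp mtv measurable_fst).
  - exact: lap_intgr.
  - move=> x w; rewrite normrM ler_pM// normrM (ger0_norm (lap_ge0 _ _)).
    by rewrite ler_piMr// lap_ge0.
have ic w : intgr leb (fun x => lap (e k) x * (cos (dotp w x) * tr (dotp v x))).
  apply: (@intgrM _ _ _ _ 1); first exact: lap_intgr.
    apply: measurable_funM => //; apply: (measurableT_comp (@measurable_cos R)).
    exact: measurable_dotp2.
  by move=> x; rewrite normrM mulr_ile1// cos_max.
have is_ w : intgr leb (fun x => lap (e k) x * (sin (dotp w x) * tr (dotp v x))).
  apply: (@intgrM _ _ _ _ 1); first exact: lap_intgr.
    apply: measurable_funM => //; apply: (measurableT_comp (@measurable_sin R)).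
    exact: measurable_dotp2.
  by move=> x; rewrite normrM mulr_ile1// sin_max.
apply: eq_Rintegral => w _.
rewrite -(RintegralZl (p w) measurableT (ic w)) -(RintegralZl (r w) measurableT (is_ w)).
rewrite -RintegralD; [|by []|exact: intgrZ|exact: intgrZ].
by apply: eq_Rintegral => x _; ring.
Qed.

Let cosT k v : \int[leb]_x (u k x * cos (dotp v x)) = (2 * pi) ^+ d * smooth leb (ksym 1 (e k)) p v.
Proof.
rewrite transform//; [|exact: measurable_cos|exact: cos_max].
rewrite /smooth -RintegralZl//; last exact: (kf_intgr (Kc k) pint pM).
apply: eq_Rintegral => w _; have [-> -> _ _] := waves k w v; ring.
Qed.

Let sinT k v : \int[leb]_x (u k x * sin (dotp v x)) = (2 * pi) ^+ d * smooth leb (ksym (-1) (e k)) r v.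
Proof.
rewrite transform//; [|exact: measurable_sin|exact: sin_max].
rewrite /smooth -RintegralZl//; last exact: (kf_intgr (Ks k) rint rM).
apply: eq_Rintegral => w _; have [_ _ -> ->] := waves k w v; ring.
Qed.

Let p2 : intgr leb (fun w => p w ^+ 2). Proof. exact: (sqr_intgr pint pM). Qed.
Let r2 : intgr leb (fun w => r w ^+ 2). Proof. exact: (sqr_intgr rint rM). Qed.

Let C := (2 * pi) ^+ d * (\int[leb]_w (p w ^+ 2) + \int[leb]_w (r w ^+ 2)).

Let half_bound (K : tup -> tup -> R) (f : tup -> R) : contr_kernel leb K -> intgr leb f ->
  (forall w, `|f w| <= M) ->
  intgr leb (fun w => f w * smooth leb K f w) /\
  \int[leb]_w (f w * smooth leb K f w) <= \int[leb]_w (f w ^+ 2).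
Proof.
move=> Kk fi fM.
have si := smooth_intgr Kk fi; have sM := smooth_le Kk fi fM.
have f2 := sqr_intgr fi fM; have s2 := sqr_intgr si sM.
have fsi : intgr leb (fun w => f w * smooth leb K f w).
  by apply: intgrM2 => //; [exact: (intgr_meas fi)|exact: (intgr_meas si)].
split=> //.
have := smooth_L2 Kk fi fM.
have : \int[leb]_w (f w * smooth leb K f w) <= \int[leb]_w (2^-1 * (f w ^+ 2 + smooth leb K f w ^+ 2)).
  apply: intgr_le => //; first by apply: intgrZ; exact: intgrD.
  move=> w; set a := f w; set b := smooth _ _ _ _.
  have : 0 <= (a - b) ^+ 2 by exact: sqr_ge0.
  lra.
rewrite RintegralZl//; last exact: intgrD.
rewrite RintegralD//; lra.
Qed.

(** Expanding one factor [synth] turns the damped square integral into a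
    multiple of <p, S p> + <r, S r>, for averaging operators S; these are
    contractions, so the bound is uniform in the damping. *)
Let synth_damped k : intgr leb (fun x => synth x ^+ 2 * lap (e k) x) /\
  \int[leb]_x (synth x ^+ 2 * lap (e k) x) <= C.
Proof.
have i : intgr leb (fun x => synth x ^+ 2 * lap (e k) x).
  have := intgrM (ui k) synth_meas synth_bound.
  by rewrite /intgr; apply: eq_integrable => // x _; rewrite /= /u; congr (_%:E); ring.
split=> //.
have -> : \int[leb]_x (synth x ^+ 2 * lap (e k) x) =
    \int[leb]_x \int[leb]_w (u k x * (p w * cos (dotp w x) + r w * sin (dotp w x))).
  by apply: eq_Rintegral => x _; rewrite RintegralZl; [rewrite -/(synth x) /u; ring|by []|exact: trigi].
rewrite Rfubini; last first.
  apply: (@pintgr_prod _ _ _ _ R leb leb _ (fun x => `|u k x|) (fun w => `|p w| + `|r w|)) => //.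
  - apply: measurable_funM => //.
    exact: (measurableT_comp (intgr_meas (ui k)) measurable_fst).
  - exact: intgr_norm.
  - by move=> x w; rewrite normrM ler_wpM2l.
have [i1 b1] := half_bound (Kc k) pint pM.
have [i2 b2] := half_bound (Ks k) rint rM.
have -> : \int[leb]_y \int[leb]_x (u k x * (p y * cos (dotp y x) + r y * sin (dotp y x))) =
   \int[leb]_y ((2 * pi) ^+ d * (p y * smooth leb (ksym 1 (e k)) p y + r y * smooth leb (ksym (-1) (e k)) r y)).
  apply: eq_Rintegral => y _.
  have ic := intgr_trig y (@measurable_cos R) (@cos_max R) (ui k).
  have is_ := intgr_trig y (@measurable_sin R) (@sin_max R) (ui k).
  transitivity (\int[leb]_x (p y * (u k x * cos (dotp y x)) + r y * (u k x * sin (dotp y x)))).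
    by apply: eq_Rintegral => x _; ring.
  rewrite RintegralD; [|by []|exact: intgrZ|exact: intgrZ].
  rewrite !RintegralZl; [|by []|exact: is_|by []|exact: ic].
  rewrite cosT sinT; ring.
rewrite RintegralZl//; last exact: intgrD.
rewrite RintegralD// /C ler_wpM2l//; last exact: lerD.
by rewrite exprn_ge0// mulr_ge0// pi_ge0.
Qed.

(** Fatou's lemma, removing the damping in [synth_damped]. *)
Lemma synth_L2 : intgr leb (fun x => synth x ^+ 2).
Proof.
have ms : measurable_fun setT (fun x => synth x ^+ 2) by apply: measurable_funX; exact: synth_meas.
apply: (@ge0_intgr _ _ _ _ _ C%:E) => //; [by move=> x; exact: sqr_ge0| |exact: ltry].
pose g k x : \bar R := (synth x ^+ 2 * lap (e k) x)%:E.
have g0 k x : (0 <= g k x)%E by rewrite lee_fin mulr_ge0 ?sqr_ge0 ?lap_ge0.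
have gf x : limn_einf (g ^~ x) = (synth x ^+ 2)%:E.
  have cg : g k x @[k --> \oo] --> (synth x ^+ 2)%:E.
    apply: cvg_EFin; first exact: nearW.
    have := cvgM (cvg_cst (synth x ^+ 2)) (lap_cvg1 x); rewrite mulr1; exact.
  rewrite is_cvg_limn_einfE; last by apply/cvg_ex; exists (synth x ^+ 2)%:E.
  exact: cvg_lim.
have := @fatou _ _ _ leb setT measurableT g _ (fun k x _ => g0 k x).
under eq_integral do rewrite gf; move=> h.
apply: (le_trans (h _)).
  by move=> k; apply/measurable_EFinP; exact: intgr_meas (synth_damped k).1.
rewrite limn_einf_lim; apply: lime_le; first exact: is_cvg_einfs.
apply: nearW => k; apply: (@le_trans _ _ (\int[leb]_x g k x)%E).
  by apply: ereal_inf_lbound; exists k => /=.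
by rewrite /g -Rint_EFin ?lee_fin; have [] := synth_damped k.
Qed.

(** The approximations are the damped functions [u k]; their transforms are the
    averages of [p] and [r] by the symmetrised Cauchy kernels ([cosT], [sinT]),
    which converge in L^2 by [smooth_cvg_L2]. *)
Lemma synth_fourierL2 : fourierL2 synth (fun w => Complex (p w / c) (- (r w / c))).
Proof.
have c0 := cfour_gt0 R d.
split => /=.
- by apply/Lfun2P; split; [exact: synth_meas|exact: synth_L2].
- by apply: measurable_funM.
- by apply: measurableT_comp => //; exact: measurable_funM.
exists u; split.
- move=> k; split; first by apply/Lfun1_integrable; exact: ui.
  apply/Lfun2P; split; first exact: intgr_meas (ui k).
  apply: (intgr_dom synth_L2); first by apply: measurable_funX; exact: intgr_meas (ui k).
  move=> x; rewrite ger0_norm ?sqr_ge0// exprMn ler_piMr ?sqr_ge0//.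
  by rewrite expr_le1 ?lap_ge0// lap_le1// ltW.
- have dom k x : (u k x - synth x) ^+ 2 <= synth x ^+ 2.
    have -> : (u k x - synth x) ^+ 2 = synth x ^+ 2 * (1 - lap (e k) x) ^+ 2 by rewrite /u; ring.
    rewrite ler_piMr ?sqr_ge0// expr_le1 ?subr_ge0 ?lap_le1 ?(ltW (e0 k))//.
    by rewrite lerBlDr lerDl lap_ge0.
  have md k : measurable_fun setT (fun x => (u k x - synth x) ^+ 2).
    by apply: measurable_funX; apply: measurable_funB; [exact: intgr_meas (ui k)|exact: synth_meas].
  apply: (Lnorm2_cvg0 (h := fun k x => u k x - synth x)).
    by move=> k; apply: (intgr_dom synth_L2) => // x; rewrite ger0_norm ?sqr_ge0.
  have [] := @Rdominated _ _ _ leb (fun k x => (u k x - synth x) ^+ 2) (fun=> 0) (fun x => synth x ^+ 2).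
  + exact: md.
  + move=> x; have h : u k x - synth x @[k --> \oo] --> synth x * 1 - synth x.
      apply: cvgB; last exact: cvg_cst.
      by apply: cvgM; [exact: cvg_cst|exact: lap_cvg1].
    rewrite mulr1 subrr in h.
    have := cvg_comp _ _ h (@exprn_continuous R 2 0).
    by rewrite expr0n.
  + exact: synth_L2.
  + by move=> k x; rewrite ger0_norm ?sqr_ge0.
  + by rewrite Rintegral_cst// mul0r.
- have cp k : contr_kernel leb (ksym 1 (e k)) by exact: Kc.
  have cr k : contr_kernel leb (ksym (-1) (e k)) by exact: Ks.
  have pc : forall w, smooth leb (ksym 1 (e k)) p w @[k --> \oo] --> p w.
    by apply: (ksym_cvg _ pint pM) => //; rewrite ?normr1 ?mulr1// => w; rewrite peven mul1r.
  have rc : forall w, smooth leb (ksym (-1) (e k)) r w @[k --> \oo] --> r w.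
    apply: (ksym_cvg _ rint rM) => //; rewrite ?normrN1 ?mulrNN ?mulr1//.
    by move=> w; rewrite rodd mulN1r.
  have [ip lp] := smooth_cvg_L2 cp pint pM pc.
  have [ir lr] := smooth_cvg_L2 cr rint rM rc.
  have cc : c * (2 * pi) ^+ d = c^-1.
    by rewrite -[LHS](mulKf (lt0r_neq0 c0)) (mulrA c c) cfour_sqr mulr1.
  have nE k w : Normc.normc (fourier (u k) w - Complex (p w / c) (- (r w / c))) ^+ 2 =
      c^-2 * ((smooth leb (ksym 1 (e k)) p w - p w) ^+ 2 + (smooth leb (ksym (-1) (e k)) r w - r w) ^+ 2).
    rewrite /fourier normc_sqrE cosT sinT -/c !mulrA cc.
    by rewrite -exprVn; ring.
  apply: (Lnorm2_cvg0 (h := fun k w => Normc.normc (fourier (u k) w - Complex (p w / c) (- (r w / c))))).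
    by move=> k; under eq_fun do rewrite nE; apply: intgrZ; exact: intgrD.
  have -> : (fun m => \int[leb]_x (Normc.normc (fourier (u m) x - Complex (p x / c) (- (r x / c))) ^+ 2)) =
     (fun k => c^-2 * (\int[leb]_w ((smooth leb (ksym 1 (e k)) p w - p w) ^+ 2) + \int[leb]_w ((smooth leb (ksym (-1) (e k)) r w - r w) ^+ 2))).
    apply/funext => k; rewrite -(RintegralD measurableT (ip k) (ir k)).
    rewrite -(RintegralZl _ measurableT (intgrD (ip k) (ir k))).
    by apply: eq_Rintegral => w _; rewrite nE.
  rewrite -[X in _ --> X](mulr0 (c^-2)); apply: cvgM; first exact: cvg_cst.
  rewrite -[X in _ --> X](addr0 0); exact: cvgD.
Qed.

End synth.

End synthesis.

(** * Functionals applied to plane waves *)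

Section functionals.
Variables (R : realType) (m : nat).
Local Notation tup := (m.-tuple R).
Implicit Types (lambda : (tup -> R) -> R) (Gamma : set tup).

(** Real and imaginary part of the symbol lambda (e^(i w.z)). *)
Definition Lcos lambda (w : tup) : R := lambda (fun z => cos (dotp w z)).
Definition Lsin lambda (w : tup) : R := lambda (fun z => sin (dotp w z)).

(** What Fourier analysis needs to know about a functional: it depends on the
    values on [Gamma] only, its symbol is bounded, continuous and Hermitian,
    and it commutes with integrals of plane waves.  The frequency of the waves
    is a function [v] of the integration variable because it is going to be one
    block of a longer frequency vector. *)
Record tame Gamma lambda : Prop := Tame {
  tame_local : forall f g : tup -> R, (forall z, Gamma z -> f z = g z) -> lambda f = lambda g;
  tame_bound : exists K : R, forall w, `|Lcos lambda w| <= K /\ `|Lsin lambda w| <= K;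
  tame_mcos : measurable_fun setT (Lcos lambda);
  tame_msin : measurable_fun setT (Lsin lambda);
  tame_scos : forall w, scont (Lcos lambda) w;
  tame_ssin : forall w, scont (Lsin lambda) w;
  tame_odd : forall w, Lsin lambda (negt w) = - Lsin lambda w;
  tame_fubini : forall d (v : d.-tuple R -> tup) (a b : d.-tuple R -> R),
    measurable_fun setT v ->
    intgr (lebesgue_tuple R d) a -> intgr (lebesgue_tuple R d) b ->
    lambda (fun z => \int[lebesgue_tuple R d]_t (a t * cos (dotp (v t) z) + b t * sin (dotp (v t) z))) =
    \int[lebesgue_tuple R d]_t (a t * Lcos lambda (v t) + b t * Lsin lambda (v t)) }.

Lemma tame_even lambda w : Lcos lambda (negt w) = Lcos lambda w.
Proof. by rewrite /Lcos; congr lambda; apply/funext => z; rewrite dotp_negt cosN. Qed.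

Lemma tame_intgr_cos d Gamma lambda (v : d.-tuple R -> tup) a : tame Gamma lambda ->
  measurable_fun setT v -> intgr (lebesgue_tuple R d) a ->
  intgr (lebesgue_tuple R d) (fun t => a t * Lcos lambda (v t)).
Proof.
move=> gl mv ai; have [K hK] := tame_bound gl.
apply: (intgrM ai _ (fun t => (hK (v t)).1)); exact: (measurableT_comp (tame_mcos gl) mv).
Qed.

Lemma tame_intgr_sin d Gamma lambda (v : d.-tuple R -> tup) a : tame Gamma lambda ->
  measurable_fun setT v -> intgr (lebesgue_tuple R d) a ->
  intgr (lebesgue_tuple R d) (fun t => a t * Lsin lambda (v t)).
Proof.
move=> gl mv ai; have [K hK] := tame_bound gl.
apply: (intgrM ai _ (fun t => (hK (v t)).2)); exact: (measurableT_comp (tame_msin gl) mv).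
Qed.

Lemma tame_comb Gamma lambda1 lambda2 s : tame Gamma lambda1 -> tame Gamma lambda2 ->
  tame Gamma (fun f => lambda1 f + s * lambda2 f).
Proof.
move=> g1 g2; split.
- by move=> f g fg; rewrite (tame_local g1 fg) (tame_local g2 fg).
- have [K1 h1] := tame_bound g1; have [K2 h2] := tame_bound g2.
  exists (K1 + `|s| * K2) => w; have [a1 b1] := h1 w; have [a2 b2] := h2 w.
  by split; rewrite (le_trans (ler_normD _ _))// normrM lerD// ler_wpM2l.
- apply: measurable_funD; first exact: tame_mcos g1.
  by apply: measurable_funM => //; exact: tame_mcos g2.
- apply: measurable_funD; first exact: tame_msin g1.
  by apply: measurable_funM => //; exact: tame_msin g2.
- move=> w; apply: scontD; first exact: (tame_scos g1).
  by apply: scontM; [exact: scont_cst|exact: (tame_scos g2)].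
- move=> w; apply: scontD; first exact: (tame_ssin g1).
  by apply: scontM; [exact: scont_cst|exact: (tame_ssin g2)].
- move=> w; have h1 := tame_odd g1 w; have h2 := tame_odd g2 w.
  by rewrite /Lsin in h1 h2 *; rewrite h1 h2 mulrN opprD.
- move=> d v a b mv ai bi; rewrite (tame_fubini g1)// (tame_fubini g2)//.
  have c1 := tame_intgr_cos g1 mv ai; have s1 := tame_intgr_sin g1 mv bi.
  have c2 := tame_intgr_cos g2 mv ai; have s2 := tame_intgr_sin g2 mv bi.
  rewrite -(RintegralZl _ measurableT (intgrD c2 s2)).
  rewrite -(RintegralD measurableT (intgrD c1 s1) (intgrZ s (intgrD c2 s2))).
  by apply: eq_Rintegral => t _; rewrite /Lcos /Lsin; ring.
Qed.

Lemma tame_zero Gamma : tame Gamma (fun=> 0).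
Proof.
split => //.
- by exists 0 => w; rewrite normr0.
- exact: (@measurable_cst _ _ _ _ setT (0 : R)).
- exact: (@measurable_cst _ _ _ _ setT (0 : R)).
- by move=> w; exact (@scont_cst R m 0 w).
- by move=> w; exact (@scont_cst R m 0 w).
- by move=> w; rewrite /Lsin oppr0.
- move=> d v a b _ _ _; under eq_Rintegral do rewrite !mulr0 addr0.
  by rewrite Rintegral_cst// mul0r.
Qed.

Lemma tame_point Gamma (x : tup) : Gamma x -> tame Gamma (fun f => f x).
Proof.
move=> Gx; split => //.
- by move=> f g fg; exact: fg.
- by exists 1 => w; rewrite /Lcos /Lsin cos_max sin_max.
- by apply: (measurableT_comp (@measurable_cos R)); exact: measurable_dotp.
- by apply: (measurableT_comp (@measurable_sin R)); exact: measurable_dotp.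
- move=> w; apply: scont_cos; rewrite (_ : (fun y => _) = dotp x); first exact: scont_dotp.
  by apply/funext => y; exact: dotpC.
- move=> w; apply: scont_sin; rewrite (_ : (fun y => _) = dotp x); first exact: scont_dotp.
  by apply/funext => y; exact: dotpC.
- by move=> w; rewrite /Lsin dotp_negt sinN.
Qed.

Lemma tame_quadrature Gamma N lambda : is_quadrature Gamma N lambda -> tame Gamma lambda.
Proof.
move=> [x [w [Gx lE]]].
have -> : lambda = (fun f => \sum_(k < N) w k * f (x k)) by apply/funext => f; exact: lE.
elim: N x w Gx {lambda lE} => [|N IHN] x w Gx.
  have -> : (fun f : tup -> R => \sum_(k < 0) w k * f (x k)) = (fun=> 0).
    by apply/funext => f; rewrite big_ord0.
  exact: tame_zero.
have -> : (fun f : tup -> R => \sum_(k < N.+1) w k * f (x k)) =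
   (fun f => \sum_(k < N) w (widen_ord (leqnSn N) k) * f (x (widen_ord (leqnSn N) k)) + w ord_max * f (x ord_max)).
  by apply/funext => f; rewrite big_ord_recr.
apply: tame_comb; last exact: tame_point.
by apply: (IHN (fun k => x (widen_ord (leqnSn N) k)) (fun k => w (widen_ord (leqnSn N) k))).
Qed.

(** The integral over [Gamma] is the one of the integrand times the indicator
    of [Gamma], which gives the commutation by Fubini. *)
Lemma tame_integral (P : probability tup R) Gamma : measurable Gamma ->
  tame Gamma (fun f => \int[P]_(y in Gamma) f y).
Proof.
move=> mG.
pose one (z : tup) : R := \1_Gamma z.
have m1 : measurable_fun setT one by exact: measurable_indic.
have one0 z : 0 <= one z by rewrite /one indicE.
have one1 z : `|one z| <= 1 by rewrite ger0_norm// /one indicE; case: (_ \in _).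
have P1 : intgr P (fun=> 1 : R).
  apply: (@ge0_intgr _ _ _ _ _ 1%E) => //; last exact: ltry.
  by rewrite integral_cst//= mul1e probability_setT.
have onei : intgr P one by exact: (intgr_dom P1).
have E f : \int[P]_(y in Gamma) f y = \int[P]_y (one y * f y).
  rewrite Rintegral_mkcond; apply: eq_Rintegral => y _.
  by rewrite /one patchE indicE; case: ifP => _; rewrite ?mul1r ?mul0r.
have md := pmeas_dotp (R := R) (d := m).
have mtr (tr : R -> R) : measurable_fun setT tr -> pmeas (fun w y : tup => one y * tr (dotp w y)).
  move=> mt; apply: measurable_funM; first exact: (measurableT_comp m1 measurable_snd).
  exact: (measurableT_comp mt md).
have tri (tr : R -> R) w : measurable_fun setT tr -> (forall t, `|tr t| <= 1) ->
    intgr P (fun y => one y * tr (dotp w y)).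
  move=> mt t1; apply: (intgrM onei _ (fun y => t1 _)); exact: (measurableT_comp mt (pmeas1 w md)).
have mLt (tr : R -> R) : measurable_fun setT tr -> (forall t, `|tr t| <= 1) ->
    measurable_fun setT (fun w : tup => \int[P]_(y in Gamma) tr (dotp w y)).
  move=> mt t1; under eq_fun do rewrite E.
  by apply: (@measurable_Rint _ _ _ _ R P _ (mtr _ mt)) => w; exact: tri.
have sLt (tr : R -> R) : measurable_fun setT tr -> (forall t, `|tr t| <= 1) -> continuous tr ->
    forall w, scont (fun w : tup => \int[P]_(y in Gamma) tr (dotp w y)) w.
  move=> mt t1 ct w; under eq_fun do rewrite E.
  apply: (@scont_int _ _ _ _ P (fun y w => one y * tr (dotp w y)) one) => //.
  - by move=> v; exact: (pmeas1 v (mtr _ mt)).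
  - by move=> y v; rewrite normrM (ger0_norm (one0 y)) ler_piMr.
  move=> y; apply: scontM; first exact: scont_cst.
  apply: (@scont_comp _ _ tr (fun v => dotp v y)); first exact: ct.
  rewrite (_ : (fun v => _) = dotp y); first exact: scont_dotp.
  by apply/funext => v; exact: dotpC.
have mc := @measurable_cos R; have ms := @measurable_sin R.
split.
- by move=> f g fg; apply: eq_Rintegral => y; rewrite inE => /fg.
- exists (\int[P]_y one y) => w; rewrite /Lcos /Lsin !E.
  split; (apply: le_norm_Rint; [exact: onei| |by move=> y; rewrite normrM (ger0_norm (one0 y)) ler_piMr// ?cos_max ?sin_max]).
    exact: (pmeas1 w (mtr _ mc)).
  exact: (pmeas1 w (mtr _ ms)).
- exact: (mLt _ mc (@cos_max R)).
- exact: (mLt _ ms (@sin_max R)).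
- exact: (sLt _ mc (@cos_max R) (@continuous_cos R)).
- exact: (sLt _ ms (@sin_max R) (@continuous_sin R)).
- move=> w; rewrite /Lsin !E -mulN1r -(RintegralZl (-1) measurableT (tri _ w ms (@sin_max R))).
  by apply: eq_Rintegral => y _; rewrite dotp_negt sinN; ring.
move=> d v a b mv ai bi; rewrite E.
set leb := lebesgue_tuple R d.
have ti (y : tup) : intgr leb (fun t => a t * cos (dotp (v t) y) + b t * sin (dotp (v t) y)).
  apply: intgrD.
    apply: (intgrM ai _ (fun t => cos_max _)).
    by apply: (measurableT_comp mc); apply: measurable_dotp2.
  apply: (intgrM bi _ (fun t => sin_max _)).
  by apply: (measurableT_comp ms); apply: measurable_dotp2.
transitivity (\int[P]_y \int[leb]_t (one y * (a t * cos (dotp (v t) y) + b t * sin (dotp (v t) y)))).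
  by apply: eq_Rintegral => y _; rewrite (RintegralZl _ measurableT (ti y)).
rewrite Rfubini; last first.
  apply: (@pintgr_prod _ _ _ _ R P leb _ one (fun t => `|a t| + `|b t|)) => //.
  - apply: measurable_funM; first exact: (measurableT_comp m1 measurable_fst).
    apply: measurable_funD; apply: measurable_funM.
    + exact: (measurableT_comp (intgr_meas ai) measurable_snd).
    + apply: (measurableT_comp mc); apply: measurable_dotp2 => //.
      exact: (measurableT_comp mv measurable_snd).
    + exact: (measurableT_comp (intgr_meas bi) measurable_snd).
    + apply: (measurableT_comp ms); apply: measurable_dotp2 => //.
      exact: (measurableT_comp mv measurable_snd).
  - by apply: intgrD; [exact: (intgr_norm ai)|exact: (intgr_norm bi)].
  - move=> y t; rewrite normrM (ger0_norm (one0 y)) ler_wpM2l//.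
    rewrite (le_trans (ler_normD _ _))// !normrM lerD// ler_piMr//.
      exact: cos_max.
    exact: sin_max.
apply: eq_Rintegral => t _; rewrite /Lcos /Lsin !E.
have i1 := tri _ (v t) mc (@cos_max R); have i2 := tri _ (v t) ms (@sin_max R).
rewrite -(RintegralZl (a t) measurableT i1) -(RintegralZl (b t) measurableT i2).
rewrite -(RintegralD measurableT (intgrZ _ i1) (intgrZ _ i2)).
by apply: eq_Rintegral => y _; ring.
Qed.

(** The inverse of the square of the isotropic Sobolev weight
    ([sobolev_weight_bessel]). *)
Definition bessel (beta : R) (w : tup) : R := (1 + \sum_(i < m) tnth w i ^+ 2) `^ (- beta).

Let base1 (w : tup) : 1 <= 1 + \sum_(i < m) tnth w i ^+ 2.
Proof. by rewrite lerDl sumr_ge0// => i _; rewrite sqr_ge0. Qed.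

Lemma bessel_gt0 beta w : 0 < bessel beta w.
Proof. by rewrite powR_gt0// (lt_le_trans ltr01 (base1 w)). Qed.

Lemma bessel_le1 beta w : 0 <= beta -> bessel beta w <= 1.
Proof. by move=> b0; rewrite -(powRr0 (1 + \sum_(i < m) tnth w i ^+ 2)) ler_powR// oppr_le0. Qed.

Lemma bessel_scont beta w : scont (bessel beta) w.
Proof.
apply: (@scont_comp _ _ (fun t => t `^ (- beta)) (fun w : tup => 1 + \sum_(i < m) tnth w i ^+ 2)).
  have p : 0 < 1 + \sum_(i < m) tnth w i ^+ 2 by rewrite (lt_le_trans ltr01 (base1 w)).
  apply: differentiable_continuous; apply/derivable1_diffP; apply: derivable_powR.
  by rewrite in_itv/= p.
apply: scontD; first exact: scont_cst.
apply: scont_sum => i _.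
apply: (@scont_comp _ _ (fun t => t ^+ 2) (fun w : tup => tnth w i)); first exact: exprn_continuous.
exact: scont_tnth.
Qed.

Lemma bessel_meas beta : measurable_fun setT (bessel beta).
Proof.
apply: (measurableT_comp (measurable_powR _)); apply: measurable_funD => //.
apply: measurable_sum => i; apply: measurable_funX; exact: measurable_tnth.
Qed.

(** In each coordinate, 1 + |w|^2 >= 1 + w_k^2; splitting the exponent equally
    among the m coordinates reduces the integral to the one-dimensional one
    with exponent beta / m > 1 / 2. *)
Lemma bessel_integrable beta : (0 < m)%N -> m%:R / 2 < beta ->
  intgr (lebesgue_tuple R m) (bessel beta).
Proof.
move=> m0 mb.
have mr : 0 < m%:R :> R by rewrite ltr0n.
have b0 : 0 < beta by rewrite (lt_trans _ mb)// divr_gt0.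
have s2 : 2^-1 < beta / m%:R by rewrite ltr_pdivlMr// mulrC.
have [i _] := prod_tuple_integral (fun _ : 'I_m => bessel_intgr s2).
apply: (intgr_dom i); first exact: bessel_meas.
move=> w; rewrite ger0_norm ?(ltW (bessel_gt0 _ _))//.
have p (k : 'I_m) : 0 < 1 + tnth w k ^+ 2 by rewrite ltr_wpDr// sqr_ge0.
have T0 := lt_le_trans ltr01 (base1 w).
have -> : bessel beta w = \prod_(k < m) (1 + \sum_(i < m) tnth w i ^+ 2) `^ (- (beta / m%:R)).
  rewrite prodr_const card_ord -powR_mulrn ?powR_ge0// -powRrM mulNr divfK//.
  by rewrite gt_eqF.
apply: ler_prod => k _; rewrite powR_ge0/= !powRN lef_pV2 ?posrE ?powR_gt0//.
apply: ge0_ler_powR; rewrite ?nnegrE ?(ltW (p _)) ?(ltW T0)// ?divr_ge0 ?(ltW b0)//.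
by rewrite lerD2l (bigD1 k)//= lerDl sumr_ge0// => l _; rewrite sqr_ge0.
Qed.

Lemma sobolev_weight_bessel beta w :
  sobolev_weight (fun _ : 'I_1 => [set: 'I_m]%SET) (fun=> beta) w ^+ 2 * bessel beta w = 1.
Proof.
have T0 := lt_le_trans ltr01 (base1 w).
rewrite /sobolev_weight big_ord1 /bessel.
rewrite (_ : \sum_(i in _) _ = \sum_(i < m) tnth w i ^+ 2); last first.
  by apply: eq_bigl => i; rewrite finset.in_setT.
rewrite -powR_mulrn ?powR_ge0// -powRrM divfK//.
by rewrite powRN mulfV// gt_eqF// powR_gt0.
Qed.

(** Up to the factor [cfour ^+ 2], the squared norm of [lambda] in the dual of
    the isotropic Sobolev space. *)
Definition dualsq beta lambda : R :=
  \int[lebesgue_tuple R m]_w (bessel beta w * (Lcos lambda w ^+ 2 + Lsin lambda w ^+ 2)).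

Lemma dualsq_intgr beta Gamma lambda : (0 < m)%N -> m%:R / 2 < beta -> tame Gamma lambda ->
  intgr (lebesgue_tuple R m) (fun w => bessel beta w * (Lcos lambda w ^+ 2 + Lsin lambda w ^+ 2)).
Proof.
move=> m0 mb gl; have bi := bessel_integrable m0 mb; have [K hK] := tame_bound gl.
apply: (@intgrM _ _ _ _ (K ^+ 2 + K ^+ 2)) => //.
  by apply: measurable_funD; apply: measurable_funX; [exact: tame_mcos gl|exact: tame_msin gl].
move=> w; rewrite ger0_norm ?addr_ge0 ?sqr_ge0//.
have [c1 s1] := hK w.
by rewrite -(real_normK (num_real (Lcos _ _))) -(real_normK (num_real (Lsin _ _))) lerD// lerXn2r ?nnegrE// (le_trans _ c1).
Qed.

(** [f] is the Riesz representer of [lambda], normalised: its transform is a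
    multiple of the conjugate symbol times [bessel].  Its norm is at most 1 by
    [synth_fourierL2], and [lambda f] is the dual norm because [lambda]
    commutes with the integral that defines [f]. *)
Lemma dualsq_opnorm beta Gamma lambda (M : R) : (0 < m)%N -> m%:R / 2 < beta ->
  tame Gamma lambda -> (opnorm (iso_norm_on beta Gamma) lambda <= M%:E)%E ->
  dualsq beta lambda <= (M / cfour R m) ^+ 2.
Proof.
move=> m0 mb gl lM; set S := dualsq beta lambda.
have c0 := cfour_gt0 R m.
have b0 : 0 <= beta by rewrite ltW// (le_lt_trans _ mb)// divr_ge0.
have bi := bessel_integrable m0 mb.
have di := dualsq_intgr m0 mb gl.
have [S0|S0] := leP S 0; first by rewrite (le_trans S0)// sqr_ge0.
have [K hK] := tame_bound gl.
pose t := cfour R m / Num.sqrt S.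
have s0 : 0 < Num.sqrt S by rewrite sqrtr_gt0.
have t0 : 0 < t by rewrite divr_gt0.
pose p w := t * (bessel beta w * Lcos lambda w).
pose r w := t * (bessel beta w * Lsin lambda w).
have mid : measurable_fun setT (@id tup) by exact: measurable_id.
have pi_ : intgr (lebesgue_tuple R m) p by apply: intgrZ; exact: (tame_intgr_cos gl mid bi).
have ri : intgr (lebesgue_tuple R m) r by apply: intgrZ; exact: (tame_intgr_sin gl mid bi).
have bnd w (x : R) : `|x| <= K -> `|t * (bessel beta w * x)| <= t * K.
  move=> xK; rewrite normrM (gtr0_norm t0) ler_wpM2l ?(ltW t0)// normrM gtr0_norm ?bessel_gt0//.
  by rewrite (le_trans _ xK)// ler_piMl// bessel_le1.
have pM w : `|p w| <= t * K by apply: bnd; have [] := hK w.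
have rM w : `|r w| <= t * K by apply: bnd; have [] := hK w.
have psc w : scont p w.
  apply: scontM; first exact: scont_cst.
  by apply: scontM; [exact: bessel_scont|exact: (tame_scos gl)].
have rsc w : scont r w.
  apply: scontM; first exact: scont_cst.
  by apply: scontM; [exact: bessel_scont|exact: (tame_ssin gl)].
have bev w : bessel beta (negt w) = bessel beta w.
  by rewrite /bessel; congr ((1 + _) `^ _); apply: eq_bigr => i _; rewrite tnth_mktuple sqrrN.
have pev w : p (negt w) = p w by rewrite /p bev tame_even.
have rod w : r (negt w) = - r w by rewrite /r bev (tame_odd gl) !mulrN.
pose f := synth p r.
have fF := synth_fourierL2 pi_ ri pM rM psc rsc pev rod.
have cf := synth_continuous pi_ ri.
have lf : lambda f = cfour R m * Num.sqrt S.
  rewrite /f /synth (tame_fubini gl mid pi_ ri).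
  transitivity (\int[lebesgue_tuple R m]_w (t * (bessel beta w * (Lcos lambda w ^+ 2 + Lsin lambda w ^+ 2)))).
    by apply: eq_Rintegral => w _; rewrite /p /r; ring.
  rewrite (RintegralZl _ measurableT di) -/(dualsq _ _) -/S /t.
  by rewrite -{2}(sqr_sqrtr (ltW S0)); field; rewrite gt_eqF.
have nf : (iso_norm_on beta Gamma f <= 1)%E.
  apply: (@le_trans _ _ (sobolev_norm (fun _ : 'I_1 => [set: 'I_m]%SET) (fun=> beta) f)).
    by apply: ereal_inf_lbound; exists f.
  apply: (@le_trans _ _ (L2norm (fun w => sobolev_weight (fun _ : 'I_1 => [set: 'I_m]%SET) (fun=> beta) w *
      Normc.normc (Complex (p w / cfour R m) (- (r w / cfour R m)))))).
    by apply: ereal_inf_lbound; exists (fun w => Complex (p w / cfour R m) (- (r w / cfour R m))).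
  have E w : (sobolev_weight (fun _ : 'I_1 => [set: 'I_m]%SET) (fun=> beta) w *
      Normc.normc (Complex (p w / cfour R m) (- (r w / cfour R m)))) ^+ 2 =
      S^-1 * (bessel beta w * (Lcos lambda w ^+ 2 + Lsin lambda w ^+ 2)).
    rewrite exprMn normc_sqrE /p /r /t.
    transitivity ((sobolev_weight (fun _ : 'I_1 => [set: 'I_m]%SET) (fun=> beta) w ^+ 2 * bessel beta w) *
      ((Num.sqrt S) ^+ 2)^-1 * (bessel beta w * (Lcos lambda w ^+ 2 + Lsin lambda w ^+ 2))).
      by field; rewrite !gt_eqF.
    by rewrite sobolev_weight_bessel mul1r sqr_sqrtr// ltW.
  rewrite /L2norm Lnorm2_fin; last by under eq_fun do rewrite E; exact: intgrZ.
  under eq_Rintegral do rewrite E.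
  by rewrite (RintegralZl _ measurableT di) -/(dualsq _ _) -/S mulVf ?gt_eqF// sqrtr1.
have : (`|lambda f|%:E <= M%:E)%E.
  by apply: le_trans lM; apply: ereal_sup_ubound; exists f.
rewrite lee_fin lf gtr0_norm ?mulr_gt0// => hM.
rewrite -[leLHS](sqr_sqrtr (ltW S0)) lerXn2r ?nnegrE ?(ltW s0)//.
  by rewrite divr_ge0 ?(ltW c0)// (le_trans _ hM)// ltW// mulr_gt0.
by rewrite ler_pdivlMr// mulrC.
Qed.

End functionals.

(** * Tensor products of functionals in frequency *)

Section complex_integrands.
Variables (R : realType) (d : nat).
Local Notation leb := (lebesgue_tuple R d).
Local Notation tup := (d.-tuple R).
Implicit Types (Z L : tup -> R[i]).

Definition cmeas Z := measurable_fun setT (fun w => complex.Re (Z w)) /\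
  measurable_fun setT (fun w => complex.Im (Z w)).

Definition cintgr Z := intgr leb (fun w => complex.Re (Z w)) /\ intgr leb (fun w => complex.Im (Z w)).

Definition cbounded Z := exists K : R, forall w, `|complex.Re (Z w)| <= K /\ `|complex.Im (Z w)| <= K.

Definition sqr_normc (z : R[i]) : R := complex.Re z ^+ 2 + complex.Im z ^+ 2.

Lemma sqr_normc_ge0 z : 0 <= sqr_normc z.
Proof. by rewrite addr_ge0// sqr_ge0. Qed.

Lemma sqr_normcM z1 z2 : sqr_normc (z1 * z2) = sqr_normc z1 * sqr_normc z2.
Proof. by case: z1 => a b; case: z2 => a' b'; rewrite /sqr_normc /=; ring. Qed.

Lemma sqr_normc_prod (I : Type) (s : seq I) (F : I -> R[i]) :
  sqr_normc (\prod_(j <- s) F j) = \prod_(j <- s) sqr_normc (F j).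
Proof.
elim/big_ind2 : _ => // [|a b a' b' <- <-]; last exact: sqr_normcM.
by rewrite /sqr_normc /= expr1n expr0n addr0.
Qed.

Lemma ReM (z1 z2 : R[i]) : complex.Re (z1 * z2) =
  complex.Re z1 * complex.Re z2 - complex.Im z1 * complex.Im z2.
Proof. by case: z1 => a b; case: z2. Qed.

Lemma ImM (z1 z2 : R[i]) : complex.Im (z1 * z2) =
  complex.Re z1 * complex.Im z2 + complex.Im z1 * complex.Re z2.
Proof. by case: z1 => a b; case: z2. Qed.

Lemma Re_sqn z : complex.Re z ^+ 2 <= sqr_normc z.
Proof. by rewrite lerDl sqr_ge0. Qed.

Lemma cintgrM Z L : cintgr Z -> cmeas L -> cbounded L -> cintgr (fun w => Z w * L w).
Proof.
move=> [Z1 Z2] [L1 L2] [K hK]; split.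
  under eq_fun do rewrite ReM; apply: intgrB.
    by apply: (intgrM Z1 L1 (fun w => (hK w).1)).
  by apply: (intgrM Z2 L2 (fun w => (hK w).2)).
under eq_fun do rewrite ImM; apply: intgrD.
  by apply: (intgrM Z1 L2 (fun w => (hK w).2)).
by apply: (intgrM Z2 L1 (fun w => (hK w).1)).
Qed.

End complex_integrands.

Section tensor_fourier.
Variables (R : realType) (d n : nat) (D : 'I_n -> {set 'I_d}).
Variables (Gamma : forall j, set (#|D j|.-tuple R)).
Local Notation leb := (lebesgue_tuple R d).
Local Notation tup := (d.-tuple R).
Hypothesis Dpart : block_partition D.

(** The symbol of [lambda j] at the j-th block of the frequency. *)
Definition Lhat (lambda : forall j, (#|D j|.-tuple R -> R) -> R) j (w : tup) : R[i] :=
  Complex (Lcos (lambda j) (get_block (D j) w)) (Lsin (lambda j) (get_block (D j) w)).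

(** [h] is represented on the domain by [Z] through absolutely convergent
    Fourier inversion. *)
Definition frep (h : tup -> R) (Z : tup -> R[i]) :=
  cintgr Z /\ forall y, prod_domain Gamma y -> h y =
  \int[leb]_w (complex.Re (Z w) * cos (dotp w y) - complex.Im (Z w) * sin (dotp w y)).

(** The part of w.y coming from the blocks outside [s], on which no functional
    has acted yet. *)
Definition phase (s : seq 'I_n) (w y : tup) : R :=
  \sum_(i < d | all (fun k => i \notin D k) s) tnth w i * tnth y i.

Lemma phase_set_block s j w y z : j \notin s ->
  phase s w (@set_block R d (D j) y z) = phase (j :: s) w y + dotp (get_block (D j) w) z.
Proof.
move=> js; have Ddisj := block_partition_disjoint Dpart.
rewrite /phase (bigID (fun i => i \in D j)) /= addrC; congr (_ + _).
  under [LHS]eq_bigl do rewrite andbC.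
  apply: eq_bigr => i /andP[iD _]; by rewrite tnth_mktuple (negPf iD).
rewrite (eq_bigl (mem (D j))); last first.
  move=> i /=; case: (boolP (i \in D j)) => iD; rewrite ?andbF ?andbT//.
  apply/allP => k ks; have jk : j != k by apply: contraNneq js => ->.
  by rewrite (disjointFr (Ddisj _ _ jk) iD).
rewrite big_enum_val /dotp; apply: eq_bigr => k _.
rewrite !tnth_mktuple enum_valP; congr (_ * _).
rewrite (tnth_nth 0) {1}(enum_val_nth (enum_val k)) index_uniq ?enum_uniq//.
by rewrite -cardE.
Qed.

Lemma measurable_phase s y : measurable_fun setT (fun w => phase s w y).
Proof.
rewrite /phase.
rewrite (_ : (fun w => _) = (fun w => \sum_(i < d) (if all (fun k => i \notin D k) s then tnth w i * tnth y i else 0))).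
  apply: measurable_sum => i; case: (all _ s); last exact: measurable_cst.
  by apply: measurable_funM => //; exact: measurable_tnth.
by apply/funext => w; rewrite big_mkcond.
Qed.

Variable lambda : forall j, (#|D j|.-tuple R -> R) -> R.
Hypothesis glam : forall j, tame (@Gamma j) (@lambda j).

Lemma Lhat_cmeas j : cmeas (Lhat lambda j).
Proof.
have mb := @measurable_get_block R d (D j).
by split; [exact: (measurableT_comp (tame_mcos (glam j)) mb)|
           exact: (measurableT_comp (tame_msin (glam j)) mb)].
Qed.

Lemma Lhat_cbounded j : cbounded (Lhat lambda j).
Proof. by have [K hK] := tame_bound (glam j); exists K => w; exact: hK. Qed.

Lemma prod_Lhat_cintgr (Z : tup -> R[i]) (s : seq 'I_n) : cintgr Z ->
  cintgr (fun w => Z w * \prod_(j <- s) Lhat lambda j w).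
Proof.
move=> Zi; elim: s => [|j s IHs].
  by under eq_fun do rewrite big_nil mulr1.
rewrite (_ : (fun w => _) = (fun w => (Z w * \prod_(j <- s) Lhat lambda j w) * Lhat lambda j w)).
  by apply: cintgrM => //; [exact: Lhat_cmeas|exact: Lhat_cbounded].
by apply/funext => w; rewrite big_cons; ring.
Qed.

(** Applying one more functional, the waves in its block are replaced by the
    symbol; the remaining coordinates keep their phase.  Membership in the
    domain is required of the untouched blocks only, as the functionals see
    their own block on [Gamma]. *)
Lemma fold_fourier (h : tup -> R) (Z : tup -> R[i]) s y : frep h Z -> uniq s ->
  (forall k, k \notin s -> Gamma (get_block (D k) y)) ->
  foldr (fun j g y => lambda (fun z => g (@set_block R d (D j) y z))) h s y =
  \int[leb]_w (complex.Re (Z w * \prod_(j <- s) Lhat lambda j w) * cos (phase s w y) -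
               complex.Im (Z w * \prod_(j <- s) Lhat lambda j w) * sin (phase s w y)).
Proof.
move=> [Zi hZ]; have Ddisj := block_partition_disjoint Dpart.
elim: s y => [|j s IHs] y.
  move=> _ yG; rewrite /= hZ; last by move=> k; exact: yG.
  by apply: eq_Rintegral => w _; rewrite big_nil mulr1 /phase /=.
move=> /= /andP[js us] yG.
set Zs := fun w => Z w * \prod_(j <- s) Lhat lambda j w.
have Zsi : cintgr Zs by exact: prod_Lhat_cintgr.
pose th w := phase (j :: s) w y.
have mth : measurable_fun setT th by exact: measurable_phase.
have mc : measurable_fun setT (fun w => cos (th w)) by apply: (measurableT_comp (@measurable_cos R)).
have ms : measurable_fun setT (fun w => sin (th w)) by apply: (measurableT_comp (@measurable_sin R)).
pose a w := complex.Re (Zs w) * cos (th w) - complex.Im (Zs w) * sin (th w).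
pose b w := - (complex.Re (Zs w) * sin (th w)) - complex.Im (Zs w) * cos (th w).
have [Z1 Z2] := Zsi.
have ai : intgr leb a.
  by apply: intgrB; [exact: (intgrM Z1 mc (fun w => cos_max _))|exact: (intgrM Z2 ms (fun w => sin_max _))].
have bi : intgr leb b.
  apply: intgrB; last exact: (intgrM Z2 mc (fun w => cos_max _)).
  by apply: intgrN; exact: (intgrM Z1 ms (fun w => sin_max _)).
rewrite (tame_local (glam j) (g := fun z => \int[leb]_w (a w * cos (dotp (get_block (D j) w) z) + b w * sin (dotp (get_block (D j) w) z)))); last first.
  move=> z Gz; rewrite IHs//; last first.
    move=> k ks; have [->|kj] := eqVneq k j; first by rewrite get_set_block.
    rewrite get_set_block_disjoint ?Ddisj//; apply: yG.
    by rewrite inE negb_or kj.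
  apply: eq_Rintegral => w _; rewrite -/(Zs w) phase_set_block// -/(th w) cosD sinD /a /b; ring.
rewrite (tame_fubini (glam j) (@measurable_get_block R d (D j)) ai bi).
apply: eq_Rintegral => w _.
have -> : Z w * \prod_(j <- j :: s) Lhat lambda j w = Zs w * Lhat lambda j w.
  by rewrite big_cons /Zs; ring.
rewrite /a /b -[Lcos _ _]/(complex.Re (Lhat lambda j w)) -[Lsin _ _]/(complex.Im (Lhat lambda j w)) -/(th w).
by move: (Zs w) (Lhat lambda j w) => z1 z2; rewrite ReM ImM; ring.
Qed.

Lemma tensor_fourier (h : tup -> R) (Z : tup -> R[i]) : frep h Z ->
  tensor lambda h = \int[leb]_w complex.Re (Z w * \prod_(j < n) Lhat lambda j w).
Proof.
move=> hZ; rewrite /tensor (fold_fourier hZ) ?enum_uniq//; last first.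
  by move=> k; rewrite mem_enum.
apply: eq_Rintegral => w _.
have -> : phase (enum 'I_n) w [tuple 0 | _ < d] = 0.
  by rewrite /phase big1// => i _; rewrite tnth_mktuple mulr0.
by rewrite cos0 sin0 mulr1 mulr0 subr0 big_enum.
Qed.

End tensor_fourier.

Section tensor_bound.
Variables (R : realType) (d n : nat) (D : 'I_n -> {set 'I_d}).
Variable beta : 'I_n -> R.
Local Notation leb := (lebesgue_tuple R d).
Local Notation tup := (d.-tuple R).
Local Notation W := (sobolev_weight D beta).
Hypothesis Dpart : block_partition D.
Hypothesis beta_gt : forall j, #|D j|%:R / 2 < beta j.

Lemma block_gt0 j : (0 < #|D j|)%N.
Proof.
have [_ /and3P[_ _ D0]] := Dpart.
rewrite card_gt0; apply: contraNneq D0 => <-; exact: imset_f.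
Qed.

(** The anisotropic weight factorises over the blocks. *)
Lemma weight_prod w : W w ^+ 2 * \prod_(j < n) bessel (beta j) (get_block (D j) w) = 1.
Proof.
rewrite /sobolev_weight -prodrXl -big_split/= big1// => j _.
have E : \sum_(i in D j) tnth w i ^+ 2 = \sum_(i < #|D j|) tnth (get_block (D j) w) i ^+ 2.
  by rewrite big_enum_val; apply: eq_bigr => k _; rewrite tnth_mktuple.
have T0 : 0 < 1 + \sum_(i < #|D j|) tnth (get_block (D j) w) i ^+ 2.
  by rewrite ltr_wpDr// sumr_ge0// => i _; rewrite sqr_ge0.
rewrite E /bessel -powR_mulrn ?powR_ge0// -powRrM divfK//.
by rewrite powRN mulfV// gt_eqF// powR_gt0.
Qed.

Lemma weight_gt0 w : 0 < W w.
Proof.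
apply: prodr_gt0 => j _; rewrite powR_gt0// ltr_wpDr// sumr_ge0// => i _.
by rewrite sqr_ge0.
Qed.

Lemma weight_meas : measurable_fun setT W.
Proof.
apply: measurable_prod => j _; apply: (measurableT_comp (measurable_powR _)).
apply: measurable_funD => //.
rewrite (_ : (fun w => _) = (fun w => \sum_(i < d) (if i \in D j then tnth w i ^+ 2 else 0))).
  apply: measurable_sum => i; case: (i \in D j); last exact: measurable_cst.
  by apply: measurable_funX; exact: measurable_tnth.
by apply/funext => w; rewrite big_mkcond.
Qed.

Lemma bessel_prod_intgr : intgr leb (fun w => \prod_(j < n) bessel (beta j) (get_block (D j) w)).
Proof.
have E := block_integral Dpart (fun j => @bessel_meas R #|D j| (beta j)) (fun j x => ltW (bessel_gt0 (beta j) x)).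
apply: (@ge0_intgr _ _ _ _ _ (\prod_(j < n) (\int[lebesgue_tuple R #|D j|]_z bessel (beta j) z))%:E).
- apply: measurable_prod => j _; apply: (measurableT_comp (@bessel_meas R #|D j| (beta j))).
  exact: measurable_get_block.
- by move=> w; apply: prodr_ge0 => j _; rewrite ltW// bessel_gt0.
- rewrite E -prodEFin le_eqVlt; apply/orP; left; apply/eqP.
  apply: eq_bigr => j _; rewrite Rint_EFin//.
  by apply: bessel_integrable => //; exact: block_gt0.
- exact: ltry.
Qed.

(** The squared norm of the Sobolev space, on the frequency side. *)
Definition wnorm (Z : tup -> R[i]) := \int[leb]_w (W w ^+ 2 * sqr_normc (Z w)).
Definition wintgr (Z : tup -> R[i]) := cmeas Z /\ intgr leb (fun w => W w ^+ 2 * sqr_normc (Z w)).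

Lemma sqr_normc_meas (Z : tup -> R[i]) : cmeas Z -> measurable_fun setT (fun w => sqr_normc (Z w)).
Proof. by move=> [m1 m2]; apply: measurable_funD; exact: measurable_funX. Qed.

(** Cauchy-Schwarz: 1 / W is square integrable when beta_j > d_j / 2.  Here in
    the additive form |a| <= W^2 a^2 + W^(-2). *)
Lemma wintgr_cintgr Z : wintgr Z -> cintgr Z.
Proof.
move=> [mZ iZ]; have [m1 m2] := mZ.
have key (a : R) w : a ^+ 2 <= sqr_normc (Z w) ->
    `|a| <= W w ^+ 2 * sqr_normc (Z w) + \prod_(j < n) bessel (beta j) (get_block (D j) w).
  move=> aZ; set B := \prod_(j < n) _.
  have WB := weight_prod w; rewrite -/B in WB.
  have W0 := weight_gt0 w.
  have B0 : 0 <= B by apply: prodr_ge0 => j _; rewrite ltW// bessel_gt0.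
  have h : W w ^+ 2 * a ^+ 2 <= W w ^+ 2 * sqr_normc (Z w) by rewrite ler_wpM2l// sqr_ge0.
  apply: le_trans (lerD h (lexx B)).
  have : 0 <= (W w * `|a| - W w * B) ^+ 2 by exact: sqr_ge0.
  have -> : (W w * `|a| - W w * B) ^+ 2 = W w ^+ 2 * a ^+ 2 - 2 * `|a| * (W w ^+ 2 * B) + B * (W w ^+ 2 * B).
    by rewrite -(real_normK (num_real a)); ring.
  rewrite WB; have : 0 <= `|a| by [].
  lra.
have bi := bessel_prod_intgr.
split; apply: (intgr_dom (intgrD iZ bi)) => // w; apply: key; first exact: Re_sqn.
by rewrite /sqr_normc lerDr sqr_ge0.
Qed.

Variables (Gamma : forall j, set (#|D j|.-tuple R)).
Variable lambda : forall j, (#|D j|.-tuple R -> R) -> R.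
Hypothesis glam : forall j, tame (@Gamma j) (@lambda j).

(** Cauchy-Schwarz for the factors W Z and W^(-1) prod_j L_j; the integral of
    the square of the latter is the product of those over the blocks. *)
Lemma tensor_bound (Z : tup -> R[i]) : wintgr Z ->
  (\int[leb]_w complex.Re (Z w * \prod_(j < n) Lhat lambda j w)) ^+ 2 <=
  wnorm Z * \prod_(j < n) dualsq (beta j) (@lambda j).
Proof.
move=> Zw; have [mZ iZ] := Zw; have Zi := wintgr_cintgr Zw.
pose phi j z := bessel (beta j) z * (Lcos (@lambda j) z ^+ 2 + Lsin (@lambda j) z ^+ 2).
have phi0 j z : 0 <= phi j z by rewrite mulr_ge0 ?(ltW (bessel_gt0 _ _))// addr_ge0// sqr_ge0.
have phii j : intgr (lebesgue_tuple R #|D j|) (phi j).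
  by apply: (dualsq_intgr _ (beta_gt j) (glam j)); exact: block_gt0.
have mphi j := intgr_meas (phii j).
have E := block_integral Dpart mphi phi0.
have Gi : intgr leb (fun w => \prod_(j < n) phi j (get_block (D j) w)) /\
    \int[leb]_w (\prod_(j < n) phi j (get_block (D j) w)) = \prod_(j < n) dualsq (beta j) (@lambda j).
  have E2 : (\int[leb]_w (\prod_(j < n) phi j (get_block (D j) w))%:E = (\prod_(j < n) dualsq (beta j) (@lambda j))%:E)%E.
    by rewrite E -prodEFin; apply: eq_bigr => j _; rewrite /dualsq Rint_EFin.
  split; last by rewrite /Rintegral E2.
  apply: (@ge0_intgr _ _ _ _ _ (\prod_(j < n) dualsq (beta j) (@lambda j))%:E).
  - apply: measurable_prod => j _; apply: (measurableT_comp (mphi j)).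
    exact: measurable_get_block.
  - by move=> w; apply: prodr_ge0 => j _.
  - by rewrite E2.
  - exact: ltry.
have [gi gE] := Gi.
pose f w := W w * Num.sqrt (sqr_normc (Z w)).
pose g w := Num.sqrt (\prod_(j < n) phi j (get_block (D j) w)).
have msq := continuous_measurable_fun (@sqrt_continuous R).
have mf : measurable_fun setT f.
  apply: measurable_funM; first exact: weight_meas.
  by apply: (measurableT_comp msq); exact: sqr_normc_meas.
have mg : measurable_fun setT g by apply: (measurableT_comp msq); exact: intgr_meas gi.
have f2 w : f w ^+ 2 = W w ^+ 2 * sqr_normc (Z w) by rewrite exprMn sqr_sqrtr// sqr_normc_ge0.
have g2 w : g w ^+ 2 = \prod_(j < n) phi j (get_block (D j) w).
  by rewrite sqr_sqrtr// prodr_ge0.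
have f2i : intgr leb (fun w => f w ^+ 2) by under eq_fun do rewrite f2.
have g2i : intgr leb (fun w => g w ^+ 2) by under eq_fun do rewrite g2.
have [ri _] := prod_Lhat_cintgr glam (index_enum 'I_n) Zi.
rewrite -(real_normK (num_real (\int[leb]_w _))).
apply: (@le_trans _ _ ((\int[leb]_w (f w * g w)) ^+ 2)).
  rewrite lerXn2r ?nnegrE//.
    by apply: Rintegral_ge0 => w _; rewrite !mulr_ge0 ?sqrtr_ge0// ltW// weight_gt0.
  apply: le_norm_Rint; [exact: intgrM2|exact: intgr_meas ri|].
  move=> w; rewrite -(@ler_sqr R) ?nnegrE//; last first.
    by rewrite !mulr_ge0 ?sqrtr_ge0// ltW// weight_gt0.
  rewrite real_normK ?num_real// exprMn f2 g2 (le_trans (Re_sqn _))//.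
  rewrite sqr_normcM sqr_normc_prod big_split/= mulrACA.
  by rewrite weight_prod mul1r.
apply: (le_trans (Rint_CauchySchwarz mf mg f2i g2i)).
rewrite -gE /wnorm le_eqVlt; apply/orP; left; apply/eqP; congr (_ * _).
  by apply: eq_Rintegral => w _; rewrite f2.
by apply: eq_Rintegral => w _; rewrite g2.
Qed.

(** The strict inequality picks an extension and a version of its transform
    within the two infima that define the norm. *)
Lemma frep_of_norm (h : tup -> R) (C : R) :
  (sobolev_norm_on D beta (prod_domain Gamma) h < C%:E)%E ->
  exists Z, [/\ frep Gamma h Z, wintgr Z & wnorm Z <= (cfour R d * C) ^+ 2].
Proof.
move=> /ereal_inf_lt[_ [g [cg gh] <-]] /ereal_inf_lt[_ [F gF <-]] FC.
have c0 := cfour_gt0 R d.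
have [_ mF1 mF2 _] := gF.
have wE w : (W w * Normc.normc (F w)) ^+ 2 = W w ^+ 2 * sqr_normc (F w).
  by rewrite exprMn; congr (_ * _); case: (F w) => a b; rewrite normc_sqrE.
have mn : measurable_fun setT (fun w => W w * Normc.normc (F w)).
  apply: measurable_funM; first exact: weight_meas.
  rewrite (_ : (fun w => _) = (fun w => Num.sqrt (sqr_normc (F w)))).
    apply: (measurableT_comp (continuous_measurable_fun (@sqrt_continuous R))).
    exact: sqr_normc_meas.
  by apply/funext => w; case: (F w).
have Fi : intgr leb (fun w => (W w * Normc.normc (F w)) ^+ 2).
  by apply: Lnorm2_lty => //; exact: (lt_trans FC (ltry _)).
have wF : wintgr F by split => //; under eq_fun do rewrite -wE.
have cF := wintgr_cintgr wF.
exists (fun w => Complex (cfour R d * complex.Re (F w)) (cfour R d * complex.Im (F w))).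
have sqE w : sqr_normc (Complex (cfour R d * complex.Re (F w)) (cfour R d * complex.Im (F w))) = cfour R d ^+ 2 * sqr_normc (F w).
  by rewrite /sqr_normc /=; ring.
have WE w : W w ^+ 2 * sqr_normc (Complex (cfour R d * complex.Re (F w)) (cfour R d * complex.Im (F w))) =
    cfour R d ^+ 2 * (W w ^+ 2 * sqr_normc (F w)) by rewrite sqE; ring.
have [iF1 iF2] := cF; have [_ iF] := wF.
split.
- split; first by split; apply: intgrZ.
  move=> y yG; rewrite -gh ?inE// (fourier_inversion cg gF iF1 iF2) /inverse_fourier.
  rewrite -RintegralZl//.
    by apply: eq_Rintegral => w _ /=; ring.
  apply: (intgrM _ (M := 1)); [|exact: measurable_cst|by move=> _; rewrite normr1].
  apply: intgrB.
    by apply: (intgrM iF1 _ (fun w => cos_max _)); apply: (measurableT_comp (@measurable_cos R)); exact: measurable_dotp.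
  by apply: (intgrM iF2 _ (fun w => sin_max _)); apply: (measurableT_comp (@measurable_sin R)); exact: measurable_dotp.
- split; first by split; apply: measurable_funM.
  by under eq_fun do rewrite WE; exact: intgrZ.
rewrite /wnorm; under eq_Rintegral do rewrite WE.
rewrite (RintegralZl _ measurableT iF) exprMn ler_wpM2l ?sqr_ge0//.
move: FC; rewrite /L2norm Lnorm2_fin// lte_fin => FC.
have I0 : 0 <= \int[leb]_w ((W w * Normc.normc (F w)) ^+ 2).
  by apply: Rintegral_ge0 => w _; exact: sqr_ge0.
have -> : \int[leb]_w (W w ^+ 2 * sqr_normc (F w)) = \int[leb]_w ((W w * Normc.normc (F w)) ^+ 2).
  by apply: eq_Rintegral => w _; rewrite wE.
rewrite -[leLHS](sqr_sqrtr I0) lerXn2r ?nnegrE ?sqrtr_ge0 ?(ltW FC)//.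
by rewrite (le_trans _ (ltW FC))// sqrtr_ge0.
Qed.

End tensor_bound.

(** * The expectation as a tensor product *)

Section resampling.
Variables (R : realType) (d n : nat) (D : 'I_n -> {set 'I_d}).
Local Notation tup := (d.-tuple R).
Hypothesis Dpart : block_partition D.

Lemma measurable_prod_domain (A : forall j, set (#|D j|.-tuple R)) :
  (forall j, measurable (A j)) -> measurable (prod_domain A).
Proof.
move=> mA.
rewrite (_ : prod_domain A = \bigcap_(j in [set: 'I_n]) (get_block (D j) @^-1` A j)); last first.
  by apply/seteqP; split=> [y h j _|y h j]; [exact: h|exact: (h j)].
apply: fin_bigcap_measurable; first exact: finite_finset.
move=> j _; have := @measurable_get_block R d (D j) measurableT _ (mA j).
by rewrite setTI.
Qed.

(** The boxes over the blocks generate the Borel sets: a condition on a single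
    coordinate is a condition on the block that contains it. *)
Lemma prod_domain_generate :
  (measurable : set (set tup)) = <<s [set X | exists A : (forall j, set (#|D j|.-tuple R)),
      (forall j, measurable (A j)) /\ X = prod_domain A] >>.
Proof.
apply/seteqP; split; last first.
  apply: smallest_sub; first exact: sigma_algebra_measurable.
  by move=> _ [A [mA ->]]; exact: measurable_prod_domain.
apply: smallest_sub; first exact: smallest_sigma_algebra.
move=> X; rewrite -bigcup_seq => -[i _ [B mB <-]]; rewrite setTI.
apply: sub_sigma_algebra.
exists (fun j => [set z | forall k : 'I_#|D j|, enum_val k = i -> B (tnth z k)]); split.
  move=> j; have [[k ki]|nk] := pselect (exists k : 'I_#|D j|, enum_val k = i).
    rewrite (_ : [set z | _] = (fun z => tnth z k) @^-1` B).
      by rewrite -[X in measurable X]setTI; apply: measurable_tnth.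
    apply/seteqP; split=> z /= h; first exact: h.
    by move=> k'; rewrite -ki => /enum_val_inj ->.
  rewrite (_ : [set z | _] = setT); first exact: measurableT.
  by apply/seteqP; split=> // z _ k ki; case: nk; exists k.
apply/seteqP; split=> y /=.
  by move=> By j k ki; rewrite tnth_mktuple ki.
have [_ /and3P[/eqP cov _ _]] := Dpart.
have : i \in [set: 'I_d]%SET by rewrite finset.in_setT.
rewrite -cov => /finset.bigcupP[_ /imsetP[j _ ->] iB] /(_ j (enum_rank_in iB i)).
by rewrite enum_rankK_in// tnth_mktuple enum_rankK_in//; apply.
Qed.

Variables (P_ : forall j, probability (#|D j|.-tuple R) R) (P : probability tup R).
Hypothesis Pprod : is_product_measure P_ P.

Lemma measurable_set_block j :
  measurable_fun setT (fun z : tup * #|D j|.-tuple R => @set_block R d (D j) z.1 z.2).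
Proof.
apply: measurable_tuple => i; have [iD|iD] := boolP (i \in D j); last first.
  rewrite (_ : (fun x => _) = (fun z => tnth z.1 i)).
    exact: (measurableT_comp (measurable_tnth i) measurable_fst).
  by apply/funext => z; rewrite tnth_mktuple (negPf iD).
have ik : (index i (enum (D j)) < #|D j|)%N by rewrite cardE index_mem mem_enum.
rewrite (_ : (fun x => _) = (fun z => tnth z.2 (Ordinal ik))).
  exact: (measurableT_comp (measurable_tnth _) measurable_snd).
by apply/funext => z; rewrite tnth_mktuple iD (tnth_nth 0).
Qed.

(** A product distribution is unchanged when a block is replaced by an
    independent copy; by uniqueness of measures it suffices to compare boxes. *)
Lemma resample_measure j (A : set tup) : measurable A ->
  P A = pushforward (P \x P_ j)%E (fun z : tup * #|D j|.-tuple R => @set_block R d (D j) z.1 z.2) A.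
Proof.
move=> mA; have Ddisj := block_partition_disjoint Dpart.
have msb := @measurable_set_block j.
pose m2 := measure_function_pushforward__canonical__measure_function_Measure (P \x P_ j)%E msb.
apply: (measure_unique _ (fun=> setT) prod_domain_generate _ _ _ P m2) => //.
- move=> _ _ [A1 [mA1 ->]] [A2 [mA2 ->]].
  exists (fun j => A1 j `&` A2 j); split; first by move=> k; exact: measurableI.
  apply/seteqP; split=> [y [h1 h2] k|y h]; first by split; [exact: h1|exact: h2].
  by split=> k; have [] := h k.
- move=> _; exists (fun=> setT); split; first by move=> k; exact: measurableT.
  by apply/seteqP; split.
- by apply/seteqP; split=> // y _; exists 0%N.
- move=> _ [B [mB ->]] /=; rewrite /m2 /= /pushforward.
  pose B' k : set (#|D k|.-tuple R) := if k == j then setT else B k.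
  have mB' k : measurable (B' k) by rewrite /B'; case: eqP => // _; exact: measurableT.
  rewrite (_ : _ @^-1` _ = prod_domain B' `*` B j); last first.
    apply/seteqP; split=> [[y z] h|[y z] [/= h Bz] k] /=.
      split=> /=.
        move=> k; rewrite /B'; case: eqP => // /eqP kj.
        by have := h k; rewrite get_set_block_disjoint// Ddisj.
      by have := h j; rewrite /= get_set_block.
    have [->|kj] := eqVneq k j; first by rewrite get_set_block.
    by rewrite get_set_block_disjoint ?Ddisj//; have := h k; rewrite /B' (negPf kj).
  rewrite product_measure1E; [|exact: (measurable_prod_domain mB')|exact: mB].
  rewrite (Pprod mB) [X in _ = (X * _)%E](_ : _ = \prod_(k < n) P_ k (B' k))%E; last exact: (Pprod mB').
  rewrite (bigD1 j)//= [in RHS](bigD1 j)//= {1}/B' eqxx probability_setT mul1e muleC.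
  by congr (_ * _)%E; apply: eq_bigr => k kj; rewrite /B' (negPf kj).
- by move=> _; rewrite (le_lt_trans (probability_le1 _ _))// ltry.
Qed.

Lemma bounded_prob_intgr dd (T : measurableType dd) (Q : probability T R) (h : T -> R) M :
  measurable_fun setT h -> (forall y, `|h y| <= M) -> intgr Q h.
Proof.
move=> mh hM.
have Q1 : intgr Q (fun=> 1 : R).
  apply: (@ge0_intgr _ _ _ _ _ 1%E) => //; last exact: ltry.
  by rewrite integral_cst//= mul1e probability_setT.
have := intgrM Q1 mh hM; rewrite /intgr; apply: eq_integrable => // y _.
by rewrite /= mul1r.
Qed.

Lemma resample j (h : tup -> R) M : measurable_fun setT h -> (forall y, `|h y| <= M) ->
  \int[P]_y h y = \int[P]_y \int[P_ j]_z h (@set_block R d (D j) y z).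
Proof.
move=> mh hM; have msb := @measurable_set_block j.
have mhs : measurable_fun setT (fun z : tup * #|D j|.-tuple R => h (@set_block R d (D j) z.1 z.2)).
  exact: (measurableT_comp mh msb).
have pm : pmeas (fun y z => h (@set_block R d (D j) y z)) by exact: mhs.
have hi : pintgr P (P_ j) (fun y z => h (@set_block R d (D j) y z)).
  apply: (@pintgr_bound1 _ _ _ _ R P (P_ j) _ (fun=> M)) => //.
  - by move=> y; apply: (@bounded_prob_intgr _ _ _ _ (M)) => //; exact: (pmeas1 y pm).
  - apply: (@bounded_prob_intgr _ _ _ _ (`|M|)); first exact: measurable_cst.
    by move=> y.
  - move=> y.
    have bi : intgr (P_ j) (fun z => h (@set_block R d (D j) y z)).
      by apply: (@bounded_prob_intgr _ _ _ _ (M)) => //; exact: (pmeas1 y pm).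
    have ci : intgr (P_ j) (fun=> M).
      apply: (@bounded_prob_intgr _ _ _ _ (`|M|)); first exact: measurable_cst.
      by move=> y'.
    apply: (le_trans (intgr_le (intgr_norm bi) ci (fun z => hM _))).
    by rewrite Rintegral_cst//= probability_setT mulr1.
rewrite Rfubini_prod// /Rintegral; congr fine.
transitivity (\int[pushforward (P \x P_ j)%E (fun z : tup * #|D j|.-tuple R => @set_block R d (D j) z.1 z.2)]_y (h y)%:E)%E.
  by apply: eq_measure_integral => A mA _; exact: resample_measure.
have meh : measurable_fun setT (EFin \o h) by apply/measurable_EFinP.
have hi' : (P \x P_ j)%E.-integrable setT ((EFin \o h) \o (fun z : tup * #|D j|.-tuple R => @set_block R d (D j) z.1 z.2)) by exact: hi.
have := @integral_pushforward _ _ _ _ _ _ msb _ _ _ meh hi' measurableT.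
by rewrite preimage_setT.
Qed.

Lemma resample_meas j (h : tup -> R) M : measurable_fun setT h -> (forall y, `|h y| <= M) ->
  measurable_fun setT (fun y => \int[P_ j]_z h (@set_block R d (D j) y z)) /\
  (forall y, `|\int[P_ j]_z h (@set_block R d (D j) y z)| <= M).
Proof.
move=> mh hM; have msb := @measurable_set_block j.
have mhs : measurable_fun setT (fun z : tup * #|D j|.-tuple R => h (@set_block R d (D j) z.1 z.2)).
  exact: (measurableT_comp mh msb).
have pm : pmeas (fun y z => h (@set_block R d (D j) y z)) by exact: mhs.
have bi y : intgr (P_ j) (fun z => h (@set_block R d (D j) y z)).
  by apply: (@bounded_prob_intgr _ _ _ _ (M)) => //; exact: (pmeas1 y pm).
split.
  exact: (@measurable_Rint _ _ _ _ R (P_ j) (fun y z => h (@set_block R d (D j) y z)) mhs bi).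
move=> y.
have ci : intgr (P_ j) (fun=> M).
  apply: (@bounded_prob_intgr _ _ _ _ (`|M|)); first exact: measurable_cst.
  by move=> y'.
rewrite (le_trans (le_norm_Rint ci (intgr_meas (bi y)) (fun z => hM _)))//.
by rewrite Rintegral_cst//= probability_setT mulr1.
Qed.

Definition integrals j (f : #|D j|.-tuple R -> R) : R := \int[P_ j]_z f z.

Lemma resample_fold (h : tup -> R) M s : measurable_fun setT h -> (forall y, `|h y| <= M) ->
  let F := foldr (fun j g y => integrals (fun z => g (@set_block R d (D j) y z))) h s in
  [/\ measurable_fun setT F, (forall y, `|F y| <= M) & \int[P]_y h y = \int[P]_y F y].
Proof.
move=> mh hM; elim: s => [|j s [mF FM FE]] //=.
by have [m1 b1] := resample_meas j mF FM; split=> //; rewrite FE; exact: (resample j mF FM).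
Qed.

(** Every integration overwrites the coordinates of its block. *)
Lemma fold_indep (h : tup -> R) s y y' :
  (forall i, (forall k, k \in s -> i \notin D k) -> tnth y i = tnth y' i) ->
  foldr (fun j g y => integrals (fun z => g (@set_block R d (D j) y z))) h s y =
  foldr (fun j g y => integrals (fun z => g (@set_block R d (D j) y z))) h s y'.
Proof.
elim: s y y' => [|j s IHs] y y' hy /=.
  by congr h; apply: eq_from_tnth => i; exact: hy.
congr integrals; apply/funext => z; apply: IHs => i hi; rewrite !tnth_mktuple.
case: (boolP (i \in D j)) => // iD; apply: hy => k.
by rewrite inE => /predU1P[->//|/hi].
Qed.

Lemma expectation_tensor (h : tup -> R) M : measurable_fun setT h -> (forall y, `|h y| <= M) ->
  \int[P]_y h y = tensor integrals h.
Proof.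
move=> mh hM; have [_ _ ->] := resample_fold (enum 'I_n) mh hM.
rewrite /tensor; set y0 : tup := [tuple 0 | _ < d].
transitivity (\int[P]_y (foldr (fun j g y => integrals (fun z => g (@set_block R d (D j) y z))) h (enum 'I_n) y0)).
  apply: eq_Rintegral => y _; apply: fold_indep => i hi.
  have [_ /and3P[/eqP cov _ _]] := Dpart.
  have : i \in [set: 'I_d]%SET by rewrite finset.in_setT.
  rewrite -cov => /finset.bigcupP[_ /imsetP[j _ ->] iB].
  by have := hi j; rewrite mem_enum => /(_ isT); rewrite iB.
by rewrite Rintegral_cst//= probability_setT mulr1.
Qed.

End resampling.

Section expectation.
Variables (R : realType) (d n : nat) (D : 'I_n -> {set 'I_d}).
Local Notation leb := (lebesgue_tuple R d).
Local Notation tup := (d.-tuple R).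
Hypothesis Dpart : block_partition D.
Variables (P_ : forall j, probability (#|D j|.-tuple R) R) (P : probability tup R).
Hypothesis Pprod : is_product_measure P_ P.
Variables (Gamma : forall j, set (#|D j|.-tuple R)).
Hypothesis mGamma : forall j, measurable (@Gamma j).
Hypothesis PGamma : forall j, P_ j (@Gamma j) = 1%E.

Definition integrals_on j (f : #|D j|.-tuple R -> R) : R := \int[P_ j]_(z in @Gamma j) f z.

Lemma Rint_full dd (T : measurableType dd) (Q : probability T R) (A : set T) (f : T -> R) :
  measurable A -> Q A = 1%E -> intgr Q f -> \int[Q]_(x in A) f x = \int[Q]_x f x.
Proof.
move=> mA QA fi; rewrite /Rintegral; congr fine.
have QC : Q (~` A) = 0%E by rewrite probability_setC// QA subee.
rewrite [RHS](negligible_integral (N := ~` A)); [|exact: measurableC|exact: measurableT|exact: fi|exact: QC].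
by rewrite setTD setCK.
Qed.

(** On the full space, not only on the domain, the superposition of waves is
    bounded and measurable, so that resampling applies to it; the integrals
    over Gamma and over the full space agree as Gamma has mass 1. *)
Lemma expectation_fourier (q : tup -> R) (Z : tup -> R[i]) : frep Gamma q Z ->
  \int[P]_(y in prod_domain Gamma) q y =
  \int[leb]_w complex.Re (Z w * \prod_(j < n) Lhat integrals_on j w).
Proof.
move=> [Zi qZ]; have [Z1 Z2] := Zi.
pose qb y := \int[leb]_w (complex.Re (Z w) * cos (dotp w y) - complex.Im (Z w) * sin (dotp w y)).
have Z2' := intgrN Z2.
have qbE y : qb y = synth (fun w => complex.Re (Z w)) (fun w => - complex.Im (Z w)) y.
  by apply: eq_Rintegral => w _; rewrite mulNr.
have mqb : measurable_fun setT qb.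
  by rewrite (funext qbE); exact: synth_meas.
have bqb y : `|qb y| <= \int[leb]_w (`|complex.Re (Z w)| + `|- complex.Im (Z w)|).
  by rewrite qbE; exact: synth_bound.
have mdom := measurable_prod_domain mGamma.
have Pdom : P (prod_domain Gamma) = 1%E.
  by rewrite Pprod// big1// => j _; exact: PGamma.
transitivity (\int[P]_(y in prod_domain Gamma) qb y).
  by apply: eq_Rintegral => y; rewrite inE => yG; exact: qZ.
rewrite (Rint_full mdom Pdom); last exact: (@bounded_prob_intgr R _ _ P _ _ mqb bqb).
rewrite (expectation_tensor Dpart Pprod mqb bqb).
have gT j : tame [set: #|D j|.-tuple R] (integrals P_ (j := j)).
  by apply: tame_integral; exact: measurableT.
rewrite (tensor_fourier Dpart gT (Z := Z)); last by split.
apply: eq_Rintegral => w _; congr (complex.Re (_ * _)); apply: eq_bigr => j _.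
have tr (f : R -> R) : measurable_fun setT f -> (forall t, `|f t| <= 1) ->
    \int[P_ j]_z f (dotp (get_block (D j) w) z) = \int[P_ j]_(z in @Gamma j) f (dotp (get_block (D j) w) z).
  move=> mf f1; rewrite (Rint_full (@mGamma j) (PGamma j))//.
  apply: (@bounded_prob_intgr R _ _ _ _ 1) => //.
  by apply: (measurableT_comp mf); apply: measurable_dotp2.
by rewrite /Lhat; congr Complex; apply: tr; [exact: measurable_cos|exact: cos_max|exact: measurable_sin|exact: sin_max].
Qed.

End expectation.

(** * Sums over levels *)

Section level_sums.
Variables (R : realType) (I : finType).
Implicit Types (y : I -> R) (z : R).

Lemma geometric_tail (x : R) L T : 0 <= x -> x < 1 ->
  \sum_(0 <= t < T | (L < t)%N) x ^+ t <= x ^+ L.+1 / (1 - x).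
Proof.
move=> x0 x1; rewrite ler_pdivlMr ?subr_gt0//.
suff : (\sum_(0 <= t < T | (L < t)%N) x ^+ t) * (1 - x) + x ^+ (maxn T L.+1) <= x ^+ L.+1.
  by apply: le_trans; rewrite lerDl exprn_ge0.
elim: T => [|T IHT]; first by rewrite big_geq// mul0r add0r max0n.
rewrite big_mkcond big_nat_recr//= -big_mkcond; case: (ltnP L T) => LT.
  have e1 : maxn T.+1 L.+1 = T.+1 by apply/maxn_idPl; rewrite ltnS ltnW.
  have e2 : maxn T L.+1 = T by apply/maxn_idPl.
  rewrite e2 in IHT; rewrite e1; apply: le_trans IHT.
  by rewrite exprS; set S := \sum_(_ <= _ < _ | _) _; lra.
have e1 : maxn T.+1 L.+1 = L.+1 by apply/maxn_idPr; rewrite ltnS.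
have e2 : maxn T L.+1 = L.+1 by apply/maxn_idPr; rewrite ltnW// ltnS.
by rewrite addr0 e1; rewrite e2 in IHT.
Qed.

Lemma geometric_head (u : R) L : 1 < u ->
  \sum_(0 <= t < L.+1) u ^+ t <= u ^+ L * (u / (u - 1)).
Proof.
move=> u1; have u0 : 0 < u - 1 by rewrite subr_gt0.
rewrite mulrA ler_pdivlMr// -exprSr.
elim: L => [|L IHL]; first by rewrite big_nat1 expr0 expr1 mul1r; lra.
rewrite big_nat_recr//= mulrDl.
have -> : u ^+ L.+2 = u ^+ L.+1 + u ^+ L.+1 * (u - 1) by rewrite (exprS _ L.+1); ring.
by rewrite lerD2r.
Qed.

Definition height M (l : {ffun I -> 'I_M.+1}) : nat := \sum_i l i.

(** Once the height is fixed, the entry at [i0] is a function of the others, so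
    that a direction with y = 1 costs nothing. *)
Lemma fixed_height M y i0 t : (forall i, 0 <= y i) -> y i0 = 1 ->
  \sum_(l : {ffun I -> 'I_M.+1} | height l == t) \prod_i y i ^+ l i <=
  \prod_(i | i != i0) \sum_(k < M.+1) y i ^+ k.
Proof.
move=> y0 yi0.
pose F i (k : 'I_M.+1) : R := if i == i0 then (k == ord0)%:R else y i ^+ k.
have F0 i k : 0 <= F i k by rewrite /F; case: eqP => // _; rewrite exprn_ge0.
have -> : \prod_(i | i != i0) \sum_(k < M.+1) y i ^+ k = \sum_(f : {ffun I -> 'I_M.+1}) \prod_i F i (f i).
  have F1 : \sum_(k < M.+1) F i0 k = 1.
    rewrite (bigD1 ord0)//= {1}/F !eqxx big1 ?addr0// => k k0.
    by rewrite /F eqxx (negPf k0).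
  rewrite -bigA_distr_bigA [in RHS](bigD1 i0)//= F1 mul1r.
  by apply: eq_bigr => i ii0; apply: eq_bigr => k _; rewrite /F (negPf ii0).
(* [phi] forgets the entry at i0, and is injective on each fibre of the
   height. *)
pose phi (l : {ffun I -> 'I_M.+1}) : {ffun I -> 'I_M.+1} := [ffun i => if i == i0 then ord0 else l i].
have phiF (l : {ffun I -> 'I_M.+1}) : \prod_i y i ^+ l i = \prod_i F i (phi l i).
  apply: eq_bigr => i _; rewrite /F /phi ffunE; case: eqP => [->|//].
  by rewrite yi0 expr1n.
rewrite (partition_big phi predT)//=; apply: ler_sum => f _.
rewrite (eq_bigr (fun=> \prod_i F i (f i))); last first.
  by move=> l /andP[_ /eqP <-]; exact: phiF.
have le1 : (#|[pred l | (height l == t) && (phi l == f)]| <= 1)%N.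
  apply/card_le1_eqP => l l' /andP[/eqP lt /eqP lf] /andP[/eqP lt' /eqP lf'].
  have E i : i != i0 -> l i = l' i.
    move=> ii0; have : phi l i = phi l' i by rewrite lf lf'.
    by rewrite !ffunE (negPf ii0).
  apply/ffunP => i; have [->|/E//] := eqVneq i i0; apply: val_inj => /=.
  have : height l = height l' by rewrite lt lt'.
  rewrite /height (bigD1 i0)//= [in RHS](bigD1 i0)//=.
  rewrite (eq_bigr (fun i => l' i : nat)); last by move=> k /E ->.
  by move=> /eqP; rewrite eqn_add2r => /eqP.
rewrite sumr_const; set x := \prod_i _.
have x0 : 0 <= x by apply: prodr_ge0.
by move: le1; case: #|_| => [|[|//]] _; rewrite ?mulr0n ?mulr1n.
Qed.

Lemma sum_by_height M y z i0 T (A : pred nat) : (forall i, 0 <= y i) -> y i0 = 1 -> 0 <= z ->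
  (#|I| * M < T)%N ->
  \sum_(l : {ffun I -> 'I_M.+1} | A (height l)) z ^+ height l * \prod_i y i ^+ l i <=
  (\sum_(0 <= t < T | A t) z ^+ t) * \prod_(i | i != i0) \sum_(k < M.+1) y i ^+ k.
Proof.
move=> y0 yi0 z0 MT.
have lT (l : {ffun I -> 'I_M.+1}) : (height l < T)%N.
  apply: leq_ltn_trans MT; rewrite /height -sum_nat_const.
  by apply: leq_sum => i _; rewrite -ltnS.
case: T lT {MT} => [|T] lT.
  by have := lT [ffun=> ord0].
rewrite big_mkord mulr_suml.
rewrite (partition_big (fun l => inord (height l) : 'I_T.+1) (fun t => A t))/=; last first.
  by move=> l Al; rewrite inordK.
apply: ler_sum => t At.
apply: le_trans (ler_wpM2l (exprn_ge0 t z0) (fixed_height M t y0 yi0)).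
rewrite mulr_sumr [leLHS]big_mkcond [leRHS]big_mkcond; apply: ler_sum => l _.
have p0 : 0 <= \prod_i y i ^+ l i by apply: prodr_ge0 => i _; rewrite exprn_ge0.
case: ifP => [/andP[Al /eqP lt]|_].
  have tE : height l = t by rewrite -lt inordK.
  by rewrite tE eqxx.
by case: ifP => // _; rewrite mulr_ge0// exprn_ge0.
Qed.

(** The directions with y = 1 other than [i0] contribute a factor M + 1 each,
    those with y < 1 a convergent geometric series. *)
Lemma prod_geometric M y i0 : (forall i, 0 <= y i <= 1) -> y i0 = 1 ->
  \prod_(i | i != i0) \sum_(k < M.+1) y i ^+ k <=
  M.+1%:R ^+ #|[pred i | y i == 1]|.-1 * \prod_(i | y i != 1) (1 - y i)^-1.
Proof.
move=> y01 yi0.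
have bnd i : \sum_(k < M.+1) y i ^+ k <= if y i == 1 then M.+1%:R else (1 - y i)^-1.
  have /andP[y0 y1] := y01 i; case: eqP => [->|/eqP yi].
    by under eq_bigr do rewrite expr1n; rewrite sumr_const card_ord.
  have y1' : 0 < 1 - y i by rewrite subr_gt0 lt_neqAle yi.
  rewrite -[leRHS]mul1r ler_pdivlMr//.
  have -> : (\sum_(k < M.+1) y i ^+ k) * (1 - y i) = 1 - y i ^+ M.+1.
    by rewrite -[RHS]opprB subrX1 -mulNr opprB mulrC.
  by rewrite gerBl exprn_ge0.
apply: (@le_trans _ _ (\prod_(i | i != i0) if y i == 1 then M.+1%:R else (1 - y i)^-1)).
  apply: ler_prod => i _; rewrite bnd andbT; apply: sumr_ge0 => k _.
  by rewrite exprn_ge0//; have /andP[] := y01 i.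
rewrite (bigID (fun i => y i == 1))/=.
rewrite (eq_bigr (fun=> M.+1%:R)); last by move=> i /andP[_ ->].
rewrite prodr_const le_eqVlt; apply/orP; left; apply/eqP; congr (_ * _).
  congr (_ ^+ _); rewrite [in RHS](cardD1 i0) inE /= yi0 eqxx /=.
  by apply: eq_card => i; rewrite !inE.
apply: eq_big => i; last by move=> /andP[_ /negPf ->].
by have [->|//] := eqVneq i i0; rewrite yi0 eqxx.
Qed.

(** A height of at most M bounds every entry by M. *)
Lemma widen_sum M (G : (I -> nat) -> R) :
  \sum_(l : {ffun I -> 'I_M.+1} | (height l <= M)%N) G (fun i => l i) =
  \sum_(l : {ffun I -> 'I_M.+2} | (height l <= M)%N) G (fun i => l i).
Proof.
have le (l : {ffun I -> 'I_M.+2}) i : (height l <= M)%N -> (l i <= M)%N.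
  by apply: leq_trans; rewrite /height (bigD1 i)//= leq_addr.
pose up (l : {ffun I -> 'I_M.+1}) : {ffun I -> 'I_M.+2} := [ffun i => widen_ord (leqnSn M.+1) (l i)].
pose down (l : {ffun I -> 'I_M.+2}) : {ffun I -> 'I_M.+1} := [ffun i => inord (l i)].
rewrite [RHS](reindex_onto up down)/=; last first.
  move=> l lM; apply/ffunP => i; rewrite !ffunE; apply: val_inj => /=.
  by rewrite inordK// ltnS le.
apply: eq_big => l.
  have -> : down (up l) = l.
    by apply/ffunP => i; rewrite !ffunE; apply: val_inj => /=; rewrite inordK.
  rewrite eqxx andbT; congr (_ <= _)%N; apply: eq_bigr => i _; by rewrite ffunE.
by move=> _; congr G; apply/funext => i; rewrite ffunE.
Qed.

End level_sums.

(** The levels of the quadratures and of the solver are treated alike, as one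
    family indexed by [option 'I_n]. *)
Lemma sum_option (R : realType) n M (A : pred nat) (G : (option 'I_n -> nat) -> R) :
  \sum_(l : {ffun 'I_n -> 'I_M.+1} * 'I_M.+1 | A (\sum_j l.1 j + l.2)%N)
     G (fun o => if o is Some j then l.1 j : nat else l.2 : nat) =
  \sum_(l : {ffun option 'I_n -> 'I_M.+1} | A (height l)) G (fun i => l i).
Proof.
pose h (l : {ffun option 'I_n -> 'I_M.+1}) : {ffun 'I_n -> 'I_M.+1} * 'I_M.+1 :=
  ([ffun j => l (Some j)], l None).
pose g (l : {ffun 'I_n -> 'I_M.+1} * 'I_M.+1) : {ffun option 'I_n -> 'I_M.+1} :=
  [ffun o => if o is Some j then l.1 j else l.2].
have hg : cancel h g by move=> l; apply/ffunP => -[j|]; rewrite !ffunE.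
have gh : cancel g h.
  by move=> [a b]; rewrite /h /g ffunE /=; congr pair; apply/ffunP => j; rewrite !ffunE.
rewrite (reindex h); last by exists g; move=> x _; [exact: hg|exact: gh].
apply: eq_big => l.
  congr A; rewrite /height /h /= addnC.
  rewrite (bigD1 None)//=; congr (_ + _)%N.
  rewrite (reindex_omap (fun j => Some j) id)/=; last by case.
  apply: eq_big => [j|j _]; first by rewrite eqxx.
  by rewrite ffunE.
by move=> _; congr G; apply/funext => -[j|]//=; rewrite ffunE.
Qed.

Section weighted_sums.
Variables (R : realType) (I : finType).

Lemma smolyak_tail (r : I -> R) i0 : 0 < r i0 -> (forall i, r i0 <= r i) ->
  exists K : R, forall L,
    \sum_(l : {ffun I -> 'I_L.+2} | (L < height l)%N) \prod_i expR (- r i * (l i)%:R) <=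
    K * (expR (- (r i0 * L%:R)) * L.+2%:R ^+ #|[pred i | r i == r i0]|.-1).
Proof.
move=> r0 rmin; pose y i := expR (r i0 - r i); pose z := expR (- r i0).
have y01 i : 0 <= y i <= 1.
  by rewrite expR_ge0/= -expR0 ler_expR subr_le0.
have yi0 : y i0 = 1 by rewrite /y subrr expR0.
have yE i : (y i == 1) = (r i == r i0).
  by rewrite /y -expR0 (inj_eq (@expR_inj R)) subr_eq0 eq_sym.
have z1 : z < 1 by rewrite /z -expR0 ltr_expR oppr_lt0.
set C := \prod_(i | y i != 1) (1 - y i)^-1.
have C0 : 0 <= C.
  by apply: prodr_ge0 => i _; rewrite invr_ge0 subr_ge0; have /andP[] := y01 i.
exists (z / (1 - z) * C) => L.
have E (l : {ffun I -> 'I_L.+2}) : \prod_i expR (- r i * (l i)%:R) = z ^+ height l * \prod_i y i ^+ l i.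
  rewrite /height -prodrXr -big_split/=; apply: eq_bigr => i _.
  rewrite /z /y -!expRM_natr -expRD; congr expR; ring.
under eq_bigr do rewrite E.
apply: le_trans (sum_by_height (fun t => L < t)%N (fun i => (andP (y01 i)).1) yi0 (expR_ge0 _) (ltnSn _)) _.
apply: (@le_trans _ _ ((z ^+ L.+1 / (1 - z)) * (L.+2%:R ^+ #|[pred i | y i == 1]|.-1 * C))).
  apply: ler_pM.
  - by apply: sumr_ge0 => t _; rewrite exprn_ge0// expR_ge0.
  - apply: prodr_ge0 => i _; apply: sumr_ge0 => k _; rewrite exprn_ge0//.
    by have /andP[] := y01 i.
  - by apply: geometric_tail => //; exact: expR_ge0.
  - exact: prod_geometric.
rewrite (eq_card (B := [pred i | r i == r i0])); last by move=> i; rewrite !inE yE.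
have -> : expR (- (r i0 * L%:R)) = z ^+ L by rewrite /z -expRM_natr mulNr.
rewrite exprS le_eqVlt; apply/orP; left; apply/eqP; ring.
Qed.

Lemma smolyak_head (s : I -> R) i0 : 0 < s i0 -> (forall i, s i <= s i0) ->
  exists K : R, 0 <= K /\ forall L,
    \sum_(l : {ffun I -> 'I_L.+1} | (height l <= L)%N) \prod_i expR (s i * (l i)%:R) <=
    K * (expR (s i0 * L%:R) * L.+1%:R ^+ #|[pred i | s i == s i0]|.-1).
Proof.
move=> s0 smax; pose y i := expR (s i - s i0); pose z := expR (s i0).
have y01 i : 0 <= y i <= 1.
  by rewrite expR_ge0/= -expR0 ler_expR subr_le0.
have yi0 : y i0 = 1 by rewrite /y subrr expR0.
have yE i : (y i == 1) = (s i == s i0).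
  by rewrite /y -expR0 (inj_eq (@expR_inj R)) subr_eq0.
have z1 : 1 < z by rewrite /z -expR0 ltr_expR.
set C := \prod_(i | y i != 1) (1 - y i)^-1.
have C0 : 0 <= C.
  by apply: prodr_ge0 => i _; rewrite invr_ge0 subr_ge0; have /andP[] := y01 i.
exists (z / (z - 1) * C); split.
  by rewrite mulr_ge0// divr_ge0// ?expR_ge0// subr_ge0 ltW.
move=> L.
have E (l : {ffun I -> 'I_L.+1}) : \prod_i expR (s i * (l i)%:R) = z ^+ height l * \prod_i y i ^+ l i.
  rewrite /height -prodrXr -big_split/=; apply: eq_bigr => i _.
  rewrite /z /y -!expRM_natr -expRD; congr expR; ring.
under eq_bigr do rewrite E.
have LT : (#|I| * L < (#|I| * L).+1 + L.+1)%N by rewrite ltnS leq_addr.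
apply: le_trans (sum_by_height (fun t => t <= L)%N (fun i => (andP (y01 i)).1) yi0 (expR_ge0 _) LT) _.
apply: (@le_trans _ _ ((z ^+ L * (z / (z - 1))) * (L.+1%:R ^+ #|[pred i | y i == 1]|.-1 * C))).
  apply: ler_pM.
  - by apply: sumr_ge0 => t _; rewrite exprn_ge0// expR_ge0.
  - apply: prodr_ge0 => i _; apply: sumr_ge0 => k _; rewrite exprn_ge0//.
    by have /andP[] := y01 i.
  - apply: le_trans (geometric_head L z1).
    by rewrite (big_nat_widen _ _ _ _ _ (leq_addl (#|I| * L).+1 L.+1)).
  - exact: prod_geometric.
rewrite (eq_card (B := [pred i | s i == s i0])); last by move=> i; rewrite !inE yE.
have -> : expR (s i0 * L%:R) = z ^+ L by rewrite /z -expRM_natr.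
rewrite le_eqVlt; apply/orP; left; apply/eqP; ring.
Qed.

End weighted_sums.

(** * Choice of the level *)

Section level_choice.
Variable R : realType.

Lemma pow_le_exp (r : R) p : 0 < r ->
  exists C : R, 0 < C /\ forall L, L.+2%:R ^+ p <= C * expR (r * L%:R).
Proof.
move=> r0; pose a := r / p.+1%:R; have a0 : 0 < a by rewrite divr_gt0.
exists ((2 + a^-1) ^+ p); split; first by rewrite exprn_gt0// addr_gt0// invr_gt0.
move=> L; have b : L.+2%:R <= (2 + a^-1) * expR (a * L%:R).
  apply: (@le_trans _ _ ((2 + a^-1) * (1 + a * L%:R))).
    have -> : (2 + a^-1) * (1 + a * L%:R) = 2 + 2 * (a * L%:R) + a^-1 + L%:R.
      by field; rewrite gt_eqF.
    have -> : L.+2%:R = L%:R + 2 :> R by rewrite -addn2 natrD.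
    have h1 : 0 <= a^-1 by rewrite invr_ge0 ltW.
    have h2 : 0 <= a * L%:R by rewrite mulr_ge0// ltW.
    lra.
  by rewrite ler_wpM2l ?expR_ge1Dx// addr_ge0// invr_ge0 ltW.
apply: (@le_trans _ _ (((2 + a^-1) * expR (a * L%:R)) ^+ p)).
  by rewrite lerXn2r ?nnegrE// mulr_ge0 ?expR_ge0// addr_ge0// invr_ge0 ltW.
rewrite exprMn ler_wpM2l ?exprn_ge0 ?addr_ge0 ?invr_ge0 ?(ltW a0)//.
rewrite -expRM_natr ler_expR mulrAC ler_wpM2r//.
by rewrite /a mulrAC ler_pdivrMr// ler_wpM2l ?ltW// ltr_nat.
Qed.

(** Let L be the least level with error at most eps.  The error at L - 1 exceeds
    eps, hence exp (r L) is at most of order L^p / eps; since the error decays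
    at least like exp (- r L / 2), L is of order |ln eps|.  The work is
    exp (r L)^rho L^p. *)
Lemma choose_level (K1 K2 r rho : R) p : 0 < K1 -> 0 <= K2 -> 0 < r -> 0 < rho ->
  exists2 eps0 : R, 0 < eps0 & exists c : R, forall eps : R, 0 < eps < eps0 ->
  exists L : nat, K1 * (expR (- (r * L%:R)) * L.+2%:R ^+ p) <= eps /\
    K2 * (expR (rho * r * L%:R) * L.+1%:R ^+ p) <=
    c * eps `^ (- rho) * `|ln eps| `^ ((1 + rho) * p%:R).
Proof.
move=> K1_gt0 K2_ge0 r0 rho0.
have r2 : 0 < r / 2 by rewrite divr_gt0.
have [C [C0 hC]] := pow_le_exp p r2.
pose err L : R := K1 * (expR (- (r * L%:R)) * L.+2%:R ^+ p).
have err_le L : err L <= K1 * C * expR (- (r / 2 * L%:R)).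
  rewrite /err -mulrA ler_pM2l//.
  apply: (@le_trans _ _ (expR (- (r * L%:R)) * (C * expR (r / 2 * L%:R)))).
    by rewrite ler_wpM2l ?expR_ge0.
  rewrite mulrCA -expRD ler_pM2l// ler_expR le_eqVlt; apply/orP; left; apply/eqP.
  by field.
pose B := (`|ln (K1 * C)| + 1) / (r / 2) + 2.
have B0 : 0 < B by rewrite addr_gt0// divr_gt0// ltr_wpDl.
(* Below exp (-1), constants are absorbed in |ln eps| >= 1; below the error at
   level 0, the least level is positive. *)
exists (Num.min (expR (-1)) (err 0)).
  by rewrite lt_min expR_gt0 /= /err !mulr_gt0// ?expR_gt0// exprn_gt0.
exists (K2 * ((expR r * K1 * B ^+ p) `^ rho * B ^+ p)) => eps /andP[e0].
rewrite lt_min => /andP[e1 eerr].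
have ln1 : 1 <= - ln eps.
  have : ln eps < ln (expR (-1)) by rewrite ltr_ln ?posrE ?expR_gt0.
  by rewrite expRK; lra.
have nln : `|ln eps| = - ln eps by rewrite ler0_norm//; lra.
have small : exists L, err L <= eps.
  exists (`|Num.ceil (B * - ln eps)|%N); set L := `|_|%N.
  have LB : B * - ln eps <= L%:R.
    have h : 0 <= B * - ln eps by rewrite mulr_ge0 ?(ltW B0)//; lra.
    have h2 : (0 <= Num.ceil (B * - ln eps))%R by rewrite ceil_ge0 (lt_le_trans _ h)// ltrN10.
    apply: (le_trans (ceil_ge _)).
    by rewrite /L natr_absz ger0_norm.
  apply: (le_trans (err_le _)).
  rewrite -[K1 * C]lnK ?posrE ?mulr_gt0// -expRD -[leRHS]lnK ?posrE// ler_expR.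
  have h : r / 2 * (B * - ln eps) <= r / 2 * L%:R by rewrite ler_pM2l.
  have h2 : r / 2 * (B * - ln eps) = (`|ln (K1 * C)| + 1 + r) * - ln eps.
    by rewrite /B; field; rewrite gt_eqF.
  have h3 : ln (K1 * C) <= `|ln (K1 * C)| * - ln eps.
    by rewrite (le_trans (ler_norm _))// ler_peMr.
  have h4 : 0 <= r * - ln eps by rewrite mulr_ge0 ?ltW//; lra.
  move: h h2 h3 h4; rewrite !mulrDl mul1r; set u := r / 2 * _; set v := r / 2 * _; lra.
case: (ex_minnP small) => -[|L] errL Lmin; first by move: errL; rewrite leNgt eerr.
exists L.+1; split; first exact: errL.
have {}Lmin : eps < err L by rewrite ltNge; apply/negP => /Lmin; rewrite ltnn.
have LB : L.+2%:R <= B * - ln eps.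
  have := lt_le_trans Lmin (err_le L).
  rewrite -[K1 * C]lnK ?posrE ?mulr_gt0// -expRD -[ltLHS]lnK ?posrE// ltr_expR => h.
  have h1 : L%:R <= (`|ln (K1 * C)| + 1) / (r / 2) * - ln eps.
    rewrite mulrAC ler_pdivlMr// mulrC.
    have h3 : ln (K1 * C) <= `|ln (K1 * C)| * - ln eps.
      by rewrite (le_trans (ler_norm _))// ler_peMr.
    by rewrite mulrDl mul1r; lra.
  by rewrite /B mulrDl -addn2 natrD; lra.
have expL : expR (r * L.+1%:R) <= expR r * K1 * B ^+ p * (- ln eps) ^+ p / eps.
  have -> : expR (r * L.+1%:R) = expR r * expR (r * L%:R).
    by rewrite -expRD -addn1 natrD; congr expR; ring.
  rewrite -!mulrA ler_pM2l ?expR_gt0// mulrA mulrA ler_pdivlMr//.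
  rewrite -mulrA -exprMn.
  apply: (@le_trans _ _ (K1 * L.+2%:R ^+ p)).
    move: (ltW Lmin); rewrite /err expRN => h.
    have := ler_wpM2l (ltW (expR_gt0 (r * L%:R))) h.
    move/le_trans; apply; rewrite le_eqVlt; apply/orP; left; apply/eqP.
    by field; rewrite gt_eqF// expR_gt0.
  rewrite ler_pM2l// lerXn2r ?nnegrE// mulr_ge0 ?(ltW B0)//; lra.
have expL' : expR (rho * r * L.+1%:R) <=
   (expR r * K1 * B ^+ p) `^ rho * (- ln eps) `^ (rho * p%:R) * eps `^ (- rho).
  have -> : expR (rho * r * L.+1%:R) = expR (r * L.+1%:R) `^ rho.
    by rewrite -expRM; congr expR; ring.
  apply: (@le_trans _ _ ((expR r * K1 * B ^+ p * (- ln eps) ^+ p / eps) `^ rho)).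
    rewrite ge0_ler_powR ?nnegrE ?expR_ge0 ?(ltW rho0)//.
    exact: le_trans (expR_ge0 _) expL.
  have q0 : 0 <= expR r * K1 * B ^+ p.
    by rewrite !mulr_ge0 ?expR_ge0 ?(ltW K1_gt0)// exprn_ge0// ltW.
  rewrite powRM ?invr_ge0 ?(ltW e0)//; last by rewrite mulr_ge0// exprn_ge0//; lra.
  rewrite powRM//; last by rewrite exprn_ge0//; lra.
  have -> : eps^-1 `^ rho = eps `^ (- rho) by rewrite -powR_inv1 ?(ltW e0)// -powRrM mulN1r.
  have <- : (- ln eps) `^ p%:R = (- ln eps) ^+ p by apply: powR_mulrn; lra.
  by rewrite -powRrM [p%:R * _]mulrC.
rewrite nln mulrDl mul1r powRD; last by apply/implyP => _; rewrite gt_eqF//; lra.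
rewrite powR_mulrn; last lra.
rewrite -!mulrA ler_wpM2l//.
apply: (@le_trans _ _ ((expR r * K1 * B ^+ p) `^ rho * (- ln eps) `^ (rho * p%:R) * eps `^ (- rho) * (B * - ln eps) ^+ p)).
  apply: ler_pM => //; first by rewrite mulrA.
  by rewrite lerXn2r ?nnegrE// mulr_ge0 ?(ltW B0)//; lra.
rewrite exprMn [expR r * (K1 * _)]mulrA; set u := _ `^ rho; set v := eps `^ _.
by set w := _ `^ (rho * _); rewrite le_eqVlt; apply/orP; left; apply/eqP; ring.
Qed.

End level_choice.

(** * Mesh sizes, rates and work *)

Section smolyak_rates.
Variables (R : realType) (d n : nat) (D : 'I_n -> {set 'I_d}).
Variables (beta : 'I_n -> R) (kappa gamma : R).
Hypothesis D_gt0 : forall j, (0 < #|D j|)%N.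
Hypothesis beta_gt0 : forall j, 0 < beta j.
Hypothesis kappa_gt0 : 0 < kappa.
Hypothesis gamma_gt0 : 0 < gamma.

(** The index [None] stands for the solver. *)
Definition work_rate (o : option 'I_n) : R :=
  if o is Some j then #|D j|%:R / beta j else gamma / kappa.

Definition error_decay o : R := (1 + work_rate o)^-1.
Definition work_growth o : R := work_rate o * error_decay o.

Lemma work_rate_gt0 o : 0 < work_rate o.
Proof. by case: o => [j|] /=; rewrite divr_gt0// ltr0n. Qed.

Lemma error_decay_gt0 o : 0 < error_decay o.
Proof. by rewrite invr_gt0 addr_gt0// work_rate_gt0. Qed.

Lemma level_ge (t : R) l : expR (l%:R / t) <= (level t l)%:R.
Proof.
have h : (0 <= Num.ceil (expR (l%:R / t)))%R.
  by rewrite ceil_ge0 (lt_le_trans _ (expR_ge0 _))// ltrN10.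
by rewrite /level natr_absz ger0_norm// ceil_ge.
Qed.

Lemma level_gt0 (t : R) l : (0 < level t l)%N.
Proof. by rewrite -(@ltr0n R) (lt_le_trans _ (level_ge t l))// expR_gt0. Qed.

Lemma level_le (t : R) l : 0 < t -> (level t l)%:R <= 2 * expR (l%:R / t).
Proof.
move=> t0; have h : (0 <= Num.ceil (expR (l%:R / t)))%R.
  by rewrite ceil_ge0 (lt_le_trans _ (expR_ge0 _))// ltrN10.
rewrite /level natr_absz ger0_norm//.
have h1 := ltW (ceilB1_lt (expR (l%:R / t))).
have h2 : 1 <= expR (l%:R / t) by rewrite -expR0 ler_expR divr_ge0// ltW.
move: h1; rewrite intrD; lra.
Qed.

Lemma level_decay (t a : R) l : 0 <= a ->
  (level t l)%:R `^ (- a) <= expR (- (a * (l%:R / t))).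
Proof.
move=> a0; have N0 : 0 < (level t l)%:R :> R by rewrite ltr0n level_gt0.
rewrite powRN expRN lef_pV2 ?posrE ?powR_gt0 ?expR_gt0//.
by rewrite mulrC expRM ge0_ler_powR ?nnegrE ?expR_ge0 ?level_ge// ltW.
Qed.

Lemma quad_growth j k : (quad_level D beta j k)%:R <= 2 * expR (work_growth (Some j) * k%:R).
Proof.
have D0 : 0 < #|D j|%:R :> R by rewrite ltr0n.
have b0 := beta_gt0 j.
apply: le_trans (level_le _ _) _; first by rewrite addr_gt0// divr_gt0.
rewrite ler_pM2l// ler_expR /work_growth /error_decay /= le_eqVlt; apply/orP; left; apply/eqP.
by field; rewrite !gt_eqF//= addr_gt0.
Qed.

Lemma quad_decay j k : (quad_level D beta j k)%:R `^ (- (beta j / #|D j|%:R)) <=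
  expR (- error_decay (Some j) * k%:R).
Proof.
have D0 : 0 < #|D j|%:R :> R by rewrite ltr0n.
have b0 := beta_gt0 j.
apply: le_trans (level_decay _ _ _) _; first by rewrite ltW// divr_gt0.
rewrite ler_expR /error_decay /= le_eqVlt; apply/orP; left; apply/eqP.
by field; rewrite !gt_eqF//= addr_gt0.
Qed.

Lemma sample_growth k : (sample_level kappa gamma k)%:R `^ gamma <=
  2 `^ gamma * expR (work_growth None * k%:R).
Proof.
have g0 := gamma_gt0; have k0 := kappa_gt0.
apply: (@le_trans _ _ ((2 * expR (k%:R / (gamma + kappa))) `^ gamma)).
  rewrite ge0_ler_powR ?nnegrE ?mulr_ge0 ?expR_ge0 ?(ltW g0)//.
  by rewrite level_le// addr_gt0.
rewrite powRM ?expR_ge0// ler_wpM2l ?powR_ge0// -expRM ler_expR.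
rewrite /work_growth /error_decay /= le_eqVlt; apply/orP; left; apply/eqP.
by field; rewrite !gt_eqF//= addr_gt0.
Qed.

Lemma sample_decay k : (sample_level kappa gamma k)%:R `^ (- kappa) <=
  expR (- error_decay None * k%:R).
Proof.
have g0 := gamma_gt0; have k0 := kappa_gt0.
apply: le_trans (level_decay _ _ _) _; first exact: ltW.
rewrite ler_expR /error_decay /= le_eqVlt; apply/orP; left; apply/eqP.
by field; rewrite !gt_eqF//= addr_gt0.
Qed.

(** Each of the terms obtained by expanding the differences is at most the one
    in which all factors are taken at the upper level. *)
Lemma work_bound (cost : nat -> R) (c : R) L : 0 <= c ->
  (forall N, (0 < N)%N -> cost N <= c * N%:R `^ gamma) ->
  smolyak_work D beta kappa gamma cost L <=
  c * (2 `^ gamma * 2 ^+ n * #|{: {ffun 'I_n -> bool} * bool}|%:R) *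
  \sum_(l : {ffun option 'I_n -> 'I_L.+1} | (height l <= L)%N)
     \prod_o expR (work_growth o * (l o)%:R).
Proof.
move=> c0 hc; pose G (l : option 'I_n -> nat) : R := \prod_o expR (work_growth o * (l o)%:R).
have G0 l : 0 <= G l by apply: prodr_ge0 => o _; exact: expR_ge0.
rewrite -(sum_option L (fun t => t <= L)%N G) mulr_sumr.
rewrite /smolyak_work [leLHS]big_mkcond [leRHS]big_mkcond; apply: ler_sum => l _.
set K := c * _.
have K0 : 0 <= K by rewrite !mulr_ge0// ?powR_ge0// exprn_ge0.
case: ifP => [/and3P[_ _ ->]|_]; last by case: ifP => // _; rewrite mulr_ge0.
set Gl := G _.
apply: (@le_trans _ _ (\sum_(e : {ffun 'I_n -> bool} * bool) c * (2 `^ gamma * 2 ^+ n * Gl))); last first.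
  rewrite sumr_const /K.
  have -> (m : nat) : c * (2 `^ gamma * 2 ^+ n * m%:R) * Gl = c * (2 `^ gamma * 2 ^+ n * Gl) *+ m.
    by rewrite -mulr_natr; ring.
  exact: lexx.
have gle o (a b : nat) : (a <= b)%N -> expR (work_growth o * a%:R) <= expR (work_growth o * b%:R).
  move=> ab; rewrite ler_expR ler_wpM2l ?ler_nat//.
  by rewrite mulr_ge0// ltW// ?work_rate_gt0 ?error_decay_gt0.
rewrite big_mkcond; apply: ler_sum => e _; case: ifP => _; last first.
  by rewrite !mulr_ge0 ?powR_ge0 ?exprn_ge0//; exact: G0.
have GE : Gl = (\prod_(j < n) expR (work_growth (Some j) * (l.1 j)%:R)) * expR (work_growth None * l.2%:R).
  rewrite /Gl /G (bigD1 None)//= mulrC; congr (_ * _).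
  rewrite (reindex_omap (fun j => Some j) id)/=; last by case.
  by apply: eq_bigl => j; rewrite eqxx.
have N0 : (0 < sample_level kappa gamma (l.2 - e.2))%N by exact: level_gt0.
apply: (@le_trans _ _ ((\prod_(j < n) (2 * expR (work_growth (Some j) * (l.1 j)%:R))) *
   (c * (2 `^ gamma * expR (work_growth None * l.2%:R))))).
  apply: (@le_trans _ _ ((\prod_(j < n) (quad_level D beta j (l.1 j - e.1 j))%:R) *
    (c * (sample_level kappa gamma (l.2 - e.2))%:R `^ gamma))).
    by rewrite ler_wpM2l ?hc//; apply: prodr_ge0.
  apply: ler_pM.
  - exact: prodr_ge0.
  - by rewrite mulr_ge0// powR_ge0.
  - apply: ler_prod => j _; rewrite ler0n/=.
    by apply: le_trans (quad_growth _ _) _; rewrite ler_pM2l// gle// leq_subr.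
  - rewrite ler_wpM2l//; apply: le_trans (sample_growth _) _.
    by rewrite ler_wpM2l ?powR_ge0// gle// leq_subr.
rewrite big_split/= prodr_const card_ord GE le_eqVlt; apply/orP; left; apply/eqP; ring.
Qed.

End smolyak_rates.

(** * Increments completed by an exact level *)

Section telescoping.

Definition increment (V : zmodType) (X : nat -> V) k : V := X k - X k.-1.

Lemma sum_increment (V : zmodType) (X : nat -> V) M : X 0%N = 0 ->
  \sum_(k < M.+1) increment X k = X M.
Proof.
move=> X0; elim: M => [|M IHM]; first by rewrite big_ord1 /increment /= subrr X0.
by rewrite big_ord_recr /= IHM /increment /= addrC subrK.
Qed.

(** Level 0 is zero and the level after [L] is exact; only the levels between
    belong to the algorithm. *)
Definition stage (V : zmodType) (top : V) (a : nat -> V) (L k : nat) : V :=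
  if k == 0%N then 0 else if (k <= L)%N then a k else top.

Lemma stage_increment (V : zmodType) (top : V) (a : nat -> V) (N : nat -> nat) L k :
  (0 < k <= L)%N ->
  increment (stage top (fun k => a (N k)) L) k = level_diff a N k.
Proof.
case: k => [//|k] /= kL; rewrite /increment /stage /level_diff /= kL.
by case: k kL => [//|k] kL /=; rewrite (ltnW kL).
Qed.

End telescoping.

Section block_increments.
Variables (R : realType) (m : nat) (Gamma : set (m.-tuple R)) (P : probability (m.-tuple R) R).
Variables (beta : R) (Q : nat -> (m.-tuple R -> R) -> R) (c r : R) (N : nat -> nat).
Local Notation tup := (m.-tuple R).
Hypothesis r_ge0 : 0 <= r.
Hypothesis m_gt0 : (0 < m)%N.
Hypothesis beta_gt : m%:R / 2 < beta.
Hypothesis mGamma : measurable Gamma.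
Hypothesis quadQ : forall k, is_quadrature Gamma (N k) (Q (N k)).
Let I (f : tup -> R) : R := \int[P]_(y in Gamma) f y.
Hypothesis errQ : forall k, (opnorm (iso_norm_on beta Gamma) (fun f => (I f - Q (N k) f)%R)
  <= (c * expR (- r * k%:R))%:E)%E.

Lemma tame_sub (l1 l2 : (tup -> R) -> R) : tame Gamma l1 -> tame Gamma l2 -> tame Gamma (l1 - l2).
Proof.
move=> g1 g2; rewrite (_ : l1 - l2 = fun f => l1 f + (-1) * l2 f); first exact: tame_comb.
by apply/funext => f; rewrite mulN1r.
Qed.

Lemma dualsq_sub (l1 l2 : (tup -> R) -> R) : tame Gamma l1 -> tame Gamma l2 ->
  dualsq beta (l1 - l2) <= 2 * dualsq beta l1 + 2 * dualsq beta l2.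
Proof.
move=> g1 g2.
have i1 := dualsq_intgr m_gt0 beta_gt g1; have i2 := dualsq_intgr m_gt0 beta_gt g2.
have i3 := dualsq_intgr m_gt0 beta_gt (tame_sub g1 g2).
have j1 := intgrZ 2 i1; have j2 := intgrZ 2 i2.
rewrite /dualsq -(RintegralZl _ measurableT i1) -(RintegralZl _ measurableT i2) -(RintegralD measurableT j1 j2).
apply: intgr_le => //; first exact: (intgrD j1 j2).
move=> w; have b0 := ltW (bessel_gt0 beta w).
have -> : Lcos (l1 - l2) w = Lcos l1 w - Lcos l2 w by [].
have -> : Lsin (l1 - l2) w = Lsin l1 w - Lsin l2 w by [].
rewrite mulrCA [2 * (_ * (Lcos l2 w ^+ 2 + _))]mulrCA -mulrDr ler_wpM2l//.
move: (Lcos l1 w) (Lcos l2 w) (Lsin l1 w) (Lsin l2 w) => a b a' b'.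
have := sqr_ge0 (a + b); have := sqr_ge0 (a' + b'); rewrite !expr2; lra.
Qed.

Let X L := stage I (fun k => Q (N k)) L.

Lemma stage_tame L k : tame Gamma (X L k).
Proof.
rewrite /X /stage; case: ifP => _; first exact: tame_zero.
by case: ifP => _; [exact: tame_quadrature (quadQ k)|exact: tame_integral].
Qed.

Lemma increment_tame L k : tame Gamma (increment (X L) k).
Proof. by apply: tame_sub; exact: stage_tame. Qed.

(** An increment is a difference of two errors I - X_k: the error of level 0 is
    the norm of the integral itself, the one of level L + 1 vanishes, and the
    others are bounded by hypothesis.  The constant does not depend on [L]. *)
Lemma increment_bound : exists2 A : R, 0 <= A & forall L k,
  dualsq beta (increment (X L) k) <= A * expR (- r * k%:R) ^+ 2.
Proof.
have dge0 l : 0 <= dualsq beta l.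
  apply: Rintegral_ge0 => w _; rewrite mulr_ge0 ?addr_ge0 ?sqr_ge0//.
  exact: ltW (bessel_gt0 beta w).
pose A := dualsq beta I + (c / cfour R m) ^+ 2.
have A0 : 0 <= A by rewrite addr_ge0 ?sqr_ge0.
have gI : tame Gamma I by exact: tame_integral.
have gerr L k : tame Gamma (I - X L k) by apply: tame_sub => //; exact: stage_tame.
have err L k : dualsq beta (I - X L k) <= A * expR (- r * k%:R) ^+ 2.
  case: k => [|k].
    rewrite /X /stage /= subr0 mulr0 expR0 expr1n mulr1.
    by rewrite /A lerDl sqr_ge0.
  rewrite /X /stage /=; case: ifP => kL.
    apply: (@le_trans _ _ ((c * expR (- r * k.+1%:R) / cfour R m) ^+ 2)).
      have g := gerr L k.+1; rewrite /X /stage /= kL in g.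
      exact: (dualsq_opnorm m_gt0 beta_gt g (errQ _)).
    rewrite mulrAC exprMn ler_wpM2r ?sqr_ge0//.
    by rewrite /A lerDr.
  rewrite subrr (_ : dualsq beta 0 = 0); first by rewrite mulr_ge0// sqr_ge0.
  rewrite /dualsq; under eq_Rintegral do rewrite /Lcos /Lsin /= expr0n /= addr0 mulr0.
  by rewrite Rintegral_cst// mul0r.
exists (2 * (A * expR r ^+ 2) + 2 * A).
  by rewrite addr_ge0// mulr_ge0// mulr_ge0// sqr_ge0.
move=> L k.
have -> : increment (X L) k = (I - X L k.-1) - (I - X L k).
  by apply/funext => f; rewrite /increment !fctE; ring.
apply: (le_trans (dualsq_sub (gerr L k.-1) (gerr L k))).
rewrite [leRHS](_ : _ = 2 * (A * (expR r ^+ 2 * expR (- r * k%:R) ^+ 2)) + 2 * (A * expR (- r * k%:R) ^+ 2)); last by ring.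
apply: lerD; last by rewrite ler_pM2l// err.
rewrite ler_pM2l//; apply: (le_trans (err L k.-1)).
rewrite ler_wpM2l// -exprMn -expRD lerXn2r ?nnegrE ?expR_ge0// ler_expR.
case: k => [|k]; first by rewrite mulr0 addr0.
by rewrite /= -addn1 natrD mulrDr mulr1; lra.
Qed.

End block_increments.

Section sample_increments.
Variables (R : realType) (d n : nat) (D : 'I_n -> {set 'I_d}).
Variable beta : 'I_n -> R.
Local Notation leb := (lebesgue_tuple R d).
Local Notation tup := (d.-tuple R).
Local Notation W := (sobolev_weight D beta).
Hypothesis Dpart : block_partition D.
Hypothesis beta_gt : forall j, #|D j|%:R / 2 < beta j.
Variables (Gamma : forall j, set (#|D j|.-tuple R)).
Implicit Types Z : tup -> R[i].

Lemma frep_sub (h1 h2 : tup -> R) Z1 Z2 : frep Gamma h1 Z1 -> frep Gamma h2 Z2 ->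
  frep Gamma (h1 - h2) (Z1 - Z2).
Proof.
move=> [[i1 j1] e1] [[i2 j2] e2].
have ReB w : complex.Re ((Z1 - Z2) w) = complex.Re (Z1 w) - complex.Re (Z2 w) by rewrite fctE raddfB.
have ImB w : complex.Im ((Z1 - Z2) w) = complex.Im (Z1 w) - complex.Im (Z2 w) by rewrite fctE raddfB.
split.
  split; first by under eq_fun do rewrite ReB; exact: intgrB.
  by under eq_fun do rewrite ImB; exact: intgrB.
move=> y yG; rewrite [LHS](_ : _ = h1 y - h2 y)// (e1 y yG) (e2 y yG).
have osc Z : cintgr Z -> intgr leb (fun w => complex.Re (Z w) * cos (dotp w y) - complex.Im (Z w) * sin (dotp w y)).
  move=> [i j]; apply: intgrB.
    by apply: (intgrM i _ (fun w => cos_max _)); apply: (measurableT_comp (@measurable_cos R)); exact: measurable_dotp.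
  by apply: (intgrM j _ (fun w => sin_max _)); apply: (measurableT_comp (@measurable_sin R)); exact: measurable_dotp.
have o1 := osc _ (conj i1 j1); have o2 := osc _ (conj i2 j2).
rewrite -(RintegralB measurableT o1 o2).
by apply: eq_Rintegral => w _; rewrite ReB ImB; ring.
Qed.

Lemma sqr_normc_sub (z1 z2 : R[i]) : sqr_normc (z1 - z2) <= 2 * sqr_normc z1 + 2 * sqr_normc z2.
Proof.
case: z1 => a b; case: z2 => a' b'; rewrite /sqr_normc /=.
have := sqr_ge0 (a + a'); have := sqr_ge0 (b + b'); rewrite !expr2; lra.
Qed.

Lemma wintgr_sub Z1 Z2 : wintgr D beta Z1 -> wintgr D beta Z2 ->
  wintgr D beta (Z1 - Z2) /\
  wnorm D beta (Z1 - Z2) <= 2 * wnorm D beta Z1 + 2 * wnorm D beta Z2.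
Proof.
move=> [[m1 k1] i1] [[m2 k2] i2].
have ReB w : complex.Re ((Z1 - Z2) w) = complex.Re (Z1 w) - complex.Re (Z2 w) by rewrite fctE raddfB.
have ImB w : complex.Im ((Z1 - Z2) w) = complex.Im (Z1 w) - complex.Im (Z2 w) by rewrite fctE raddfB.
have mZ : cmeas (Z1 - Z2).
  split; first by under eq_fun do rewrite ReB; exact: measurable_funB.
  by under eq_fun do rewrite ImB; exact: measurable_funB.
have j1 := intgrZ 2 i1; have j2 := intgrZ 2 i2.
have le w : W w ^+ 2 * sqr_normc ((Z1 - Z2) w) <= 2 * (W w ^+ 2 * sqr_normc (Z1 w)) + 2 * (W w ^+ 2 * sqr_normc (Z2 w)).
  rewrite mulrCA [2 * (_ * sqr_normc (Z2 w))]mulrCA -mulrDr ler_wpM2l ?sqr_ge0//.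
  exact: sqr_normc_sub.
have iZ : wintgr D beta (Z1 - Z2).
  split=> //; apply: (intgr_dom (intgrD j1 j2)).
    apply: measurable_funM; last exact: sqr_normc_meas.
    by apply: measurable_funX; exact: weight_meas.
  by move=> w; rewrite ger0_norm// mulr_ge0 ?sqr_normc_ge0// sqr_ge0.
split => //; rewrite /wnorm -(RintegralZl _ measurableT i1) -(RintegralZl _ measurableT i2).
rewrite -(RintegralD measurableT j1 j2).
by apply: intgr_le => //; [exact: iZ.2|exact: (intgrD j1 j2)].
Qed.

Lemma wintgr0 : wintgr D beta 0 /\ wnorm D beta 0 = 0.
Proof.
have z w : W w ^+ 2 * sqr_normc ((0 : tup -> R[i]) w) = 0 by rewrite /sqr_normc /= !expr0n /= addr0 mulr0.
split; last by rewrite /wnorm; under eq_Rintegral do rewrite z; rewrite Rintegral_cst// mul0r.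
split; first by split; exact: measurable_cst.
by under eq_fun do rewrite z; exact: intgr0.
Qed.

Variables (q : tup -> R) (qa : nat -> tup -> R) (c r : R).
Hypothesis r_ge0 : 0 <= r.
Hypothesis qS : sobolev_on D beta (prod_domain Gamma) q.
Hypothesis errq : forall k, (sobolev_norm_on D beta (prod_domain Gamma) (fun y => (q y - qa k y)%R)
  <= (c * expR (- r * k%:R))%:E)%E.

(** The same bound for the samples.  [Za k] is defined from [Zq] by subtracting
    a representation of the error, not from the k-th sample directly, so that
    the small norm of the error carries over to the representation. *)
Lemma sample_increments : exists (Zq : tup -> R[i]) (Za : nat -> tup -> R[i]),
  [/\ frep Gamma q Zq, forall k, frep Gamma (qa k) (Za k),
   forall L k, wintgr D beta (increment (stage Zq Za L) k) &
   exists2 A : R, 0 <= A & forall L k, 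
     wnorm D beta (increment (stage Zq Za L) k) <= A * expR (- r * k%:R) ^+ 2].
Proof.
have [Zq [hq wq _]] : exists Z, [/\ frep Gamma q Z, wintgr D beta Z & True].
  move: qS; rewrite /sobolev_on /=; set s := sobolev_norm_on _ _ _ _ => s_lt.
  have [C sC] : exists C : R, (s < C%:E)%E.
    case: s s_lt => [x|//|] _; last by exists 0; exact: ltNyr.
    by exists (x + 1); rewrite lte_fin ltrDl.
  by have [Z [h1 h2 _]] := frep_of_norm Dpart beta_gt sC; exists Z.
have /choice[Ze hZe] : forall k, exists Z, [/\ frep Gamma (q - qa k) Z, wintgr D beta Z &
    wnorm D beta Z <= (cfour R d * ((`|c| + 1) * expR (- r * k%:R))) ^+ 2].
  move=> k; apply: (frep_of_norm Dpart beta_gt); apply: (le_lt_trans (errq k)).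
  by rewrite lte_fin ltr_pM2r ?expR_gt0// ltr_pwDr// ler_norm.
pose Za k := Zq - Ze k.
have wa k : wintgr D beta (Za k) by have [_ w _] := hZe k; have [] := wintgr_sub wq w.
exists Zq, Za.
have ws L k : wintgr D beta (stage Zq Za L k).
  rewrite /stage; case: ifP => _; first exact: wintgr0.1.
  by case: ifP.
split => //.
- move=> k; have [h _ _] := hZe k; have := frep_sub hq h.
  by congr frep; apply/funext => y; rewrite !fctE; ring.
- by move=> L k; have [] := wintgr_sub (ws L k) (ws L k.-1).
have wn0 Z : 0 <= wnorm D beta Z.
  by apply: Rintegral_ge0 => w _; rewrite mulr_ge0 ?sqr_normc_ge0// sqr_ge0.
pose A := wnorm D beta Zq + (cfour R d * (`|c| + 1)) ^+ 2.
have A0 : 0 <= A by rewrite addr_ge0 ?sqr_ge0.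
have err L k : wintgr D beta (Zq - stage Zq Za L k) /\
    wnorm D beta (Zq - stage Zq Za L k) <= A * expR (- r * k%:R) ^+ 2.
  split; first by have [] := wintgr_sub wq (ws L k).
  case: k => [|k].
    rewrite /stage /= subr0 mulr0 expR0 expr1n mulr1.
    by rewrite /A lerDl sqr_ge0.
  rewrite /stage /=; case: ifP => kL.
    have -> : Zq - Za k.+1 = Ze k.+1 by rewrite /Za opprB addrC subrK.
    have [_ _ h] := hZe k.+1; apply: (le_trans h).
    by rewrite mulrA exprMn ler_wpM2r ?sqr_ge0// /A lerDr.
  by rewrite subrr wintgr0.2 mulr_ge0// sqr_ge0.
exists (2 * (A * expR r ^+ 2) + 2 * A).
  by rewrite addr_ge0// mulr_ge0// mulr_ge0// sqr_ge0.
move=> L k.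
have -> : increment (stage Zq Za L) k = (Zq - stage Zq Za L k.-1) - (Zq - stage Zq Za L k).
  by apply/funext => w; rewrite /increment !fctE; ring.
have [w1 b1] := err L k.-1; have [w2 b2] := err L k.
apply: (le_trans (wintgr_sub w1 w2).2).
rewrite [leRHS](_ : _ = 2 * (A * (expR r ^+ 2 * expR (- r * k%:R) ^+ 2)) + 2 * (A * expR (- r * k%:R) ^+ 2)); last by ring.
apply: lerD; last by rewrite ler_pM2l.
rewrite ler_pM2l//; apply: (le_trans b1).
rewrite ler_wpM2l// -exprMn -expRD lerXn2r ?nnegrE ?expR_ge0// ler_expR.
case: k {w1 b1 w2 b2} => [|k]; first by rewrite mulr0 addr0.
by rewrite /= -addn1 natrD mulrDr mulr1; lra.
Qed.

End sample_increments.

(** * The remainder of the Smolyak sum *)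

Section smolyak_remainder.
Variables (R : realType) (d n : nat) (D : 'I_n -> {set 'I_d}).
Variables (beta : 'I_n -> R) (kappa gamma : R).
Local Notation leb := (lebesgue_tuple R d).
Local Notation tup := (d.-tuple R).
Hypothesis Dpart : block_partition D.
Variables (Gamma : forall j, set (#|D j|.-tuple R)).
Variables (I : forall j, (#|D j|.-tuple R -> R) -> R).
Variables (Q : forall j, nat -> (#|D j|.-tuple R -> R) -> R).
Variables (qN : nat -> tup -> R) (Zq : tup -> R[i]) (Za : nat -> tup -> R[i]) (L : nat).

Definition quad_increment j k : (#|D j|.-tuple R -> R) -> R :=
  increment (stage (@I j) (fun k => @Q j (quad_level D beta j k)) L) k.

(** The integrand of the term of multi-index [l], on the frequency side. *)
Definition smolyak_term (l : option 'I_n -> nat) (w : tup) : R[i] :=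
  increment (stage Zq Za L) (l None) w *
  \prod_(j < n) Lhat (fun j => @quad_increment j (l (Some j))) j w.

Hypothesis tame_increment : forall j k, tame (@Gamma j) (@quad_increment j k).
Hypothesis frep_sample : forall k, frep Gamma (qN (sample_level kappa gamma k)) (Za k).
Hypothesis cintgr_increment : forall k, cintgr (increment (stage Zq Za L) k).

Lemma smolyak_term_intgr l : intgr leb (fun w => complex.Re (smolyak_term l w)).
Proof.
exact: (prod_Lhat_cintgr (fun j => tame_increment j (l (Some j))) (index_enum 'I_n) (cintgr_increment (l None))).1.
Qed.

Lemma Lhat_telescope j w :
  Lhat I j w = \sum_(k < L.+2) Lhat (fun j => @quad_increment j k) j w.
Proof.
pose X k := Lhat (fun j => stage (@I j) (fun k => @Q j (quad_level D beta j k)) L k) j w.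
have X0 : X 0%N = 0 by [].
have := sum_increment L.+1 X0.
rewrite {2}/X /stage /= ltnn => <-.
by apply: eq_bigr.
Qed.

Lemma sample_telescope w : Zq w = \sum_(k < L.+2) increment (stage Zq Za L) k w.
Proof.
pose X k := stage Zq Za L k w.
have X0 : X 0%N = 0 by [].
have := sum_increment L.+1 X0.
rewrite {2}/X /stage /= ltnn => <-.
by apply: eq_bigr.
Qed.

(** Expand the product of the telescoping sums under the integral sign. *)
Lemma expectation_telescope :
  \int[leb]_w complex.Re (Zq w * \prod_(j < n) Lhat I j w) =
  \sum_(l : {ffun option 'I_n -> 'I_L.+2}) \int[leb]_w complex.Re (smolyak_term (fun o => l o) w).
Proof.
have := sum_option L.+1 predT (fun l => \int[leb]_w complex.Re (smolyak_term l w)).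
rewrite /= => <-.
rewrite -(@Rint_sum _ _ _ leb); last by move=> l _ _; exact: smolyak_term_intgr.
apply: eq_Rintegral => w _; rewrite -raddf_sum; congr complex.Re.
rewrite sample_telescope; under eq_bigr do rewrite Lhat_telescope.
rewrite bigA_distr_bigA mulrC big_distrl/=.
under eq_bigr do rewrite big_distrr/=.
rewrite pair_bigA/=; apply: eq_bigr => l _; rewrite /smolyak_term mulrC; congr (_ * _).
Qed.

Lemma frep_increment k : (0 < k <= L)%N ->
  frep Gamma (level_diff qN (sample_level kappa gamma) k) (increment (stage Zq Za L) k).
Proof.
move=> kL; rewrite [X in frep _ _ X](@stage_increment _ Zq Za id L k kL) /level_diff; apply: frep_sub; first exact: frep_sample.
case: ifP => _; first exact: frep_sample.
split; first by split; exact: intgr0.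
move=> y _; under eq_Rintegral do rewrite /= !mul0r subr0.
by rewrite Rintegral_cst// mul0r.
Qed.

(** For height at most L, no exact level occurs, hence the terms are those of
    the algorithm; terms with a level 0 vanish. *)
Lemma smolyak_partial_sum : smolyak beta kappa gamma Q qN L =
  \sum_(l : {ffun option 'I_n -> 'I_L.+2} | (height l <= L)%N)
    \int[leb]_w complex.Re (smolyak_term (fun o => l o) w).
Proof.
pose G l := \int[leb]_w complex.Re (smolyak_term l w).
rewrite -(widen_sum L G) -(sum_option L (fun t => t <= L)%N G) /smolyak.
rewrite [LHS]big_mkcond [RHS]big_mkcond; apply: eq_bigr => l _.
rewrite /admissible; case: (boolP [forall j, (0 < l.1 j)%N]) => /= [/forallP l1|].
  case: (posnP l.2) => [l2|l2] /=.
    case: ifP => // _; rewrite /G /smolyak_term l2.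
    have z w : increment (stage Zq Za L) 0 w = 0 by rewrite /increment subrr.
    under eq_Rintegral do rewrite z mul0r /=.
    by rewrite Rintegral_cst// mul0r.
  case: ifP => // lL.
  have l2L : (l.2 <= L)%N by rewrite (leq_trans _ lL)// leq_addl.
  have l1L j : (l.1 j <= L)%N.
    by rewrite (leq_trans _ lL)// (bigD1 j)//= -addnA leq_addr.
  rewrite /G /smolyak_term.
  have -> : (fun j => level_diff (@Q j) (quad_level D beta j) (l.1 j)) =
      (fun j => @quad_increment j (l.1 j)).
    by apply: functional_extensionality_dep => j; rewrite /quad_increment stage_increment// l1 l1L.
  by rewrite (tensor_fourier Dpart (fun j => tame_increment j (l.1 j)) (Z := increment (stage Zq Za L) l.2))//; apply: frep_increment; rewrite l2.
rewrite negb_forall => /existsP[j]; rewrite -eqn0Ngt => /eqP l1j.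
case: ifP => // _; rewrite /G /smolyak_term.
have z w : \prod_(j < n) Lhat (fun j => @quad_increment j (l.1 j)) j w = 0.
  rewrite (bigD1 j)//= [X in X * _](_ : _ = 0) ?mul0r//.
  by rewrite /Lhat l1j /quad_increment /increment subrr.
under eq_Rintegral do rewrite z mulr0 /=.
by rewrite Rintegral_cst// mul0r.
Qed.

Theorem smolyak_remainder :
  \int[leb]_w complex.Re (Zq w * \prod_(j < n) Lhat I j w) - smolyak beta kappa gamma Q qN L =
  \sum_(l : {ffun option 'I_n -> 'I_L.+2} | (L < height l)%N)
    \int[leb]_w complex.Re (smolyak_term (fun o => l o) w).
Proof.
rewrite expectation_telescope smolyak_partial_sum.
rewrite (bigID (fun l : {ffun option 'I_n -> 'I_L.+2} => height l <= L)%N)/= addrAC subrr add0r.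
by apply: eq_bigl => l; rewrite ltnNge.
Qed.

End smolyak_remainder.

(** * Error bound and conclusion *)

Section extreme_rates.
Variables (R : realType) (d n : nat) (D : 'I_n -> {set 'I_d}).
Variables (beta : 'I_n -> R) (kappa gamma : R).
Hypothesis D_gt0 : forall j, (0 < #|D j|)%N.
Hypothesis beta_gt0 : forall j, 0 < beta j.
Hypothesis kappa_gt0 : 0 < kappa.
Hypothesis gamma_gt0 : 0 < gamma.
Local Notation rate := (work_rate D beta kappa gamma).
Local Notation rho := (smolyak_rho D beta kappa gamma).

Let s : seq (option 'I_n) := None :: [seq Some j | j <- enum 'I_n].

Let mem_s o : o \in s.
Proof. by case: o => [j|]; rewrite inE//= map_f// mem_enum. Qed.

Let work_ratesE : work_rates D beta kappa gamma = [seq rate o | o <- s].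
Proof. by rewrite /work_rates /s /= -map_comp. Qed.

Lemma smolyak_rho_max : exists2 i0, rate i0 = rho & forall o, rate o <= rho.
Proof.
have ub o : rate o <= rho.
  by rewrite /smolyak_rho work_ratesE big_map; apply: le_bigmax_seq.
exists [arg max_(o > None) rate o]%O => //.
case: Order.TotalTheory.arg_maxP => // i _ imax; apply/le_anti; rewrite ub /=.
rewrite /smolyak_rho work_ratesE big_map; apply: bigmax_le => [|o _]; last exact: imax.
exact/ltW/work_rate_gt0.
Qed.

Lemma smolyak_n0_card : smolyak_n0 D beta kappa gamma = #|[pred o | rate o == rho]|.
Proof.
rewrite /smolyak_n0 work_ratesE count_map cardE -size_filter.
have us : uniq s.
  rewrite /s /= map_inj_uniq ?enum_uniq ?andbT; last by move=> ? ? [].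
  by apply/mapP => -[].
apply: perm_size; apply: uniq_perm => [||o].
- exact: filter_uniq.
- exact: enum_uniq.
- by rewrite mem_filter mem_s andbT mem_enum.
Qed.

End extreme_rates.

Section error_bound.
Variables (R : realType) (d n : nat) (D : 'I_n -> {set 'I_d}).
Variables (Gamma : forall j, set (#|D j|.-tuple R)).
Variables (P_ : forall j, probability (#|D j|.-tuple R) R).
Variables (P : probability (d.-tuple R) R).
Variables (beta : 'I_n -> R) (kappa gamma : R).
Variables (q : d.-tuple R -> R) (qN : nat -> d.-tuple R -> R).
Variables (Q : forall j, nat -> (#|D j|.-tuple R -> R) -> R).
Hypothesis Dpart : block_partition D.
Hypothesis mGamma : forall j, measurable (@Gamma j).
Hypothesis PGamma : forall j, P_ j (@Gamma j) = 1%E.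
Hypothesis Pprod : is_product_measure P_ P.
Hypothesis beta_gt : forall j, #|D j|%:R / 2 < beta j.
Hypothesis kappa_gt0 : 0 < kappa.
Hypothesis gamma_gt0 : 0 < gamma.
Hypothesis qS : sobolev_on D beta (prod_domain Gamma) q.
Hypothesis errq : exists c : R, forall N, (0 < N)%N ->
  (sobolev_norm_on D beta (prod_domain Gamma) (fun y => (q y - qN N y)%R)
    <= (c * N%:R `^ (- kappa))%:E)%E.
Hypothesis quadQ : forall j N, (0 < N)%N -> is_quadrature (@Gamma j) N (@Q j N).
Hypothesis errQ : forall j, exists c : R, forall N, (0 < N)%N ->
  (opnorm (iso_norm_on (beta j) (@Gamma j))
     (fun f => (\int[P_ j]_(y in @Gamma j) f y - @Q j N f)%R)
    <= (c * N%:R `^ (- (beta j / #|D j|%:R)))%:E)%E.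
Local Notation decay := (error_decay D beta kappa gamma).

Lemma smolyak_error : exists2 K : R, 0 <= K & forall L,
  `|\int[P]_(y in prod_domain Gamma) q y - smolyak beta kappa gamma Q qN L| <=
  K * \sum_(l : {ffun option 'I_n -> 'I_L.+2} | (L < height l)%N)
     \prod_o expR (- decay o * (l o)%:R).
Proof.
have D0 j := block_gt0 Dpart j.
have b0 j : 0 < beta j by rewrite (le_lt_trans _ (beta_gt j))// divr_ge0.
have dec0 o : 0 < decay o by exact: error_decay_gt0.
have blocks j : exists A : R, 0 <= A /\ forall L k,
    dualsq (beta j) (quad_increment beta (@integrals_on R d n D P_ Gamma) Q L (j := j) k) <=
    A * expR (- decay (Some j) * k%:R) ^+ 2.
  have [c hc] := errQ j.
  have e k : (opnorm (iso_norm_on (beta j) (@Gamma j))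
      (fun f => (\int[P_ j]_(y in @Gamma j) f y - @Q j (quad_level D beta j k) f)%R)
      <= (`|c| * expR (- decay (Some j) * k%:R))%:E)%E.
    apply: (le_trans (hc _ (level_gt0 _ _))); rewrite lee_fin.
    apply: (@le_trans _ _ (`|c| * (quad_level D beta j k)%:R `^ (- (beta j / #|D j|%:R)))).
      by rewrite ler_wpM2r ?powR_ge0// ler_norm.
    by rewrite ler_wpM2l// quad_decay.
  have [A A0 hA] := increment_bound (ltW (dec0 (Some j))) (D0 j) (beta_gt j) (@mGamma j)
    (fun k => quadQ j (level_gt0 _ _)) e.
  by exists A.
have /choice[A hA] := blocks.
have [c hc] := errq.
have e k : (sobolev_norm_on D beta (prod_domain Gamma) (fun y => (q y - qN (sample_level kappa gamma k) y)%R)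
    <= (`|c| * expR (- decay None * k%:R))%:E)%E.
  apply: (le_trans (hc _ (level_gt0 _ _))); rewrite lee_fin.
  apply: (@le_trans _ _ (`|c| * (sample_level kappa gamma k)%:R `^ (- kappa))).
    by rewrite ler_wpM2r ?powR_ge0// ler_norm.
  by rewrite ler_wpM2l// sample_decay.
have [Zq [Za [hq ha wZ [B B0 hB]]]] := sample_increments Dpart beta_gt (ltW (dec0 None)) qS e.
pose K2 := B * \prod_(j < n) A j.
have K20 : 0 <= K2 by rewrite mulr_ge0// prodr_ge0// => j _; have [] := hA j.
exists (Num.sqrt K2) => [|L]; first exact: sqrtr_ge0.
have gi j k : tame (@Gamma j) (quad_increment beta (@integrals_on R d n D P_ Gamma) Q L (j := j) k).
  apply: increment_tame; first exact: mGamma.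
  by move=> k'; apply: quadQ; exact: level_gt0.
rewrite (expectation_fourier Dpart Pprod mGamma PGamma hq).
rewrite (smolyak_remainder Dpart gi ha); last by move=> k; exact: wintgr_cintgr (wZ L k).
apply: (le_trans (ler_norm_sum _ _ _)); rewrite mulr_sumr; apply: ler_sum => l _.
have p0 : 0 <= \prod_o expR (- decay o * (l o)%:R) by apply: prodr_ge0 => o _; exact: expR_ge0.
rewrite -[leLHS]sqrtr_sqr -[X in _ * X](ger0_norm p0) -[X in _ * X]sqrtr_sqr -sqrtrM//.
rewrite ler_wsqrtr//.
have := tensor_bound Dpart beta_gt (fun j => gi j (l (Some j))) (wZ L (l None)).
move/le_trans; apply.
have -> : \prod_o expR (- decay o * (l o)%:R) =
    expR (- decay None * (l None)%:R) * \prod_(j < n) expR (- decay (Some j) * (l (Some j))%:R).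
  rewrite (bigD1 None)//=; congr (_ * _).
  rewrite (reindex_omap (fun j => Some j) id)/=; last by case.
  by apply: eq_bigl => j; rewrite eqxx.
rewrite exprMn /K2 mulrACA; apply: ler_pM => //.
- by apply: Rintegral_ge0 => w _; rewrite mulr_ge0 ?sqr_normc_ge0// sqr_ge0.
- apply: prodr_ge0 => j _; apply: Rintegral_ge0 => w _.
  by rewrite mulr_ge0 ?addr_ge0 ?sqr_ge0//; exact: ltW (bessel_gt0 _ _).
rewrite -prodrXl -big_split/=; apply: ler_prod => j _.
rewrite (hA j).2 andbT; apply: Rintegral_ge0 => w _.
by rewrite mulr_ge0 ?addr_ge0 ?sqr_ge0//; exact: ltW (bessel_gt0 _ _).
Qed.

End error_bound.

Theorem theorem4p1 (R : realType) (d n : nat) (D : 'I_n -> {set 'I_d})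
  (Gamma : forall j, set (#|D j|.-tuple R))
  (P_ : forall j, probability (#|D j|.-tuple R) R)
  (P : probability (d.-tuple R) R)
  (beta : 'I_n -> R) (kappa gamma : R)
  (q : d.-tuple R -> R) (qN : nat -> d.-tuple R -> R)
  (Q : forall j, nat -> (#|D j|.-tuple R -> R) -> R)
  (tau : nat -> R) :
  block_partition D ->
  (forall j, measurable (Gamma j)) ->
  (forall j, P_ j (Gamma j) = 1%E) ->
  is_product_measure P_ P ->
  (forall j, #|D j|%:R / 2 < beta j) ->
  0 < kappa ->
  0 < gamma ->
  sobolev_on D beta (prod_domain Gamma) q ->
  (forall N, (0 < N)%N -> sobolev_on D beta (prod_domain Gamma) (qN N)) ->
  (exists c : R, forall N, (0 < N)%N ->
     (sobolev_norm_on D beta (prod_domain Gamma) (fun y => (q y - qN N y)%R)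
        <= (c * N%:R `^ (- kappa))%:E)%E) ->
  (forall j N, (0 < N)%N -> is_quadrature (Gamma j) N (Q j N)) ->
  (forall j, exists c : R, forall N, (0 < N)%N ->
     (opnorm (iso_norm_on (beta j) (Gamma j))
             (fun f => (\int[P_ j]_(y in Gamma j) f y - Q j N f)%R)
        <= (c * N%:R `^ (- (beta j / #|D j|%:R)))%:E)%E) ->
  (exists c : R, forall N, (0 < N)%N -> tau N <= c * N%:R `^ gamma) ->
  let E := \int[P]_(y in prod_domain Gamma) q y in
  let S := smolyak beta kappa gamma Q qN in
  let rho := smolyak_rho D beta kappa gamma in
  let n0 := smolyak_n0 D beta kappa gamma in
  exists eps0 : R, 0 < eps0 /\ exists c : R,
    forall eps : R, 0 < eps < eps0 ->
    exists L : nat,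
      let bound := c * eps `^ (- rho) * `|ln eps| `^ ((1 + rho) * (n0%:R - 1)) in
      [/\ `|E - S L| <= eps,
          smolyak_work D beta kappa gamma (fun N => N%:R `^ gamma) L <= bound &
          smolyak_work D beta kappa gamma tau L <= bound].
Proof.
move=> Dpart mGamma PGamma Pprod beta_gt kappa_gt0 gamma_gt0 qS qNS errq quadQ errQ [ctau htau] E S rho n0.
have D0 j := block_gt0 Dpart j.
have b0 j : 0 < beta j by rewrite (le_lt_trans _ (beta_gt j))// divr_ge0.
pose rate := work_rate D beta kappa gamma.
pose decay := error_decay D beta kappa gamma.
pose growth := work_growth D beta kappa gamma.
have rate0 o : 0 < rate o by exact: work_rate_gt0.
have dec0 o : 0 < decay o by exact: error_decay_gt0.
have [i0 i0rho rhomax] := smolyak_rho_max D0 b0 kappa_gt0 gamma_gt0.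
rewrite -/rho -/rate in i0rho rhomax.
have rho0 : 0 < rho by rewrite -i0rho.
have growthE o : growth o = 1 - decay o.
  rewrite /growth /work_growth -/rate -/decay /decay /error_decay -/rate.
  by field; rewrite gt_eqF// addr_gt0.
have decE o : (decay o == decay i0) = (rate o == rho).
  rewrite /decay /error_decay (inj_eq invr_inj) -/rate (inj_eq (addrI 1)).
  by rewrite i0rho.
have decmin o : decay i0 <= decay o.
  rewrite /decay /error_decay -/rate lef_pV2 ?posrE ?addr_gt0// lerD2l.
  by rewrite i0rho.
have n0E : n0 = #|[pred o | rate o == rho]| by exact: smolyak_n0_card.
pose p := n0.-1.
have n0p : (n0 = p.+1)%N.
  rewrite prednK// n0E; apply/card_gt0P; exists i0.
  by rewrite inE i0rho.
have [Kerr Kerr0 hKerr] := smolyak_error Dpart mGamma PGamma Pprod beta_gt kappa_gt0 gamma_gt0 qS errq quadQ errQ.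
have [Kt hKt] := smolyak_tail (dec0 i0) decmin.
have gr0 : 0 < growth i0 by rewrite mulr_gt0.
have grmax o : growth o <= growth i0 by rewrite !growthE lerD2l lerN2.
have [Kh [Kh0 hKh]] := smolyak_head gr0 grmax.
have pE : #|[pred o | decay o == decay i0]|.-1 = p.
  by rewrite /p n0E; congr _.-1; apply: eq_card => o; rewrite !inE decE.
have pE' : #|[pred o | growth o == growth i0]|.-1 = p.
  rewrite -pE; congr _.-1; apply: eq_card => o; rewrite !inE !growthE.
  by rewrite (inj_eq (addrI 1)) (inj_eq oppr_inj).
pose C := (1 + `|ctau|) * (2 `^ gamma * 2 ^+ n * #|{: {ffun 'I_n -> bool} * bool}|%:R).
have C0 : 0 <= C by rewrite mulr_ge0 ?addr_ge0// !mulr_ge0// ?powR_ge0// exprn_ge0.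
have K10 : 0 < `|Kerr * Kt| + 1 by rewrite ltr_wpDl.
have [eps0 eps00 [c hc]] := choose_level p K10 (mulr_ge0 C0 Kh0) (dec0 i0) rho0.
exists eps0; split => //; exists c => eps epsI.
have [L [errL workL]] := hc eps epsI; exists L => bound.
have work cost : (forall N, (0 < N)%N -> cost N <= (1 + `|ctau|) * N%:R `^ gamma) ->
    smolyak_work D beta kappa gamma cost L <= bound.
  move=> hcost; have ct0 : 0 <= 1 + `|ctau| by rewrite addr_ge0.
  apply: (le_trans (work_bound D0 b0 kappa_gt0 gamma_gt0 L ct0 hcost)).
  rewrite -/C; apply: (le_trans (ler_wpM2l C0 (hKh L))).
  rewrite pE' mulrA /bound n0p -[p.+1%:R]natr1 addrK.
  by move: workL; rewrite /growth /work_growth -/rate -/decay i0rho !mulrA.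
split.
- apply: (le_trans (hKerr L)); apply: le_trans errL.
  apply: (le_trans (ler_wpM2l Kerr0 (hKt L))).
  rewrite pE [leLHS]mulrA ler_wpM2r//.
  by rewrite (le_trans (ler_norm _))// lerDl.
- by apply: work => N N0; rewrite ler_peMl ?powR_ge0// lerDl.
- apply: work => N N0; apply: (le_trans (htau N N0)).
  rewrite ler_wpM2r ?powR_ge0// (le_trans (ler_norm _))//.
  by rewrite lerDr.
Qed.
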